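(* Let $(X,\mathcal{A},m)$ be a probability space, $T:X\to X$ a measurable map that is non-singular with respect to $m$, and $P:L^1(m)\to L^1(m)$ its Perron-Frobenius operator. Let $\mathcal{B}\subset L^1(m)$ be a subspace with a norm $\|\cdot\|_{\mathcal{B}}$ satisfying conditions (1)-(7) listed in the context, and assume that $1$ is a simple eigenvalue of $P$ on $\mathcal{B}$ and that $P$ has no other eigenvalue of modulus $1$ on $\mathcal{B}$. Let $\mu$ be the unique $T$-invariant probability measure with $\mu\ll m$ and $\frac{d\mu}{dm}\in\mathcal{B}$. Let $\phi:X\to\mathbb{R}$ be a bounded function belonging to $\mathcal{B}$ with $\int\phi\,d\mu=0$, and put $S_n=\sum_{k=0}^{n-1}\phi\circ T^k$. Then the limit $\sigma^2=\lim_{n\to\infty}\int\left(\frac{S_n}{\sqrt{n}}\right)^2 d\mu$ exists. Moreover, if $\sigma^2>0$, then there exist $\epsilon_0>0$ and a function $c:\,]-\epsilon_0,+\epsilon_0[\,\to\mathbb{R}$ that is continuous, strictly convex and vanishes only at $0$, such that for every $0<\epsilon<\epsilon_0$ and every probability measure $\nu$ with $\nu\ll m$ and $\frac{d\nu}{dm}\in\mathcal{B}$, $$\lim_{n\to\infty}\frac{1}{n}\log\nu(S_n>n\epsilon)=-c(\epsilon).$$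
   Context: All function spaces consist of ($m$-a.e. equivalence classes of) complex-valued functions. The Perron-Frobenius (transfer) operator $P:L^1(m)\to L^1(m)$ of $T$ is defined by $Pf=\frac{dm_f}{dm}$, where $m_f(A)=\int_{T^{-1}A}f\,dm$; equivalently $\int f\,(g\circ T)\,dm=\int (Pf)\,g\,dm$ for $f\in L^1(m)$, $g\in L^\infty(m)$. Conditions on $\mathcal{B}$: (1) $(\mathcal{B},\|\cdot\|_{\mathcal{B}})$ is a complex Banach space and the inclusion $\mathcal{B}\to L^1(m)$ is continuous; (2) constant functions lie in $\mathcal{B}$; (3) there is $C>0$ such that for all $f,g\in\mathcal{B}$, $fg\in\mathcal{B}$ and $\|fg\|_{\mathcal{B}}\le C\|f\|_{\mathcal{B}}\|g\|_{\mathcal{B}}$ (Banach algebra); (4) $\mathcal{B}$ is a complex Banach lattice: for every $f\in\mathcal{B}$, $\bar f\in\mathcal{B}$ and $|f|\in\mathcal{B}$; (5) $P(\mathcal{B})\subset\mathcal{B}$; (6) $P$ is a bounded operator on $\mathcal{B}$ with spectral radius equal to $1$; (7) $P$ is quasi-compact of diagonal type on $\mathcal{B}$: there is a decomposition $P=\sum_{i=1}^s\lambda_i\Pi_i+Q$, where the $\lambda_i$ are complex numbers of modulus $1$, the $\Pi_i$ are finite-rank projections with $\Pi_i\Pi_j=0$ for $i\ne j$, and $Q$ is a bounded operator on $\mathcal{B}$ with spectral radius strictly less than $1$ and $Q\Pi_i=\Pi_iQ=0$ for all $i$. Under these conditions and the simplicity of the eigenvalue $1$, there is exactly one $T$-invariant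 probability measure $\mu\ll m$ with density in $\mathcal{B}$. *)

(* Defs.v *)
From mathcomp Require Export all_boot all_order all_algebra.
From mathcomp Require Export complex.
From mathcomp Require Export all_classical all_reals all_analysis.

Set Implicit Arguments.
Unset Strict Implicit.
Unset Printing Implicit Defensive.

Export Order.TTheory GRing.Theory Num.Theory.
Export numFieldNormedType.Exports.

Global Open Scope classical_set_scope.
Global Open Scope ring_scope.
Global Open Scope complex_scope.

(* The library integrates real and extended real functions only, so complex
   functions are treated through their real and imaginary parts. An element of
   L^1(m) is represented by a function f : X -> R[i] with [L1C m f]; equality in
   L^1(m) is [ae_eq m setT]. *)
Section ComplexL1.
Context {d : measure_display} {X : measurableType d} {R : realType}.
Variable m : {measure set X -> \bar R}.

Definition L1C (f : X -> R[i]) : Prop :=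
  m.-integrable setT (fun x => (complex.Re (f x))%:E) /\
  m.-integrable setT (fun x => (complex.Im (f x))%:E).

Definition integralC (A : set X) (f : X -> R[i]) : R[i] :=
  Rintegral m A (fun x => complex.Re (f x)) +i*
  Rintegral m A (fun x => complex.Im (f x)).

Definition L1normC (f : X -> R[i]) : \bar R :=
  (\int[m]_x (complex.Re `|f x|)%:E)%E.

(* P f is the density with respect to m of A |-> \int_(T^-1 A) f dm. This
   determines P f up to m-almost everywhere equality. *)
Definition perron_frobenius (T : X -> X) (P : (X -> R[i]) -> X -> R[i]) : Prop :=
  forall f, L1C f -> L1C (P f) /\
    forall A, measurable A -> integralC A (P f) = integralC (T @^-1` A) f.

End ComplexL1.

Section Operators.
Context {R : realType} {B : normedModType R[i]}.
Implicit Types (P Q : {linear B -> B}) (l : R[i]).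

Definition invertible_operator (F : B -> B) : Prop :=
  exists S : {linear B -> B},
    [/\ continuous S, forall f, S (F f) = f & forall f, F (S f) = f].

Definition spectrum P : set R[i] :=
  [set l | ~ invertible_operator (fun f => l *: f - P f)].

Definition spectral_radius P : \bar R :=
  ereal_sup [set (complex.Re `|l|)%:E | l in spectrum P].

Definition eigenvalue_of P l : Prop := exists f : B, f != 0 /\ P f = l *: f.

(* Algebraic multiplicity one: the generalized eigenspace, i.e. the union over
   k of the kernels of (P - l)^k, is a line. *)
Definition simple_eigenvalue P l : Prop :=
  exists h : B, [/\ h != 0, P h = l *: h &
    forall (k : nat) (f : B),
      iter k (fun g => P g - l *: g) f = 0 -> exists a : R[i], f = a *: h].

Definition finite_rank P : Prop :=
  exists (n : nat) (e : 'I_n -> B),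
    forall f, exists a : 'I_n -> R[i], P f = \sum_(i < n) a i *: e i.

Definition quasi_compact_diagonal P : Prop :=
  exists (s : nat) (lam : 'I_s -> R[i]) (Pi : 'I_s -> {linear B -> B})
         (Q : {linear B -> B}),
    [/\ forall f, P f = \sum_(i < s) lam i *: Pi i f + Q f,
        forall i, `|lam i| = 1,
        (forall i, [/\ continuous (Pi i), finite_rank (Pi i) &
                       forall f, Pi i (Pi i f) = Pi i f]) /\
        (forall i j, i != j -> forall f, Pi i (Pi j f) = 0),
        continuous Q /\ (spectral_radius Q < 1)%E &
        forall i f, Q (Pi i f) = 0 /\ Pi i (Q f) = 0].

End Operators.

(* A subspace of L^1(m) with its own complete norm is a Banach space B together
   with an injective linear map into L^1(m); [iota b] is a representative of
   the class of b, so linearity and injectivity hold modulo m-a.e. equality. *)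
Section FunctionSpace.
Context {d : measure_display} {X : measurableType d} {R : realType}.
Variables (m : probability X R) (B : completeNormedModType R[i]).
Variable iota : B -> X -> R[i].

Definition L1_subspace : Prop :=
  [/\ forall b, L1C m (iota b),
      forall (a : R[i]) (b b' : B),
        ae_eq m setT (iota (a *: b + b')) (fun x => a * iota b x + iota b' x) &
      forall b, ae_eq m setT (iota b) (cst 0) -> b = 0].

Definition mem_space (f : X -> R[i]) : Prop :=
  exists b, ae_eq m setT (iota b) f.

Definition continuous_inclusion : Prop :=
  forall b : B,
    L1normC m (fun x => iota b' x - iota b x) @[b' --> b] --> (0%E : \bar R).

Definition contains_constants : Prop := forall a : R[i], mem_space (cst a).

Definition banach_algebra : Prop :=
  exists C : R, 0 < C /\ forall f g : B, exists h : B,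
    ae_eq m setT (iota h) (fun x => iota f x * iota g x) /\
    `|h| <= C%:C * `|f| * `|g|.

Definition complex_banach_lattice : Prop :=
  forall f : B, mem_space (fun x => (iota f x)^*) /\
                mem_space (fun x => `|iota f x|).

Definition restriction_of (P : (X -> R[i]) -> X -> R[i]) (PB : B -> B) : Prop :=
  forall f : B, ae_eq m setT (iota (PB f)) (P (iota f)).

Definition density_in_space (nu : probability X R) : Prop :=
  nu `<< m /\
  mem_space
    (fun x => (fine (Radon_Nikodym (charge_of_finite_measure nu) m x))%:C).

End FunctionSpace.

Section Dynamics.
Context {d : measure_display} {X : measurableType d} {R : realType}.
Implicit Types (T : X -> X).

Definition nonsingular (m : {measure set X -> \bar R}) T : Prop :=
  pushforward m T `<< m.

Definition invariant_measure (mu : {measure set X -> \bar R}) T : Prop :=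
  forall A, measurable A -> mu (T @^-1` A) = mu A.

Definition birkhoff_sum T (phi : X -> R) (n : nat) (x : X) : R :=
  \sum_(0 <= k < n) phi (iter k T x).

End Dynamics.

Definition strictly_convex_on {R : realType} (D : set R) (c : R -> R) : Prop :=
  forall x y t : R, D x -> D y -> x != y -> 0 < t -> t < 1 ->
    c (t * x + (1 - t) * y) < t * c x + (1 - t) * c y.

(* Main.v *)
(** The Nagaev-Guivarc'h method. By quasi-compactness and simplicity of the
    eigenvalue 1, P f = (int f dm) h + Q f with Q a contraction in an adapted
    norm, where h is the density of mu. Put P_t f = P (e^(t phi) f), so that
    int e^(t S_n) g dm = int P_t^n g dm. For small real t the projective map
    f |-> P_t f / int P_t f dm is a contraction near h; its fixed point f_t
    satisfies P_t f_t = lambda_t f_t, and int P_t^n g dm is comparable to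
    |lambda_t|^n, uniformly enough to make L(t) = log |lambda_t| semiconcave
    (hence differentiable where t x - L(t) is maximal) and to have
    int e^(t S_n) dmu <= e^(n L(t)) (1 + O(t^2)) with a constant independent of n.

    For a density g in the space, P^k g tends to h, which gives the growth rate
    L(t) of int e^(t S_n) dnu on an interval of t independent of nu. The rate
    function c is the Legendre transform of L on a small interval; the upper bound
    is Chernoff's inequality and the lower bound an exponential change of measure,
    for which upper bounds on L near the maximizing t suffice.

    The variance of S_n is n sigma^2 + O(1) by decay of correlations. If sigma^2 > 0,
    comparing e^x >= 1 + x + x^2/4 at x = t S_n, for one large n, with the above
    bound e^(n L(t)) (1 + O(t^2)) gives L(t) > 0 for small t <> 0. *)

Require Import Defs.
From mathcomp Require Import measurable_realfun.
From mathcomp Require Import ring lra.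

Set Implicit Arguments.
Unset Strict Implicit.
Unset Printing Implicit Defensive.

(** * Moduli and real-valued norms *)

(** [spectral_radius] is defined through non-invertibility, so the fact that some iterate of Q
    contracts is itself to be proved (one direction of Gelfand's formula); an elementary resolvent
    argument does it, without complex analysis. The perturbation theory likewise avoids spectral
    projections, dual spaces and analyticity: t stays real, estimates are proved at a finite time n
    with a geometric error, and the error is then dropped. What comes out is an upper second-order
    bound on L(t) = log |lambda_t|, and the Legendre and tilting arguments are arranged to live on
    that.

    The delicate point is L(t) > 0. The prefactor of e^(n L(t)) has to be 1 + O(t^2), not just O(1),
    because it competes with 1 + t^2 var_n / 4 where |t| n is bounded. The square is a product of
    two errors of order t: the eigenvector is O(t) away from h, and the eigenfunctional is O(t) away
    from integration against m.

    Elements of the space are classes modulo null sets, so identities between operators are tested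
    by pairing with bounded measurable functions. *)

Notation cabs := ComplexField.Normc.normc.

Section ComplexModulus.
Variable R : realType.
Implicit Types z w : R[i].

Lemma cabsE z : (cabs z)%:C = `|z|. Proof. by []. Qed.

Lemma cabs_ge0 z : 0 <= cabs z.
Proof. by rewrite -lecR cabsE normr_ge0. Qed.

Lemma cabsD z w : cabs (z + w) <= cabs z + cabs w.
Proof. exact: le_normcD. Qed.

Lemma cabsM z w : cabs (z * w) = cabs z * cabs w.
Proof. exact: ComplexField.Normc.normcM. Qed.

Lemma cabsV z : cabs z^-1 = (cabs z)^-1.
Proof. exact: ComplexField.Normc.normcV. Qed.

Lemma cabs0 : cabs (0 : R[i]) = 0. Proof. exact: ComplexField.Normc.normc0. Qed.

Lemma cabs1 : cabs (1 : R[i]) = 1. Proof. exact: ComplexField.Normc.normc1. Qed.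

Lemma cabsN z : cabs (- z) = cabs z. Proof. exact: normcN. Qed.

Lemma cabsX z n : cabs (z ^+ n) = cabs z ^+ n.
Proof. by elim: n => [|n IH]; rewrite ?expr0 ?cabs1 // !exprS cabsM IH. Qed.

Lemma cabs_eq0 z : (cabs z == 0) = (z == 0).
Proof.
by apply/eqP/eqP => [/ComplexField.Normc.eq0_normc|->]; rewrite ?cabs0.
Qed.

Lemma cabsR (x : R) : cabs x%:C = `|x|.
Proof. by rewrite /= expr0n addr0 sqrtr_sqr. Qed.

Lemma cabs_distC z w : cabs (z - w) = cabs (w - z).
Proof. by rewrite -cabsN opprB. Qed.

Lemma Re_le_cabs z : `|complex.Re z| <= cabs z.
Proof. by rewrite -lecR cabsE; apply: normc_ge_Re. Qed.

Lemma Im_le_cabs z : `|complex.Im z| <= cabs z.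
Proof. by case: z => a b /=; rewrite -sqrtr_sqr ler_wsqrtr// lerDr sqr_ge0. Qed.

Lemma cabs_le_ReIm z : cabs z <= `|complex.Re z| + `|complex.Im z|.
Proof.
rewrite {1}[z]complexE -[X in _ <= X + _]cabsR -[X in _ <= _ + X]cabsR.
apply: (le_trans (cabsD _ _)); rewrite lerD2l cabsM.
by rewrite (_ : cabs 'i = 1) ?mul1r// /= expr0n expr1n add0r sqrtr1.
Qed.

Lemma cabs_ge_sub z w : cabs z - cabs w <= cabs (z + w).
Proof. by rewrite lerBlDr -{1}[z](addrK w) -[cabs w]cabsN cabsD. Qed.

Lemma ReM_real (x : R) z : complex.Re (x%:C * z) = x * complex.Re z.
Proof. by case: z => a b /=; rewrite mul0r subr0. Qed.

Lemma ReD z w : complex.Re (z + w) = complex.Re z + complex.Re w.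
Proof. by case: z w => [a b] [c e]. Qed.

Lemma ReN z : complex.Re (- z) = - complex.Re z. Proof. by case: z. Qed.

Lemma ReB z w : complex.Re (z - w) = complex.Re z - complex.Re w.
Proof. by rewrite ReD ReN. Qed.

Lemma cabs_sqr z : cabs z ^+ 2 = complex.Re z ^+ 2 + complex.Im z ^+ 2.
Proof. by case: z => a b /=; rewrite sqr_sqrtr// addr_ge0// sqr_ge0. Qed.

(** Applied with z = (s - t) times the logarithmic derivative of the eigenvalue: only the real part
    enters to first order, and the quadratic error is one-sided. Both sides are nonnegative, and
    their squares differ by |z|^2 |1 + z|^2 + (Re z)^2. *)
Lemma cabs_1D z : cabs (1 + z) <= 1 + complex.Re z + cabs z ^+ 2.
Proof.
have z2 := cabs_sqr z.
have w2 : cabs (1 + z) ^+ 2 = (1 + complex.Re z) ^+ 2 + complex.Im z ^+ 2.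
  by rewrite cabs_sqr; case: (z) => a b /=; rewrite add0r.
move: z2 w2; set x := complex.Re z; set y := complex.Im z.
set r := cabs z ^+ 2; set w := cabs (1 + z) => z2 w2.
have w0 : 0 <= w by exact: cabs_ge0.
have y0 : 0 <= y ^+ 2 by exact: sqr_ge0.
have x0 := sqr_ge0 x; have x1 := sqr_ge0 (x + 1 / 2).
have p : 0 <= 1 + x + r by rewrite z2; lra.
rewrite -(ler_pXn2r (ltn0Sn 1)) ?nnegrE// w2 -subr_ge0.
rewrite z2 (_ : _ - _ = (x ^+ 2 + y ^+ 2) * ((1 + x) ^+ 2 + y ^+ 2) + x ^+ 2).
  by rewrite addr_ge0// mulr_ge0 ?addr_ge0 ?sqr_ge0.
by ring.
Qed.

End ComplexModulus.
Arguments ComplexField.Normc.normc : simpl never.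

Section RealNorm.
Variables (R : realType) (B : normedModType R[i]).
Implicit Types (f g : B).

(* The library norm of [B] takes values in [R[i]]. *)
Definition nrm (f : B) : R := complex.Re `|f|.

Lemma nrmE f : (nrm f)%:C = `|f|.
Proof. by rewrite /nrm RRe_real// realE normr_ge0. Qed.

Lemma nrm_ge0 f : 0 <= nrm f. Proof. by rewrite -lecR nrmE normr_ge0. Qed.

Lemma nrmD f g : nrm (f + g) <= nrm f + nrm g.
Proof. by rewrite -lecR rmorphD/= !nrmE ler_normD. Qed.

Lemma nrmZ a f : nrm (a *: f) = cabs a * nrm f.
Proof. by apply: complexI; rewrite rmorphM/= !nrmE normrZ. Qed.

Lemma nrm0 : nrm (0 : B) = 0. Proof. by rewrite /nrm normr0. Qed.

Lemma nrm0_eq0 f : nrm f = 0 -> f = 0.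
Proof. by move=> f0; apply/normr0_eq0; rewrite -nrmE f0. Qed.

End RealNorm.

(** * Perturbation of a simple leading eigenvalue *)

Section RealSequences.
Variable R : realType.
Implicit Types (x C th : R) (u : nat -> R).

Lemma geometric_small C th e : 0 <= th < 1 -> 0 < e ->
  exists n0, forall n, (n0 <= n)%N -> C * th ^+ n < e.
Proof.
move=> /andP[th0 th1] e0.
have : (fun n => C * th ^+ n) @ \oo --> C * 0.
  by apply: cvgM; [exact: cvg_cst | apply: cvg_expr; rewrite ger0_norm].
rewrite mulr0 => /cvgrPdist_lt /(_ e e0) [n0 _ Hn0]; exists n0 => n nn0.
have := Hn0 n nn0; rewrite /= sub0r normrN => h.
exact: le_lt_trans (ler_norm _) h.
Qed.

(** The standard passage to the limit below: an inequality is proved at each time n up to a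
    geometric error, which is then dropped. *)
Lemma geometric_le x y C th : 0 <= th < 1 ->
  (forall n, x <= y + C * th ^+ n) -> x <= y.
Proof.
move=> th01 H; apply/ler_addgt0Pr => e e0.
have [n0 Hn0] := geometric_small C th01 e0.
by apply: le_trans (H n0) _; rewrite lerD2l ltW ?Hn0.
Qed.

(** Stated for any subadditive [N] because it serves the absolute value, complex moduli and the
    adapted norm. *)
Lemma telescope_geometric (T : zmodType) (N : T -> R) (v : nat -> T) C th :
  N 0 = 0 -> (forall f g, N (f + g) <= N f + N g) -> 0 <= th < 1 -> 0 <= C ->
  (forall n, N (v n.+1 - v n) <= C * th ^+ n) ->
  forall n k, N (v (n + k)%N - v n) <= C * th ^+ n / (1 - th).
Proof.
move=> N0 ND /andP[th0 th1] C0 vC n k.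
(* The factor 1 - th^k of the finite geometric sum is what closes the induction. *)
suff : N (v (n + k)%N - v n) <= C * th ^+ n * (1 - th ^+ k) / (1 - th).
  move=> /le_trans; apply; apply: ler_wpM2r.
    by rewrite invr_ge0 subr_ge0 ltW.
  by rewrite ler_piMr ?mulr_ge0 ?exprn_ge0// gerBl exprn_ge0.
elim: k => [|k IH]; first by rewrite addn0 subrr N0 expr0 subrr mulr0 mul0r.
rewrite addnS -(subrKA (v (n + k)%N)).
apply: (le_trans (ND _ _)); apply: (le_trans (lerD (vC _) IH)).
rewrite exprS exprD le_eqVlt; apply/orP; left; apply/eqP.
by field; rewrite subr_eq0 gt_eqF.
Qed.

Lemma geometric_cvg u C th : 0 <= th < 1 -> 0 <= C ->
  (forall n, `|u n.+1 - u n| <= C * th ^+ n) ->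
  exists l, forall n, `|u n - l| <= C * th ^+ n / (1 - th).
Proof.
move=> th01 C0 uC.
have tel := telescope_geometric (normr0 _) (@ler_normD _ _) th01 C0 uC.
have : cvg (u @ \oo).
  apply/cauchy_cvgP/cauchy_exP => e e0.
  have [n0 Hn0] := geometric_small (C / (1 - th)) th01 e0.
  exists (u n0); exists n0 => // n /= n0n; rewrite /ball /= distrC.
  rewrite -(subnKC n0n); apply: le_lt_trans (tel _ _) _.
  by rewrite mulrAC Hn0.
move=> /cvg_ex[l ul]; exists l => n; apply/ler_addgt0Pr => e e0.
have /cvgrPdist_lt /(_ e e0) [m _ Hm] := ul.
have := Hm (n + m)%N (leq_addl _ _); rewrite /= distrC => /ltW um.
rewrite -(subrKA (u (n + m)%N)); apply: (le_trans (ler_normD _ _)).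
by rewrite lerD// distrC tel.
Qed.

End RealSequences.

Section Perturbation.
Variables (R : realType) (V : lmodType R[i]) (N : V -> R).
Hypothesis ND : forall f g, N (f + g) <= N f + N g.
Hypothesis NZ : forall a f, N (a *: f) = cabs a * N f.
Hypothesis N_eq0 : forall f, N f = 0 -> f = 0.
Hypothesis N_complete : forall (u : nat -> V) (C th : R),
  0 <= th < 1 -> 0 <= C -> (forall n, N (u n.+1 - u n) <= C * th ^+ n) ->
  exists l, forall n, N (u n - l) <= C * th ^+ n / (1 - th).

(** In the application [l] is the integral against m, [P t] is f |-> P (e^(t phi) f), [D t] is its
    derivative in t, and [N] is a norm in which P contracts the kernel of [l] in one step. *)
Variables (l : V -> R[i]) (c : R).
Hypothesis l_linear : forall a f g, l (a *: f + g) = a * l f + l g.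
Hypothesis l_bounded : forall f, cabs (l f) <= c * N f.
Hypothesis c_ge0 : 0 <= c.

Variables (P D : R -> V -> V) (h : V) (th K : R).
Hypothesis P_linear : forall t a f g, P t (a *: f + g) = a *: P t f + P t g.
Hypothesis D_linear : forall t a f g, D t (a *: f + g) = a *: D t f + D t g.
Hypothesis K_ge0 : 0 <= K.
Hypothesis P_lip : forall s t f, `|s| <= 1 -> `|t| <= 1 ->
  N (P s f - P t f) <= K * `|s - t| * N f.
Hypothesis P_diff : forall s t f, `|s| <= 1 -> `|t| <= 1 ->
  N (P s f - P t f - (s - t)%:C *: D t f) <= K * `|s - t| ^+ 2 * N f.
Hypothesis D_bounded : forall t f, `|t| <= 1 -> N (D t f) <= K * N f.
Hypothesis th01 : 0 <= th < 1.
Hypothesis l_h : l h = 1.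
Hypothesis P0_h : P 0 h = h.
Hypothesis l_P0 : forall f, l (P 0 f) = l f.
Hypothesis P0_contract : forall g, l g = 0 -> N (P 0 g) <= th * N g.

Implicit Types (s t : R) (f g u : V) (n : nat).

Let N0 : N 0 = 0. Proof. by rewrite -(scale0r 0) NZ cabs0 mul0r. Qed.
Let NN f : N (- f) = N f.
Proof. by rewrite -scaleN1r NZ cabsN cabs1 mul1r. Qed.
Let N_ge0 f : 0 <= N f.
Proof. have := ND f (- f); rewrite subrr N0 NN; lra. Qed.
Let NB f g : N (f - g) <= N f + N g.
Proof. by rewrite -[N g]NN ND. Qed.
Let N_dist f g : N (f - g) = N (g - f). Proof. by rewrite -NN opprB. Qed.

Let l0 : l 0 = 0.
Proof.
have := l_linear 1 0 0; rewrite scaler0 addr0 mul1r => /eqP.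
by rewrite -subr_eq subrr eq_sym => /eqP. Qed.
Let lZ a f : l (a *: f) = a * l f.
Proof. by have := l_linear a f 0; rewrite !addr0 l0 addr0. Qed.
Let lD f g : l (f + g) = l f + l g.
Proof. by have := l_linear 1 f g; rewrite scale1r mul1r. Qed.
Let lB f g : l (f - g) = l f - l g.
Proof. by rewrite lD -scaleN1r lZ mulN1r. Qed.

Let PD t f g : P t (f + g) = P t f + P t g.
Proof. by have := P_linear t 1 f g; rewrite !scale1r. Qed.
Let P00 t : P t 0 = 0.
Proof.
by have := PD t 0 0; rewrite addr0 => /eqP; rewrite -subr_eq subrr eq_sym => /eqP. Qed.
Let PZ t a f : P t (a *: f) = a *: P t f.
Proof. by have := P_linear t a f 0; rewrite !addr0 P00 addr0. Qed.
Let PB t f g : P t (f - g) = P t f - P t g.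
Proof. by rewrite PD -scaleN1r PZ scaleN1r. Qed.
Let DB t f g : D t (f - g) = D t f - D t g.
Proof.
have D2 := D_linear t 1 (- 1 *: g) f; rewrite !scale1r in D2.
have D0 : D t 0 = 0.
  have := D_linear t 1 0 0; rewrite scaler0 addr0 scale1r => /eqP.
  by rewrite -subr_eq subrr eq_sym => /eqP.
have := D_linear t (-1) g 0; rewrite addr0 D0 addr0 => D3.
by rewrite addrC -scaleN1r D2 D3 scaleN1r addrC.
Qed.

Let H := N h.
(** [th'] is the contraction factor that survives for small t. [B1] dominates the products of c and
    N h that occur in the estimates, and [t0] makes B1 K |t| at most (1 - th)/4, whence th + zeta t
    <= th' (1 - zeta t). *)
Let th' := (1 + th) / 2.
Let B1 := (1 + c) * (1 + H) ^+ 2.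
Let t0 : R := (1 - th) / (4 * (B1 * K + 1)).

Let H_ge0 : 0 <= H. Proof. exact: N_ge0. Qed.
Let B1_ge0 : 0 <= B1. Proof. by rewrite /B1 mulr_ge0// ?sqr_ge0// addr_ge0. Qed.
Let th'01 : 0 <= th' < 1.
Proof.
by move/andP: th01 => [? ?]; rewrite /th'; apply/andP; split; lra. Qed.
Let t0_gt0 : 0 < t0.
Proof.
move/andP: th01 => [? ?]; rewrite /t0 divr_gt0 ?subr_gt0// mulr_gt0//.
by rewrite ltr_wpDl// mulr_ge0.
Qed.

Let zeta (t : R) := B1 * K * `|t|.

Let zeta_ge0 t : 0 <= zeta t. Proof. by rewrite /zeta mulr_ge0// mulr_ge0. Qed.

Let zeta_small t : `|t| < t0 -> zeta t <= (1 - th) / 4.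
Proof.
move=> tt0; have BK : 0 <= B1 * K by rewrite mulr_ge0.
apply: (@le_trans _ _ ((B1 * K + 1) * t0)).
  by rewrite /zeta ler_pM// ?lerDl// ltW.
rewrite le_eqVlt; apply/orP; left; apply/eqP; rewrite /t0; field.
by rewrite gt_eqF// ltr_wpDl.
Qed.

Let t_le1 t : `|t| < t0 -> `|t| <= 1.
Proof.
move=> tt0; apply: le_trans (ltW tt0) _; move/andP: th01 => [? ?].
have BK : 0 <= B1 * K by rewrite mulr_ge0.
rewrite /t0 ler_pdivrMr ?mul1r; lra.
Qed.

(** The domain of the projective map. On it [l (P t f)] stays near 1, so that dividing by it is
    harmless. *)
Let S f := l f = 1 /\ N (f - h) <= 1.

Let S_le f : S f -> N f <= 1 + H.
Proof. by move=> [_ fh]; rewrite -(subrK h f) (le_trans (ND _ _))// lerD2r. Qed.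

Let E_le t f : `|t| < t0 -> N (P t f - P 0 f) <= K * `|t| * N f.
Proof. by move=> tt0; rewrite -{2}(subr0 t) P_lip ?normr0// t_le1. Qed.

Let lE_le t f : `|t| < t0 -> cabs (l (P t f) - l f) <= c * (K * `|t| * N f).
Proof.
move=> tt0; rewrite -[X in _ - X]l_P0 -lB (le_trans (l_bounded _))//.
by rewrite ler_wpM2l// E_le.
Qed.

Let B1_c : c * (1 + H) <= B1.
Proof.
rewrite /B1 -subr_ge0 (_ : _ - _ = (1 + H) ^+ 2 + c * ((1 + H) * H)); last by ring.
by rewrite addr_ge0 ?sqr_ge0// mulr_ge0// mulr_ge0// addr_ge0.
Qed.

Let B1_1 : 1 + c * (1 + H) <= B1.
Proof.
rewrite /B1 expr2.
suff : 0 <= (1 + c) * ((1 + H) * (1 + H)) - (1 + c * (1 + H)) by rewrite subr_ge0.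
rewrite (_ : _ - _ = H + H + H * H + c * H + c * H * H); last by ring.
by rewrite !addr_ge0// ?mulr_ge0.
Qed.

Let den_close t f : `|t| < t0 -> S f -> cabs (l (P t f) - 1) <= zeta t.
Proof.
move=> tt0 Sf; rewrite -(proj1 Sf) (le_trans (lE_le _ tt0))//.
rewrite /zeta (_ : c * _ = c * N f * (K * `|t|)); last by ring.
rewrite -[leRHS]mulrA ler_wpM2r ?mulr_ge0//.
by apply: le_trans B1_c; rewrite ler_wpM2l// S_le.
Qed.

Let den_ge t f : `|t| < t0 -> S f -> 1 - zeta t <= cabs (l (P t f)).
Proof.
move=> tt0 Sf; have := den_close tt0 Sf.
have := cabs_ge_sub 1 (l (P t f) - 1); rewrite cabs1 (addrC 1 (_ - _)) subrK; lra.
Qed.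

Let den_ge2 t f : `|t| < t0 -> S f -> 3 / 4 <= cabs (l (P t f)).
Proof.
move=> tt0 Sf; have := den_ge tt0 Sf; have := zeta_small tt0.
by move/andP: th01 => [? ?]; lra.
Qed.

Let den_neq0 t f : `|t| < t0 -> S f -> l (P t f) != 0.
Proof. by move=> tt0 Sf; rewrite -cabs_eq0 gt_eqF//; have := den_ge2 tt0 Sf; lra. Qed.

Let rate_le t f : `|t| < t0 -> S f -> th + zeta t <= th' * cabs (l (P t f)).
Proof.
move=> tt0 Sf; have := den_ge tt0 Sf; have := zeta_small tt0; have := zeta_ge0 t.
move/andP: th01 th'01 => [? ?] /andP[? ?] z0 z1 dz.
apply: (@le_trans _ _ (th' * (1 - zeta t))); last by rewrite ler_wpM2l.
have : zeta t * th' <= zeta t by rewrite ler_piMr// ltW.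
by rewrite mulrBr mulr1 (mulrC th' (zeta t)); have e : th' = (1 + th) / 2 by []; lra.
Qed.

(** On the kernel of [l], P 0 contracts by th and [l (P t u)] is O(t), so P t - P 0 and the
    correction along [f] together cost only [zeta t]. The direction [f] and the normalizing vector
    [g] are kept separate because the fixed-point and Lipschitz estimates use different vectors for
    them. *)
Let ker_contract t f g u : `|t| < t0 -> S f -> S g -> l u = 0 ->
  N (P t u - l (P t u) *: f) <= th' * cabs (l (P t g)) * N u.
Proof.
move=> tt0 Sf Sg lu.
apply: (@le_trans _ _ ((th + zeta t) * N u)); last by rewrite ler_wpM2r// rate_le.
rewrite -(subrK (P 0 u) (P t u)) -addrA.
have -> : l (P t u - P 0 u + P 0 u) = l (P t u) - l u by rewrite subrK lu subr0.
set e := l (P t u) - l u.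
have He : cabs e * N f <= c * (K * `|t| * N u) * (1 + H).
  by rewrite ler_pM ?cabs_ge0// ?lE_le// S_le.
apply: (le_trans (ND _ _)); rewrite mulrDl [leLHS]addrC.
have H1 : N (P 0 u - e *: f) <= th * N u + c * (K * `|t| * N u) * (1 + H).
  by rewrite (le_trans (NB _ _))// lerD ?P0_contract// NZ.
apply: (le_trans (lerD H1 (E_le u tt0))); rewrite -addrA lerD2l.
rewrite [leLHS](_ : _ = (1 + c * (1 + H)) * (K * `|t| * N u)); last by ring.
rewrite (_ : zeta t * N u = B1 * (K * `|t| * N u)); last by rewrite /zeta; ring.
by apply: ler_wpM2r => //; rewrite mulr_ge0// mulr_ge0.
Qed.

Let F t f := (l (P t f))^-1 *: P t f.

Let F_scale t f : `|t| < t0 -> S f -> l (P t f) *: F t f = P t f.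
Proof. by move=> tt0 Sf; rewrite /F scalerA divff ?scale1r// den_neq0. Qed.

Let F_close t f : `|t| < t0 -> S f ->
  N (F t f - h) <= (th * N (f - h) + zeta t) / (1 - zeta t).
Proof.
move=> tt0 Sf; have := den_ge tt0 Sf; have := zeta_small tt0.
move/andP: th01 => [? ?] z1 dz.
rewrite ler_pdivlMr; last lra.
apply: (@le_trans _ _ (cabs (l (P t f)) * N (F t f - h))).
  by rewrite mulrC ler_wpM2r.
rewrite -NZ scalerBr F_scale//.
set e := l (P t f) - l f.
have -> : P t f - l (P t f) *: h = P 0 (f - h) + ((P t f - P 0 f) - e *: h).
  rewrite PB P0_h /e (proj1 Sf) scalerBl scale1r opprB.
  by rewrite addrACA addKr addrCA subrr addr0.
apply: (le_trans (ND _ _)); apply: lerD.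
  by rewrite P0_contract// lB (proj1 Sf) l_h subrr.
apply: (le_trans (NB _ _)); rewrite NZ.
have h1 := E_le f tt0; have h2 : cabs e * N h <= c * (K * `|t| * N f) * H.
  by rewrite ler_wpM2r// lE_le.
apply: (le_trans (lerD h1 h2)).
rewrite (_ : _ + _ = (1 + c * H) * N f * (K * `|t|)); last by ring.
rewrite /zeta -[leRHS]mulrA ler_wpM2r ?mulr_ge0//.
apply: (@le_trans _ _ ((1 + c * H) * (1 + H))).
  by rewrite ler_wpM2l ?S_le// addr_ge0// mulr_ge0.
rewrite /B1 expr2 mulrA ler_wpM2r ?addr_ge0//.
by rewrite -subr_ge0 (_ : _ - _ = H + c) ?addr_ge0//; ring.
Qed.

Let F_S t f : `|t| < t0 -> S f -> S (F t f).
Proof.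
move=> tt0 Sf; split; first by rewrite /F lZ mulVf// den_neq0.
apply: (le_trans (F_close tt0 Sf)); have := zeta_small tt0.
move/andP: th01 => [? ?] z1; rewrite ler_pdivrMr ?mul1r; last lra.
have : th * N (f - h) <= th by rewrite ler_piMr//; case: Sf.
lra.
Qed.

Let S_h : S h. Proof. by split; rewrite // subrr N0. Qed.

(** Clearing the denominator of [F t f] leaves P t (f - g) projected to the kernel of [l] along
    [F t g], to which [ker_contract] applies. *)
Let F_contract t f g : `|t| < t0 -> S f -> S g ->
  N (F t f - F t g) <= th' * N (f - g).
Proof.
move=> tt0 Sf Sg; have d0 := den_neq0 tt0 Sf.
have dgt0 : 0 < cabs (l (P t f)) by rewrite lt_def cabs_eq0 d0 cabs_ge0.
rewrite -(ler_pM2l dgt0) -NZ scalerBr F_scale//.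
have -> : P t f - l (P t f) *: F t g
    = P t (f - g) - l (P t (f - g)) *: F t g.
  rewrite !PB lB scalerBl F_scale// opprB.
  by rewrite subrKA.
apply: (le_trans (ker_contract tt0 (F_S tt0 Sg) Sf _)).
  by rewrite lB (proj1 Sf) (proj1 Sg) subrr.
by rewrite -mulrA mulrCA.
Qed.

Let Cf := 4 * B1 * K / (1 - th).

(** Banach's fixed point for [F t], started at h. The first step is at most 2 zeta t, so the whole
    orbit stays within O(t) of h: the first of the two factors |t| in the bound 1 + C t^2. *)
Let eigenvector_exists t : `|t| < t0 -> exists f,
  [/\ S f, N (f - h) <= Cf * `|t| & P t f = l (P t f) *: f].
Proof.
move=> tt0; pose u n := iter n (F t) h.
have Su n : S (u n) by elim: n => [|n IH]; [exact: S_h | exact: F_S].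
move/andP: (th01) => [th0 th1]; have z1 := zeta_small tt0; have z0 := zeta_ge0 t.
have u1 : N (u 1%N - u 0%N) <= 2 * zeta t.
  apply: (le_trans (F_close tt0 S_h)); rewrite subrr N0 mulr0 add0r.
  rewrite ler_pdivrMr; last lra.
  have : zeta t * zeta t <= zeta t * (1 / 4) by rewrite ler_wpM2l//; lra.
  lra.
have uC n : N (u n.+1 - u n) <= (2 * zeta t) * th' ^+ n.
  elim: n => [|n IH]; first by rewrite expr0 mulr1.
  apply: (le_trans (F_contract tt0 (Su n.+1) (Su n))).
  rewrite exprS mulrCA ler_wpM2l//; by case/andP: th'01.
have [|f Hf] := N_complete th'01 _ uC; first by rewrite mulr_ge0.
have e1 : 1 - th' = (1 - th) / 2 by rewrite /th'; field.
have fh : N (f - h) <= Cf * `|t|.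
  rewrite N_dist (le_trans (Hf 0%N))// expr0 mulr1 e1 /zeta /Cf le_eqVlt.
  by apply/orP; left; apply/eqP; field; rewrite subr_eq0 gt_eqF.
have lf : l f = 1.
  apply/eqP; rewrite -subr_eq0 -cabs_eq0 eq_le cabs_ge0 andbT.
  apply: (@geometric_le _ _ _ (c * ((2 * zeta t) / (1 - th'))) th') => // n.
  rewrite add0r -(proj1 (Su n)) -lB (le_trans (l_bounded _))//.
  by rewrite -mulrA ler_wpM2l// N_dist (le_trans (Hf n))// mulrAC.
have Sf : S f.
  split=> //; apply: (le_trans fh); rewrite /Cf.
  rewrite (_ : _ * _ = 4 * zeta t / (1 - th)); last by rewrite /zeta; ring.
  rewrite ler_pdivrMr ?mul1r; lra.
exists f; split=> //.
have : F t f = f.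
  apply/eqP; rewrite -subr_eq0; apply/eqP/N_eq0/eqP.
  rewrite eq_le N_ge0 andbT.
  apply: (@geometric_le _ _ _ ((1 + 1) * ((2 * zeta t) / (1 - th'))) th') => // n.
  rewrite add0r -(subrKA (u n.+1)) (le_trans (ND _ _))//.
  rewrite -mulrA mulrDl !mul1r.
  have a1 : N (F t f - u n.+1) <= 2 * zeta t * th' ^+ n / (1 - th').
    apply: le_trans (F_contract tt0 Sf (Su n)) _.
    rewrite N_dist; apply: le_trans (Hf n).
    by rewrite ler_piMl// ltW//; case/andP: th'01.
  rewrite mulrAC in a1; apply: lerD a1 _.
  apply: (le_trans (Hf n.+1)); rewrite mulrAC ler_wpM2l//.
    apply: divr_ge0; first exact: mulr_ge0.
    by rewrite e1; lra.
  by move/andP: th'01 => [? ?]; rewrite exprS ler_piMl ?exprn_ge0//; exact: ltW.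
by move=> Ff; have := F_scale tt0 Sf; rewrite Ff => ->.
Qed.

(** * Approximate eigenfunctionals and residuals *)

Let eig t f := [/\ S f, N (f - h) <= Cf * `|t| & P t f = l (P t f) *: f].

Let iter_linear t n a f g :
  iter n (P t) (a *: f + g) = a *: iter n (P t) f + iter n (P t) g.
Proof. by elim: n => // n IH; rewrite !iterS IH P_linear. Qed.

(* Stand-in at time [n] for the eigenfunctional of [P t] normalized by 1 at [f],
   which is its limit: no dual space is needed. *)
Let b t f n g := l (iter n (P t) g) / l (P t f) ^+ n.

Let b_linear t f n a g g' : b t f n (a *: g + g') = a * b t f n g + b t f n g'.
Proof. by rewrite /b iter_linear l_linear mulrDl mulrA. Qed.

Let bD t f n g g' : b t f n (g + g') = b t f n g + b t f n g'.
Proof. by have := b_linear t f n 1 g g'; rewrite scale1r mul1r. Qed.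

Let bZ t f n a g : b t f n (a *: g) = a * b t f n g.
Proof.
have := b_linear t f n a g 0; rewrite addr0 => ->.
have := bD t f n 0 0; rewrite addr0 => /eqP.
by rewrite -subr_eq subrr eq_sym => /eqP ->; rewrite addr0.
Qed.

Let bB t f n g g' : b t f n (g - g') = b t f n g - b t f n g'.
Proof. by rewrite bD -scaleN1r bZ mulN1r. Qed.

(** The part of P_t^n g in the kernel of [l]. It evolves by itself under P_t followed by projection
    along [f] ([res_step]), hence is smaller than |lambda|^n by a factor th'^n. *)
Let res t f n g := iter n (P t) g - l (iter n (P t) g) *: f.

Let l_res t f n g : eig t f -> l (res t f n g) = 0.
Proof. by move=> [[lf _] _ _]; rewrite lB lZ lf mulr1 subrr. Qed.

Let l_P_res t f n g : eig t f ->
  l (P t (res t f n g)) = l (iter n.+1 (P t) g) - l (P t f) * l (iter n (P t) g).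
Proof. by move=> [[lf _] _ Pf]; rewrite iterS PB lB PZ {1}Pf !lZ lf mulr1 mulrC. Qed.

Let res_step t f n g : eig t f ->
  res t f n.+1 g = P t (res t f n g) - l (P t (res t f n g)) *: f.
Proof.
move=> ef; rewrite l_P_res//; have [[lf _] _ Pf] := ef.
rewrite {2}/res PB PZ {1}Pf scalerA scalerBl opprB mulrC.
by rewrite subrKA.
Qed.

Let res_le t f n g : `|t| < t0 -> eig t f ->
  N (res t f n g) <= (th' * cabs (l (P t f))) ^+ n * N (g - l g *: f).
Proof.
move=> tt0 ef; have [Sf _ _] := ef.
elim: n => [|n IH]; first by rewrite expr0 mul1r.
rewrite res_step//.
apply: (le_trans (ker_contract tt0 Sf Sf (l_res n g ef))).
rewrite exprS -[leRHS]mulrA ler_wpM2l// mulr_ge0 ?cabs_ge0//.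
by case/andP: th'01.
Qed.

(** The increment is [l (P t r)] over lambda^(n+1), with r the residual. As r lies in the kernel of
    [l] and P 0 preserves [l], a factor |t| appears besides th'^n. The 2 absorbs one division by
    |lambda| >= 3/4. *)
Let b_step t f n g : `|t| < t0 -> eig t f ->
  cabs (b t f n.+1 g - b t f n g)
    <= 2 * c * K * `|t| * N (g - l g *: f) * th' ^+ n.
Proof.
move=> tt0 ef; have [Sf _ _] := ef.
have d0 := den_neq0 tt0 Sf; have d2 := den_ge2 tt0 Sf.
have -> : b t f n.+1 g - b t f n g = l (P t (res t f n g)) / l (P t f) ^+ n.+1.
  rewrite l_P_res// /b exprS; field.
  by rewrite d0 expf_neq0.
rewrite cabsM cabsV cabsX ler_pdivrMr; last by rewrite exprn_gt0//; lra.
rewrite -[l _]subr0 -(l_res n g ef).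
apply: (le_trans (lE_le _ tt0)).
have r := res_le n g tt0 ef.
have e : 0 <= c * (K * `|t|) by rewrite mulr_ge0// mulr_ge0.
rewrite (mulrA c); apply: (le_trans (ler_wpM2l e r)).
rewrite exprMn exprS.
set L := cabs (l (P t f)) in d2 *.
have L1 : L ^+ n <= 2 * L * L ^+ n by rewrite ler_peMl ?exprn_ge0//; lra.
apply: (@le_trans _ _ (c * (K * `|t|) * (th' ^+ n * N (g - l g *: f))
    * (2 * L * L ^+ n))); last first.
  by rewrite le_eqVlt; apply/orP; left; apply/eqP; ring.
rewrite [leLHS](_ : _ = c * (K * `|t|) * (th' ^+ n * N (g - l g *: f)) * L ^+ n); last by ring.
apply: ler_wpM2l => //; apply: mulr_ge0 => //; apply: mulr_ge0 => //.
by apply: exprn_ge0; case/andP: th'01.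
Qed.

Let Cb := 2 * c * K / (1 - th').

Let inv_th'_ge0 : 0 <= (1 - th')^-1.
Proof. by rewrite invr_ge0 subr_ge0 ltW//; case/andP: th'01. Qed.

Let Cb_ge0 : 0 <= Cb.
Proof. by rewrite /Cb mulr_ge0// mulr_ge0// mulr_ge0. Qed.

(** At time 0 the functional is [l] itself, so summing the increments keeps it within O(t) of [l],
    uniformly in n: the second factor |t|. *)
Let b_close t f n g : `|t| < t0 -> eig t f ->
  cabs (b t f n g - l g) <= Cb * `|t| * N (g - l g *: f).
Proof.
move=> tt0 ef; have b0 : b t f 0 g = l g by rewrite /b expr0 divr1.
rewrite -b0 -[n]add0n.
have C0 : 0 <= 2 * c * K * `|t| * N (g - l g *: f).
  by rewrite mulr_ge0// mulr_ge0// mulr_ge0// mulr_ge0.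
have := telescope_geometric (@cabs0 R) (@cabsD R) th'01 C0
  (fun k => b_step k g tt0 ef) 0 n.
rewrite expr0 mulr1 b0 => /le_trans; apply.
by rewrite /Cb le_eqVlt; apply/orP; left; apply/eqP; ring.
Qed.

Let proj_le f g : S f -> N (g - l g *: f) <= (1 + c * (1 + H)) * N g.
Proof.
move=> Sf; apply: (le_trans (NB _ _)); rewrite NZ mulrDl mul1r lerD2l.
rewrite mulrAC; apply: ler_pM => //; [exact: cabs_ge0|exact: S_le].
Qed.

Let Cn := c + Cb * (1 + c * (1 + H)).

Let Cn_ge0 : 0 <= Cn.
Proof. by rewrite addr_ge0// mulr_ge0// addr_ge0// mulr_ge0// addr_ge0. Qed.

Let b_bounded t f n g : `|t| < t0 -> eig t f -> cabs (b t f n g) <= Cn * N g.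
Proof.
move=> tt0 ef; have [Sf _ _] := ef.
rewrite -(subrK (l g) (b t f n g)) (le_trans (cabsD _ _))//.
rewrite /Cn mulrDl addrC lerD// (le_trans (b_close n g tt0 ef))// -mulrA.
rewrite -[leRHS]mulrA; apply: ler_wpM2l => //.
apply: (@le_trans _ _ (1 * N (g - l g *: f))).
  by apply: ler_wpM2r => //; exact: t_le1.
by rewrite mul1r proj_le.
Qed.

(** * Dependence of eigenvector and eigenvalue on t *)

Let Cl := 2 * (1 + c * (1 + H)) * K * (1 + H) / (1 - th').

Let Cl_ge0 : 0 <= Cl.
Proof.
have H1 : 0 <= 1 + H by rewrite addr_ge0.
rewrite /Cl mulr_ge0// mulr_ge0// mulr_ge0// mulr_ge0// addr_ge0//.
by rewrite mulr_ge0.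
Qed.

Let PB_le s t f : `|s| < t0 -> `|t| < t0 -> S f ->
  N (P s f - P t f) <= K * `|s - t| * (1 + H).
Proof.
move=> ss0 tt0 Sf; apply: le_trans (P_lip _ _ _) _; [exact: t_le1..|].
by apply: ler_wpM2l; [rewrite mulr_ge0|exact: S_le].
Qed.

(** Subtracting the eigenvector equations ([key]) writes lambda_t (ft - fs) as a [ker_contract] term
    plus the projected effect of P t - P s on fs. The first is at most th' |lambda_t| N (ft - fs)
    and is absorbed on the left; 1/|lambda_t| <= 2 gives the 2 in [Cl]. *)
Let eig_lip s t fs ft : `|s| < t0 -> `|t| < t0 -> eig s fs -> eig t ft ->
  N (ft - fs) <= Cl * `|t - s|.
Proof.
move=> ss0 tt0 es et; have [Ss _ Ps] := es; have [St _ Pt] := et.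
have lu : l (ft - fs) = 0 by rewrite lB (proj1 Ss) (proj1 St) subrr.
have d2 := den_ge2 tt0 St.
have key : l (P t ft) *: (ft - fs) = (P t (ft - fs) - l (P t (ft - fs)) *: fs)
    + ((P t fs - P s fs) - l (P t fs - P s fs) *: fs).
  rewrite scalerBr -Pt PB lB addrACA [X in _ = X + _]addrA subrK.
  rewrite Ps !lB lZ (proj1 Ss) mulr1 -addrA -opprD -scalerDl -opprD.
  rewrite -scalerDl.
  by congr (_ - _ *: _); ring.
have k1 := ker_contract tt0 Ss St lu.
have k2 := le_trans (proj_le (P t fs - P s fs) Ss)
   (ler_wpM2l _ (PB_le tt0 ss0 Ss)).
have {}k2 : N ((P t fs - P s fs) - l (P t fs - P s fs) *: fs)
    <= (1 + c * (1 + H)) * (K * `|t - s| * (1 + H)).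
  by apply: k2; rewrite addr_ge0// mulr_ge0// addr_ge0.
have := le_trans (ND _ _) (lerD k1 k2); rewrite -key NZ.
set L := cabs _; set X := N _; set Y := (1 + _) * _ => LX.
have X0 : 0 <= X by exact: N_ge0.
have th1 : 0 < 1 - th' by rewrite subr_gt0; case/andP: th'01.
rewrite (_ : Cl * _ = 2 * Y / (1 - th')); last by rewrite /Cl /Y; ring.
rewrite ler_pdivlMr//.
have : (3 / 4) * (X * (1 - th')) <= L * (X * (1 - th')).
  by apply: ler_wpM2r => //; rewrite mulr_ge0// ltW.
have Y0 : 0 <= Y.
  rewrite /Y mulr_ge0// ?addr_ge0//; first by rewrite mulr_ge0// addr_ge0.
  by rewrite mulr_ge0// ?mulr_ge0// addr_ge0.
lra.
Qed.

Let Cm := c * K * Cl + c * K * (1 + H).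

Let lam_lip s t fs ft : `|s| < t0 -> `|t| < t0 -> eig s fs -> eig t ft ->
  cabs (l (P s fs) - l (P t ft)) <= Cm * `|s - t|.
Proof.
move=> ss0 tt0 es et; have [Ss _ Ps] := es; have [St _ Pt] := et.
have lu : l (fs - ft) = 0 by rewrite lB (proj1 Ss) (proj1 St) subrr.
have -> : l (P s fs) - l (P t ft)
    = (l (P t (fs - ft)) - l (fs - ft)) + l (P s fs - P t fs).
  by rewrite lu subr0 PB !lB; ring.
apply: (le_trans (cabsD _ _)); rewrite /Cm mulrDl; apply: lerD.
  apply: (le_trans (lE_le _ tt0)).
  rewrite [leRHS](_ : _ = c * (K * (Cl * `|s - t|))); last by ring.
  rewrite -(mulrA K) ler_wpM2l// ler_wpM2l//.
  apply: (@le_trans _ _ (1 * N (fs - ft))).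
    by apply: ler_wpM2r => //; exact: t_le1.
  by rewrite mul1r; apply: eig_lip tt0 ss0 et es.
apply: (le_trans (l_bounded _)).
rewrite [leRHS](_ : _ = c * (K * `|s - t| * (1 + H))); last by ring.
by rewrite ler_wpM2l// PB_le.
Qed.

Let C3 := Cm * (Cb * Cl) + Cn * K * (1 + H) + Cn * K * Cl.
Let C4 := 4 * (2 * c * K * Cl).

Let Cm_ge0 : 0 <= Cm.
Proof.
by rewrite /Cm addr_ge0// mulr_ge0// ?mulr_ge0// addr_ge0.
Qed.

(** The derivative of the eigenvalue is the eigenfunctional applied to [D t ft]. Using [b] at time n
    instead adds the term in th'^n, which measures how far [b] is from being an exact
    eigenfunctional. *)
Let lam_diff s t fs ft n : `|s| < t0 -> `|t| < t0 -> eig s fs -> eig t ft ->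
  cabs (l (P s fs) - l (P t ft) - (s - t)%:C * b t ft n (D t ft))
    <= C3 * `|s - t| ^+ 2 + C4 * th' ^+ n.
Proof.
move=> ss0 tt0 es et; have [Ss _ Ps] := es; have [St _ Pt] := et.
set ls := l (P s fs); set lt := l (P t ft).
have lu : l (fs - ft) = 0 by rewrite lB (proj1 Ss) (proj1 St) subrr.
have d2 := den_ge2 tt0 St; have d0 := den_neq0 tt0 St.
have lt2 : cabs lt <= 2.
  have := den_close tt0 St; have := zeta_small tt0; move/andP: th01 => [? ?].
  have := cabsD 1 (lt - 1); rewrite cabs1 (addrC 1 (_ - _)) subrK -/lt; lra.
have u_le := eig_lip tt0 ss0 et es.
have key : (ls - lt) *: fs = (P t (fs - ft) - lt *: (fs - ft)) + (P s fs - P t fs).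
  rewrite PB scalerBr -Pt scalerBl -Ps opprB.
  by rewrite subrKA [RHS]addrC subrKA.
have bP g : b t ft n (P t g) = lt * b t ft n.+1 g.
  rewrite /b -iterSr exprS -/lt; field.
  by rewrite d0 expf_neq0.
(* First-order perturbation: as [b] is nearly [P t]-invariant, applying it to
   [key] leaves the effect of [P s - P t] on [fs]. *)
have bkey : (ls - lt) * b t ft n fs
    = lt * (b t ft n.+1 (fs - ft) - b t ft n (fs - ft)) + b t ft n (P s fs - P t fs).
  rewrite -(bZ t ft n (ls - lt)) key (bD t ft n (P t (fs - ft) - lt *: (fs - ft))).
  by rewrite (bB t ft n (P t (fs - ft))) bP (bZ t ft n lt) mulrBr.
have bfs : cabs (b t ft n fs - 1) <= Cb * Cl * `|s - t|.
  rewrite -(proj1 Ss) (le_trans (b_close n fs tt0 et))// (proj1 Ss) scale1r.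
  rewrite -(mulrA Cb) -(mulrA Cb) ler_wpM2l//.
  apply: (@le_trans _ _ (1 * N (fs - ft))).
    by apply: ler_wpM2r => //; exact: t_le1.
  by rewrite mul1r.
have bdec : b t ft n (P s fs - P t fs) = (s - t)%:C * b t ft n (D t ft)
    + (b t ft n (P s fs - P t fs - (s - t)%:C *: D t fs)
       + (s - t)%:C * b t ft n (D t (fs - ft))).
  rewrite DB -bZ -[in X in _ + (_ + X)]bZ -!bD; congr (b _ _ _ _).
  by rewrite scalerBr subrKA [RHS]addrC subrK.
(* The four errors, bounded in this order by [e1] to [e4]: a product of two Lipschitz quantities,
   the defect of invariance of [b], the Taylor remainder of P s at t, and the change of eigenvector
   under D t. *)
have -> : ls - lt - (s - t)%:C * b t ft n (D t ft)
  = - ((ls - lt) * (b t ft n fs - 1))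
    + lt * (b t ft n.+1 (fs - ft) - b t ft n (fs - ft))
    + (b t ft n (P s fs - P t fs - (s - t)%:C *: D t fs)
       + (s - t)%:C * b t ft n (D t (fs - ft))).
  rewrite mulrBr mulr1 bkey bdec; ring.
set d := `|s - t|.
have d0' : 0 <= d by rewrite /d.
have e1 : cabs (- ((ls - lt) * (b t ft n fs - 1))) <= Cm * (Cb * Cl) * d ^+ 2.
  rewrite cabsN cabsM expr2 (_ : Cm * _ * _ = Cm * d * (Cb * Cl * d)); last by ring.
  by apply: ler_pM => //; rewrite ?cabs_ge0//; exact: lam_lip.
have e2 : cabs (lt * (b t ft n.+1 (fs - ft) - b t ft n (fs - ft))) <= C4 * th' ^+ n.
  rewrite cabsM.
  have d_le : d <= 2.
    by rewrite /d (le_trans (ler_normB _ _))//; have := t_le1 ss0; have := t_le1 tt0; lra.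
  have st := b_step n (fs - ft) tt0 et; rewrite lu scale0r subr0 in st.
  apply: (le_trans (ler_pM (cabs_ge0 _) (cabs_ge0 _) lt2 st)).
  have cK : 0 <= c * K by rewrite mulr_ge0.
  have q : N (fs - ft) <= Cl * 2 by rewrite (le_trans u_le)// ler_wpM2l.
  have q2 : `|t| * N (fs - ft) <= 1 * (Cl * 2) by apply: ler_pM => //; exact: t_le1.
  have q3 := ler_wpM2l cK q2.
  have thn : 0 <= th' ^+ n by rewrite exprn_ge0//; case/andP: th'01.
  have := ler_wpM2r thn q3; rewrite /C4; lra.
have e3 : cabs (b t ft n (P s fs - P t fs - (s - t)%:C *: D t fs))
    <= Cn * K * (1 + H) * d ^+ 2.
  apply: (le_trans (b_bounded n _ tt0 et)).
  rewrite -(mulrA Cn) -(mulrA Cn) ler_wpM2l//.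
  apply: (le_trans (P_diff _ (t_le1 ss0) (t_le1 tt0))).
  rewrite -/d [leLHS]mulrAC ler_wpM2r ?sqr_ge0//.
  by rewrite ler_wpM2l// S_le.
have e4 : cabs ((s - t)%:C * b t ft n (D t (fs - ft))) <= Cn * K * Cl * d ^+ 2.
  rewrite cabsM cabsR expr2 (_ : _ * (d * d) = d * (Cn * (K * (Cl * d)))); last by ring.
  rewrite ler_wpM2l//; apply: (le_trans (b_bounded n _ tt0 et)).
  rewrite ler_wpM2l//; apply: (le_trans (D_bounded _ (t_le1 tt0))).
  by rewrite ler_wpM2l.
apply: (le_trans (cabsD _ _)); apply: (le_trans (lerD (cabsD _ _) (cabsD _ _))).
have := lerD (lerD e1 e2) (lerD e3 e4); rewrite /C3; lra.
Qed.

Let C6 := 2 * (Cn * (K * (1 + H))).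

Let C6_ge0 : 0 <= C6.
Proof. by rewrite mulr_ge0// mulr_ge0// mulr_ge0// addr_ge0. Qed.

Let slope_bound t f n : `|t| < t0 -> eig t f ->
  cabs (b t f n (D t f) / l (P t f)) <= C6.
Proof.
move=> tt0 et; have [St _ _] := et; have d2 := den_ge2 tt0 St.
rewrite cabsM cabsV ler_pdivrMr; last lra.
have q : Cn * N (D t f) <= Cn * (K * (1 + H)).
  rewrite ler_wpM2l//; apply: (le_trans (D_bounded _ (t_le1 tt0))).
  by rewrite ler_wpM2l// S_le.
have q0 : 0 <= Cn * (K * (1 + H)) by rewrite mulr_ge0// mulr_ge0// addr_ge0.
have : Cn * (K * (1 + H)) * (3 / 4) <= Cn * (K * (1 + H)) * cabs (l (P t f)).
  exact: ler_wpM2l.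
have := b_bounded n (D t f) tt0 et; rewrite /C6; lra.
Qed.

(** The limit is Re (lambda_t' / lambda_t), the slope of log |lambda_t|; it becomes the [G] of
    [perturbed_growth]. *)
Let slope_cvg t f : `|t| < t0 -> eig t f -> exists G C, 0 <= C /\
  forall n, `|complex.Re (b t f n (D t f) / l (P t f)) - G| <= C * th' ^+ n.
Proof.
move=> tt0 et; have [St _ _] := et; have d2 := den_ge2 tt0 St.
set C := 2 * (2 * c * K * `|t| * N (D t f - l (D t f) *: f)).
have C0 : 0 <= C by do !(apply: mulr_ge0 => //).
have step n : `|complex.Re (b t f n.+1 (D t f) / l (P t f))
    - complex.Re (b t f n (D t f) / l (P t f))| <= C * th' ^+ n.
  rewrite -ReB -mulrBl (le_trans (Re_le_cabs _))// cabsM cabsV.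
  rewrite ler_pdivrMr; last lra.
  apply: (le_trans (b_step n _ tt0 et)).
  have thn : 0 <= C * th' ^+ n by rewrite mulr_ge0// exprn_ge0//; case/andP: th'01.
  have e : C * th' ^+ n
      = 2 * (2 * c * K * `|t| * N (D t f - l (D t f) *: f) * th' ^+ n).
    by rewrite /C; ring.
  by have := ler_wpM2l thn d2; lra.
have [G HG] := geometric_cvg th'01 C0 step.
exists G, (C / (1 - th')); split; first by rewrite mulr_ge0.
by move=> n; rewrite [leRHS]mulrAC.
Qed.

(** [lam_diff] puts lambda_s / lambda_t in the form 1 + z up to an error, [cabs_1D] keeps only Re z
    to first order, and the terms in th'^n disappear as n grows. *)
Let lam_upper s t fs f G C : `|s| < t0 -> `|t| < t0 -> eig s fs -> eig t f ->
  0 <= C ->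
  (forall n, `|complex.Re (b t f n (D t f) / l (P t f)) - G| <= C * th' ^+ n) ->
  cabs (l (P s fs)) <= cabs (l (P t f))
     * (1 + ((s - t) * G + (C6 ^+ 2 + 2 * C3) * (s - t) ^+ 2)).
Proof.
move=> ss0 tt0 es et C0 HG; have [St _ _] := et; have d2 := den_ge2 tt0 St.
have d0 := den_neq0 tt0 St.
apply: (@geometric_le _ _ _ (cabs (l (P t f)) * (2 * C) + C4) th') => // n.
set q := b t f n (D t f) / l (P t f).
have := lam_diff n ss0 tt0 es et.
have e : l (P s fs) = l (P t f) * (1 + (s - t)%:C * q)
   + (l (P s fs) - l (P t f) - (s - t)%:C * b t f n (D t f)).
  by rewrite /q mulrDr mulr1 mulrCA [_ * (_ / _)]mulrCA divff// mulr1; ring.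
rewrite {2}e; set err := _ - _ - _ => Herr.
apply: (le_trans (cabsD _ _)); rewrite cabsM.
have e1 := cabs_1D ((s - t)%:C * q).
rewrite ReM_real cabsM cabsR exprMn in e1.
have sq : `|s - t| ^+ 2 = (s - t) ^+ 2 by rewrite real_normK// num_real.
rewrite sq in e1 Herr.
have q6 : cabs q ^+ 2 <= C6 ^+ 2.
  by rewrite lerXn2r ?nnegrE ?cabs_ge0//; exact: slope_bound.
have st0 := sqr_ge0 (s - t).
have e2 := ler_wpM2l st0 q6.
have thn : 0 <= th' ^+ n by rewrite exprn_ge0//; case/andP: th'01.
have e3 : (s - t) * complex.Re q <= (s - t) * G + 2 * C * th' ^+ n.
  rewrite -lerBlDl -mulrBr (le_trans (ler_norm _))// normrM.
  rewrite -(mulrA 2); apply: ler_pM => //; last exact: HG.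
  by rewrite (le_trans (ler_normB _ _))//; have := t_le1 ss0; have := t_le1 tt0; lra.
set L := cabs (l (P t f)) in d2 *.
have L0 : 0 <= L by exact: cabs_ge0.
have e4 : L * cabs (1 + (s - t)%:C * q) <= L * (1 + ((s - t) * G
    + 2 * C * th' ^+ n) + (s - t) ^+ 2 * C6 ^+ 2) by apply: ler_wpM2l => //; lra.
have C30 : 0 <= C3.
  rewrite /C3 addr_ge0//; first rewrite addr_ge0//.
    by rewrite mulr_ge0// mulr_ge0.
    by rewrite mulr_ge0// ?mulr_ge0// addr_ge0.
  by rewrite mulr_ge0// mulr_ge0.
have e5 : C3 * (s - t) ^+ 2 <= L * (2 * C3 * (s - t) ^+ 2).
  have := mulr_ge0 C30 st0; set X := C3 * _ => X0.
  rewrite (_ : L * _ = (2 * L) * X); last by rewrite /X; ring.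
  by rewrite ler_peMl//; lra.
apply: (le_trans (lerD e4 Herr)).
apply: (@le_trans _ _ (L * (1 + ((s - t) * G + 2 * C * th' ^+ n)
    + (s - t) ^+ 2 * C6 ^+ 2) + (L * (2 * C3 * (s - t) ^+ 2) + C4 * th' ^+ n))).
  by rewrite lerD2l lerD2r.
by rewrite le_eqVlt; apply/orP; left; apply/eqP; ring.
Qed.

(** The first two clauses feed the Legendre transform, the third the positivity of L; the last two
    give the two-sided growth of exponential moments. *)
Lemma perturbed_growth : exists (t1 C : R) (L G : R -> R),
  0 < t1 /\ 0 <= C /\
  [/\ forall t, `|t| < t1 -> `|G t| <= C,
      forall s t, `|s| < t1 -> `|t| < t1 ->
        L s <= L t + (s - t) * G t + C * (s - t) ^+ 2,
      forall t n, `|t| < t1 ->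
        cabs (l (iter n (P t) h)) <= expR (n%:R * L t) * (1 + C * t ^+ 2),
      forall t n f, `|t| < t1 ->
        cabs (l (iter n (P t) f)) <= expR (n%:R * L t) * (C * N f) &
      forall t n f, `|t| < t1 -> l f = 1 -> N (f - h) <= 1 ->
        expR (n%:R * L t) / 2 <= cabs (l (iter n (P t) f))].
Proof.
have /choice[ft Hft] : forall t, exists f, `|t| < t0 -> eig t f.
  move=> t; have [tt0|_] := boolP (`|t| < t0); last by exists h.
  by have [f fP] := eigenvector_exists tt0; exists f.
have /choice[G HG] : forall t, exists g : R, `|t| < t0 -> exists C : R, 0 <= C /\
  forall n, `|complex.Re (b t (ft t) n (D t (ft t)) / l (P t (ft t))) - g|
     <= C * th' ^+ n.
  move=> t; have [tt0|_] := boolP (`|t| < t0); last by exists 0.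
  have [g [C HC]] := slope_cvg tt0 (Hft t tt0).
  by exists g; move=> _; exists C.
(* The second bound gives 2 Cb |t| <= 1/2, which leaves at least 1/2 in the final lower bound. *)
pose t1 := Num.min t0 (1 / (4 * Cb + 1)).
have t1P t : `|t| < t1 -> `|t| < t0 /\ `|t| * (4 * Cb + 1) <= 1.
  rewrite lt_min => /andP[? /ltW]; rewrite ler_pdivlMr//.
  by have := Cb_ge0; lra.
pose lam t := cabs (l (P t (ft t))).
have lam2 t : `|t| < t0 -> 3 / 4 <= lam t.
  by move=> tt0; have [St _ _] := Hft t tt0; exact: den_ge2.
have lamX t n : `|t| < t0 -> expR (n%:R * ln (lam t)) = lam t ^+ n.
  by move=> tt0; rewrite expRM_natl lnK// posrE; have := lam2 t tt0; lra.
have bE t n f : `|t| < t0 ->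
    cabs (l (iter n (P t) f)) = lam t ^+ n * cabs (b t (ft t) n f).
  move=> tt0; rewrite /b cabsM cabsV cabsX mulrCA divff ?mulr1//.
  by rewrite gt_eqF// exprn_gt0//; have := lam2 t tt0; rewrite /lam; lra.
have lamn t n : `|t| < t0 -> 0 <= lam t ^+ n.
  by move=> tt0; rewrite exprn_ge0//; exact: cabs_ge0.
pose C := C6 + (C6 ^+ 2 + 2 * C3) + Cb * Cf + Cn.
have Cf_ge0 : 0 <= Cf.
  rewrite /Cf divr_ge0//; first by rewrite mulr_ge0// mulr_ge0.
  by rewrite subr_ge0 ltW//; case/andP: th01.
have C30 : 0 <= C3.
  rewrite /C3 addr_ge0//; first rewrite addr_ge0//.
    by rewrite mulr_ge0// mulr_ge0.
    by rewrite mulr_ge0// ?mulr_ge0// addr_ge0.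
  by rewrite mulr_ge0// mulr_ge0.
have Cs : [/\ 0 <= C, C6 <= C, C6 ^+ 2 + 2 * C3 <= C, Cb * Cf <= C & Cn <= C].
  have p1 := mulr_ge0 Cb_ge0 Cf_ge0; have p2 := sqr_ge0 C6.
  have p3 := C6_ge0; have p4 := Cn_ge0.
  by rewrite /C; split; lra.
case: Cs => C0 CC6 CC3 CCb CCn.
exists t1, C, (fun t => ln (lam t)), G; split.
  rewrite lt_min t0_gt0/= divr_gt0//; have := Cb_ge0; lra.
split=> //; split.
- move=> t /t1P[tt0 _]; have [C' [C'0 HC']] := HG t tt0.
  apply: (@geometric_le _ _ _ C' th') => // n.
  rewrite -(subrK (complex.Re (b t (ft t) n (D t (ft t)) / l (P t (ft t)))) (G t)).
  apply: (le_trans (ler_normD _ _)); rewrite addrC lerD//; last by rewrite distrC.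
  by rewrite (le_trans (Re_le_cabs _))// (le_trans (slope_bound n tt0 (Hft t tt0))).
- move=> s t /t1P[ss0 _] /t1P[tt0 _]; have [C' [C'0 HC']] := HG t tt0.
  have := lam_upper ss0 tt0 (Hft s ss0) (Hft t tt0) C'0 HC'.
  rewrite -/(lam s) -/(lam t); set x := (_ + _ * (s - t) ^+ 2) => Hx.
  have ls := lam2 s ss0; have lt := lam2 t tt0.
  have x0 : 0 < 1 + x.
    by rewrite -(@pmulr_rgt0 _ (lam t)); [apply: lt_le_trans Hx; lra | lra].
  have lt0 : 0 < lam t by lra.
  have ls0 : 0 < lam s by lra.
  have : ln (lam s) <= ln (lam t * (1 + x)).
    by rewrite ler_ln ?posrE// mulr_gt0.
  rewrite lnM ?posrE//.
  have ln1x : ln (1 + x) <= x by rewrite le_ln1Dx//; lra.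
  have := ler_wpM2r (sqr_ge0 (s - t)) CC3.
  rewrite /x in ln1x *; lra.
(* [b_close] at h contributes Cb |t| and the distance from h to the eigenvector Cf |t|: hence the
   square. *)
- move=> t n /t1P[tt0 _]; rewrite lamX// bE// ler_wpM2l ?lamn//.
  have et := Hft t tt0; have [St fh _] := et.
  have := b_close n h tt0 et; rewrite l_h scale1r => bc.
  have : cabs (b t (ft t) n h) <= 1 + Cb * `|t| * N (h - ft t).
    rewrite -{1}(subrK 1 (b _ _ _ _)) (le_trans (cabsD _ _))// cabs1 addrC.
    by rewrite lerD2l.
  move=> /le_trans; apply; rewrite lerD2l.
  have tt : t ^+ 2 = `|t| * `|t| by rewrite -expr2 real_normK// num_real.
  apply: (@le_trans _ _ (Cb * `|t| * (Cf * `|t|))).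
    by rewrite ler_wpM2l ?mulr_ge0// N_dist.
  rewrite (_ : Cb * _ * _ = Cb * Cf * t ^+ 2); last by rewrite tt; ring.
  by rewrite ler_wpM2r ?sqr_ge0.
- move=> t n f /t1P[tt0 _]; rewrite lamX// bE// ler_wpM2l ?lamn//.
  apply: (le_trans (b_bounded n f tt0 (Hft t tt0))).
  by rewrite ler_wpM2r.
move=> t n f /t1P[tt0 tC] lf fh; rewrite lamX// bE// ler_wpM2l ?lamn//.
have et := Hft t tt0; have [[_ fth] _ _] := et.
have := b_close n f tt0 et; rewrite lf scale1r => bc.
have N2 : N (f - ft t) <= 2.
  rewrite -(subrKA h) (le_trans (ND _ _))// (N_dist h); lra.
have : Cb * `|t| * N (f - ft t) <= Cb * `|t| * 2.
  by rewrite ler_wpM2l// mulr_ge0.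
have := cabs_ge_sub 1 (b t (ft t) n f - 1).
rewrite cabs1 (addrC 1 (_ - _)) subrK.
have : 0 <= `|t| by []; lra.
Qed.
End Perturbation.

(** * Spectral radius *)

Section SpectralRadius.
Variables (R : realType) (B : normedModType R[i]).
Implicit Types (f g : B) (v w : R[i]).

Lemma nrmN f : nrm (- f) = nrm f.
Proof. by rewrite -scaleN1r nrmZ cabsN cabs1 mul1r. Qed.

Lemma nrm_dist f g : nrm (f - g) = nrm (g - f).
Proof. by rewrite -nrmN opprB. Qed.

Lemma continuous_nrm_bounded (F : {linear B -> B}) : continuous F ->
  exists K, 0 <= K /\ forall f, nrm (F f) <= K * nrm f.
Proof.
move=> /linear_bounded_continuous/linear_boundedP[M [Mr HM]].
have M0 : 0 <= `|M| by [].
exists (complex.Re (`|M| + 1)).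
have e : `|M| + 1 = (complex.Re (`|M| + 1))%:C.
  by rewrite RRe_real// ger0_real// addr_ge0.
split; first by rewrite -lecR -e addr_ge0.
move=> f; rewrite -lecR rmorphM/= !nrmE -e; apply: HM.
rewrite (le_lt_trans (real_ler_norm Mr))//.
by rewrite ltrDl ltr01.
Qed.

Variable Q : {linear B -> B}.
Hypothesis Q_cont : continuous Q.
Hypothesis Q_radius : (spectral_radius Q < 1)%E.

(** Inverting 1 - w Q with w = 1/l, instead of l - Q, turns |l| >= 1 into the closed unit disc,
    which is compact and where w = 0 is trivial. *)
Lemma resolvent_exists w : cabs w <= 1 -> exists S : B -> B,
  [/\ forall a f g, S (a *: f + g) = a *: S f + S g,
      exists K, 0 <= K /\ forall f, nrm (S f) <= K * nrm f,
      forall f, S (f - w *: Q f) = f & forall f, S f - w *: Q (S f) = f].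
Proof.
have [->|w0] := eqVneq w 0 => w1.
  exists id; split=> //; first by exists 1; split=> // f; rewrite mul1r.
  by move=> f; rewrite scale0r subr0.
  by move=> f; rewrite scale0r subr0.
have : ~ spectrum Q w^-1.
  move=> sw; have : ((cabs w^-1)%:E <= spectral_radius Q)%E.
    by apply: ereal_sup_ubound; exists w^-1.
  move=> /le_lt_trans/(_ Q_radius); rewrite lte_fin cabsV; apply/negP.
  by rewrite -leNgt -invr1 lef_pV2 ?posrE// lt_def cabs_eq0 w0 cabs_ge0.
move=> /contrapT[S [Sc SF FS]].
have [K [K0 SK]] := continuous_nrm_bounded Sc.
exists (fun f => w^-1 *: S f); split.
- by move=> a f g; rewrite linearP scalerDr !scalerA mulrC.
- exists (cabs w^-1 * K); split; first by rewrite mulr_ge0// cabs_ge0.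
  by move=> f; rewrite nrmZ -mulrA ler_wpM2l ?cabs_ge0.
- move=> f; rewrite -linearZ/= scalerBr scalerA mulVf// scale1r.
  exact: SF.
- move=> f; have -> : Q (w^-1 *: S f) = w^-1 *: Q (S f) by rewrite linearZ.
  by rewrite scalerA divff// scale1r; exact: FS.
Qed.

(** Outside the unit disc [id] is a filler value; the properties in [RsP] are claimed for
    [cabs w <= 1]. *)
Let Rs w := if pselect (cabs w <= 1) is left h then projT1 (cid (resolvent_exists h)) else id.

Let RsP w : cabs w <= 1 ->
  [/\ forall a f g, Rs w (a *: f + g) = a *: Rs w f + Rs w g,
      exists K, 0 <= K /\ forall f, nrm (Rs w f) <= K * nrm f,
      forall f, Rs w (f - w *: Q f) = f & forall f, Rs w f - w *: Q (Rs w f) = f].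
Proof. by rewrite /Rs; case: pselect => // h _; case: cid. Qed.

Let RsB w f g : cabs w <= 1 -> Rs w (f - g) = Rs w f - Rs w g.
Proof.
by move=> /RsP[RL _ _ _]; rewrite addrC -scaleN1r RL scaleN1r addrC.
Qed.

Let RsZ w a f : cabs w <= 1 -> Rs w (a *: f) = a *: Rs w f.
Proof.
move=> w1; have [RL _ _ _] := RsP w1; have := RL a f 0.
by have := RsB 0 0 w1; rewrite !subrr => ->; rewrite !addr0.
Qed.

Let resolvent_identity v w f : cabs v <= 1 -> cabs w <= 1 ->
  Rs w f - Rs v f = (w - v) *: Rs v (Q (Rs w f)).
Proof.
move=> v1 w1; have [_ _ vl _] := RsP v1; have [_ _ _ wr] := RsP w1.
rewrite -{1}(vl (Rs w f)) -[in Rs v f](wr f) -RsB// -RsZ//.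
by congr (Rs v _); rewrite opprB addrC subrKA scalerBl.
Qed.

Let Q_bound : exists q, 0 <= q /\ forall f, nrm (Q f) <= q * nrm f.
Proof. exact: continuous_nrm_bounded. Qed.

(** The resolvent identity gives a locally uniform bound, and compactness makes it uniform. The
    covering is of the square [-1, 1]^2; near a point outside the disc the claim is vacuous. *)
Let resolvent_bounded : exists K, 0 <= K /\
  forall w f, cabs w <= 1 -> nrm (Rs w f) <= K * nrm f.
Proof.
have [q [q0 Qq]] := Q_bound.
pose toC (p : R * R) : R[i] := p.1 +i* p.2.
have close (p : R * R) e : 0 < e ->
    \forall p' \near p, cabs (toC p' - toC p) < e.
  move=> e0; apply/nbhs_ballP; exists (e / 2); first by rewrite /= divr_gt0.
  move=> p' [/= b1 b2]; rewrite /ball/= in b1 b2.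
  apply: (le_lt_trans (cabs_le_ReIm _)) => /=.
  by rewrite (distrC p.1) in b1; rewrite (distrC p.2) in b2; lra.
have K_compact : compact (`[(-1 : R), 1] `*` `[(-1 : R), 1]).
  by apply: compact_setX; exact: segment_compact.
have /compact_near_coveringP cov := K_compact.
have [] := cov R +oo%R
  (fun M p => cabs (toC p) <= 1 -> forall f, nrm (Rs (toC p) f) <= M * nrm f).
  move=> p _; have [p1|p1] := leP (cabs (toC p)) 1.
    have [_ [K [K0 RK]] _ _] := RsP p1.
    (* Within this radius the resolvent identity changes [Rs] by at most half its norm at the new
       point, which is absorbed and leaves the bound 2 K. *)
    have e0 : 0 < 1 / (2 * (K * q + 1)).
      by rewrite divr_gt0// mulr_gt0// ltr_wpDl// mulr_ge0.
    exists ([set p' | cabs (toC p' - toC p) < 1 / (2 * (K * q + 1))],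
            [set M | 2 * K < M]).
      by split=> /=; [exact: close | exists (2 * K); rewrite num_real].
    move=> [p' M] /= [pp' KM] p'1 f.
    have id := resolvent_identity f p1 p'1.
    have : nrm (Rs (toC p') f) <= K * nrm f + 1 / 2 * nrm (Rs (toC p') f).
      rewrite -{1}(subrK (Rs (toC p) f) (Rs (toC p') f)) addrC.
      apply: (le_trans (nrmD _ _)); apply: lerD; first exact: RK.
      rewrite id nrmZ; set x := nrm (Rs (toC p') f).
      have x0 : 0 <= x by exact: nrm_ge0.
      apply: (@le_trans _ _ (1 / (2 * (K * q + 1)) * (K * (q * x)))).
        apply: ler_pM; [exact: cabs_ge0|exact: nrm_ge0|exact: ltW|].
        by apply: (le_trans (RK _)); rewrite ler_wpM2l.
      have Kq : 0 <= K * q by rewrite mulr_ge0.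
      rewrite [leLHS](_ : _ = K * q / (K * q + 1) * (1 / 2 * x)); last first.
        by field; rewrite gt_eqF//; lra.
      rewrite ler_piMl//; first by lra.
      rewrite ler_pdivrMr; lra.
    have : 2 * K * nrm f <= M * nrm f by rewrite ler_wpM2r ?nrm_ge0// ltW.
    lra.
  exists ([set p' | cabs (toC p' - toC p) < cabs (toC p) - 1], [set M | 0 < M]).
    by split=> /=; [apply: close; lra | exists 0; rewrite num_real].
  move=> [p' M] /= [pp' _] p'1; exfalso.
  have := cabs_ge_sub (toC p) (toC p' - toC p).
  by rewrite (addrC (toC p)) subrK; lra.
move=> M [_ HM].
(* The covering gives the bound for every number strictly above [M]; this one is also
   nonnegative. *)
pose K := Num.max M 0 + 1.
exists K; split; first by rewrite addr_ge0// le_max lexx orbT.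
move=> [a b] f w1; apply: (HM K _ (a, b)) => //.
  by rewrite /K (@le_lt_trans _ _ (Num.max M 0)) ?le_max ?lexx// ltrDl.
have := Re_le_cabs (a +i* b); have := Im_le_cabs (a +i* b) => /= h1 h2.
by split; rewrite /= in_itv/= -ler_norml; [apply: le_trans h2 _|apply: le_trans h1 _].
Qed.

Let resolvent_lipschitz : exists L, 0 <= L /\
  forall v w f, cabs v <= 1 -> cabs w <= 1 ->
    nrm (Rs w f - Rs v f) <= L * cabs (w - v) * nrm f.
Proof.
have [q [q0 Qq]] := Q_bound; have [K [K0 RK]] := resolvent_bounded.
exists (K * q * K); split; first by rewrite mulr_ge0// mulr_ge0.
move=> v w f v1 w1; rewrite resolvent_identity// nrmZ mulrAC mulrC.
rewrite ler_wpM2r ?cabs_ge0//; apply: (le_trans (RK _ _ v1)).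
rewrite -!mulrA ler_wpM2l//; apply: (le_trans (Qq _)).
by rewrite ler_wpM2l// RK.
Qed.

(* [pow_res k v] is the inverse of [1 - v Q^(2^k)], by
   [(1 - u^2 b^2)^-1 = ((1 - u b)^-1 + (1 + u b)^-1) / 2]. *)
Fixpoint pow_res k v : B -> B := match k with
  | 0 => Rs v
  | k'.+1 => fun f => (1 / 2)%:C *: (pow_res k' (sqrtc v) f + pow_res k' (- sqrtc v) f)
  end.

Let b k := iter (2 ^ k) Q.

Let bD k f g : b k (f + g) = b k f + b k g.
Proof. by rewrite /b; elim: (2 ^ k)%N => //= n ->; rewrite linearD. Qed.

Let bZ k a f : b k (a *: f) = a *: b k f.
Proof. by rewrite /b; elim: (2 ^ k)%N => //= n ->; rewrite linearZ. Qed.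

Let bN k f : b k (- f) = - b k f.
Proof. by rewrite -scaleN1r bZ scaleN1r. Qed.

Let bS k f : b k.+1 f = b k (b k f).
Proof. by rewrite /b expnS mul2n -addnn iterD. Qed.

Let cabs_sqrtc v : cabs v <= 1 -> cabs (sqrtc v) <= 1.
Proof.
move=> v1; rewrite -(ler_pXn2r (ltn0Sn 1)) ?nnegrE ?cabs_ge0//.
by rewrite -cabsX sqr_sqrtc expr1n.
Qed.

Let half2 f : (1 / 2)%:C *: (f + f) = f.
Proof.
rewrite -mulr2n -(scaler_nat 2 f) scalerA -(rmorph_nat (real_complex R) 2) -rmorphM/=.
by rewrite (_ : 1 / 2 * 2 = 1 :> R) ?scale1r//; field.
Qed.

Let pow_resP k : forall v, cabs v <= 1 ->
  (forall f, pow_res k v (f - v *: b k f) = f) /\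
  (forall f, pow_res k v f - v *: b k (pow_res k v f) = f).
Proof.
elim: k => [|k IH] v v1.
  by have [_ _ l r] := RsP v1; split=> f /=; rewrite /b/=; [exact: l|exact: r].
have u1 := cabs_sqrtc v1; have u1' : cabs (- sqrtc v) <= 1 by rewrite cabsN.
have [l1 r1] := IH _ u1; have [l2 r2] := IH _ u1'.
have ve : v = sqrtc v * sqrtc v by rewrite -expr2 sqr_sqrtc.
set u := sqrtc v in u1 u1' l1 r1 l2 r2 ve.
split=> f /=; rewrite -/u.
  have e1 : f - v *: b k.+1 f = (f + u *: b k f) - u *: b k (f + u *: b k f).
    by rewrite bD bZ scalerDr scalerA -ve bS opprD addrA addrK.
  have e2 : f - v *: b k.+1 f = (f - u *: b k f) - (- u) *: b k (f - u *: b k f).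
    rewrite bD bN bZ scalerDr scalerN !scaleNr scalerA -ve bS opprK opprD.
    by rewrite opprK addrA subrK.
  by rewrite {1}e1 l1 e2 l2 addrACA subrr addr0 half2.
set x := pow_res k u f; set y := pow_res k (- u) f.
have e1 : x - v *: b k.+1 x = f + u *: b k f.
  rewrite -[in RHS](r1 f) -/x bD bN bZ bS scalerBr scalerA -ve.
  by rewrite addrA subrK.
have e2 : y - v *: b k.+1 y = f - u *: b k f.
  have r2' : y + u *: b k y = f by rewrite -[RHS]r2 scaleNr opprK.
  by rewrite -[in RHS]r2' bD bZ bS scalerDr scalerA -ve opprD addrA addrK.
rewrite bZ bD scalerA (mulrC v) -scalerA -scalerBr (scalerDr v) opprD addrACA e1 e2.
by rewrite addrACA subrr addr0 half2.
Qed.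

(** The average is symmetric in the two square roots, so the discontinuity of the principal branch
    never matters. *)
Let pow_res_sqr k y f :
  pow_res k.+1 (y ^+ 2) f = (1 / 2)%:C *: (pow_res k y f + pow_res k (- y) f).
Proof.
rewrite /=; have /eqP := sqr_sqrtc (y ^+ 2); rewrite eqf_sqr => /orP[]/eqP -> //.
by rewrite opprK addrC.
Qed.

(** Going from k + 1 to k replaces r^(2^(k+1)) u by plus or minus r^(2^k) sqrt(u), with the same r
    and s. Averaging two L-Lipschitz functions keeps L, so the constant is independent of k. *)
Let pow_res_lip L : 0 <= L ->
  (forall v w f, cabs v <= 1 -> cabs w <= 1 ->
    nrm (Rs w f - Rs v f) <= L * cabs (w - v) * nrm f) ->
  forall k (r s : R) u f, 0 <= r <= 1 -> 0 <= s <= 1 -> cabs u = 1 ->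
    nrm (pow_res k ((r ^+ (2 ^ k))%:C * u) f - pow_res k ((s ^+ (2 ^ k))%:C * u) f)
      <= L * `|r - s| * nrm f.
Proof.
move=> L0 HL; elim=> [|k IH] r s u f rb sb u1.
  rewrite /= !expr1.
  have ub x : 0 <= x <= 1 -> cabs (x%:C * u) <= 1.
    by move=> /andP[x0 x1]; rewrite cabsM u1 mulr1 cabsR ger0_norm.
  apply: (le_trans (HL _ _ _ (ub s sb) (ub r rb))).
  by rewrite -mulrBl cabsM u1 mulr1 -rmorphB cabsR.
have ue : u = sqrtc u ^+ 2 by rewrite sqr_sqrtc.
have su : cabs (sqrtc u) = 1.
  have : cabs (sqrtc u) ^+ 2 = 1 ^+ 2 by rewrite -cabsX -ue u1 expr1n.
  by move=> /eqP; rewrite eqrXn2 ?cabs_ge0// => /eqP.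
have e (x : R) : (x ^+ (2 ^ k.+1))%:C * u = ((x ^+ (2 ^ k))%:C * sqrtc u) ^+ 2.
  by rewrite exprMn -ue -rmorphXn/= -exprM mulnC -expnS.
rewrite !e !pow_res_sqr -scalerBr nrmZ cabsR ger0_norm// opprD addrACA.
have i1 := IH r s (sqrtc u) f rb sb su.
have i2 := IH r s (- sqrtc u) f rb sb.
rewrite cabsN !mulrN in i2.
have := le_trans (nrmD _ _) (lerD i1 (i2 su)); lra.
Qed.

(** With [inverse_close]: v Q^(2^k) is small when the inverse of 1 - v Q^(2^k) is near the identity,
    and conversely. Here delta <= (1 + delta)/8 gives delta <= 1/7; there delta <= (1 + delta)/3
    gives delta <= 1/2. *)
Let inverse_small k v f e : cabs v <= 1 -> 0 <= e -> e <= 1 / 8 ->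
  (forall g, nrm (v *: b k g) <= e * nrm g) ->
  nrm (pow_res k v f - f) <= 1 / 6 * nrm f.
Proof.
move=> v1 e0 e1 Hb; have [_ r] := pow_resP k v1.
set x := pow_res k v f.
have xf : x - f = v *: b k x by have := r f; rewrite -/x => <-; rewrite opprB addrC subrK.
have x1 := Hb x.
have x2 : nrm x <= nrm f + nrm (v *: b k x).
  by rewrite -xf -{1}(subrK f x) addrC nrmD.
rewrite xf; have : e * nrm x <= 1 / 8 * nrm x by rewrite ler_wpM2r ?nrm_ge0.
have := nrm_ge0 f; lra.
Qed.

Let inverse_close k v : cabs v <= 1 ->
  (forall f, nrm (pow_res k v f - f) <= 1 / 3 * nrm f) ->
  forall f, nrm (v *: b k f) <= 1 / 2 * nrm f.
Proof.
move=> v1 H f; have [l _] := pow_resP k v1.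
have := H (f - v *: b k f); rewrite l opprB addrC subrK => h1.
have : nrm (f - v *: b k f) <= nrm f + nrm (v *: b k f).
  by rewrite (le_trans (nrmD _ _))// nrmN.
lra.
Qed.

Let square_le k (s : R) e : 0 <= s -> 0 <= e ->
  (forall f, nrm ((s ^+ (2 ^ k))%:C *: b k f) <= e * nrm f) ->
  forall f, nrm ((s ^+ (2 ^ k.+1))%:C *: b k.+1 f) <= e ^+ 2 * nrm f.
Proof.
move=> s0 e0 H f.
have -> : (s ^+ (2 ^ k.+1))%:C *: b k.+1 f
    = (s ^+ (2 ^ k))%:C *: b k ((s ^+ (2 ^ k))%:C *: b k f).
  by rewrite bZ scalerA bS -rmorphM/= -exprD addnn -mul2n -expnS.
by apply: (le_trans (H _)); rewrite expr2 -mulrA ler_wpM2l.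
Qed.

(* After Rickart: the radius [r] for which [r^(2^k) Q^(2^k)] is eventually
   small is pushed from 0 to 1 in steps of fixed length, because
   [pow_res k (r^(2^k))] is Lipschitz in [r] uniformly in [k]. *)
Lemma spectral_radius_lt1_contract : exists n, (0 < n)%N /\
  forall f, nrm (iter n Q f) <= 1 / 2 * nrm f.
Proof.
have [L [L0 HL]] := resolvent_lipschitz.
(* A step of length 1/M moves [pow_res] by at most L/M <= 1/6, and 1/6 + 1/6 is the 1/3 allowed by
   [inverse_close]. *)
pose M := (Num.truncn (6 * L)).+1.
have M0 : 0 < M%:R :> R by rewrite ltr0n.
have LM : L * M%:R^-1 <= 1 / 6.
  rewrite ler_pdivrMr//; have := truncnS_gt (6 * L); rewrite -/M; lra.
suff H j : (j <= M)%N -> exists k0, forall k, (k0 <= k)%N -> forall f,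
    nrm (((j%:R / M%:R) ^+ (2 ^ k))%:C *: b k f) <= 1 / 2 * nrm f.
  have [k0 Hk] := H M (leqnn _); exists (2 ^ k0)%N.
  split; first by rewrite expn_gt0.
  move=> f; have := Hk k0 (leqnn _) f.
  by rewrite divff ?gt_eqF// expr1n scale1r.
elim: j => [|j IH] jM.
  exists 0%N => k _ f; rewrite mul0r expr0n expn_eq0/= scale0r nrm0.
  by rewrite mulr_ge0 ?nrm_ge0.
(* Two further squarings improve 1/2 to 1/16, below the 1/8 that [inverse_small] requires. *)
have [k0 Hk0] := IH (ltnW jM); exists k0.+2 => k k0k.
set s : R := j%:R / M%:R; set r : R := j.+1%:R / M%:R.
have sb : 0 <= s <= 1.
  by rewrite /s divr_ge0//= ler_pdivrMr// mul1r ler_nat ltnW.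
have rb : 0 <= r <= 1.
  by rewrite /r divr_ge0//= ler_pdivrMr// mul1r ler_nat.
have pow1 (x : R) : 0 <= x <= 1 -> cabs (x ^+ (2 ^ k))%:C <= 1.
  by move=> /andP[x0 x1]; rewrite cabsR ger0_norm ?exprn_ge0// exprn_ile1.
apply: (inverse_close (pow1 r rb)) => f.
have small : forall g, nrm ((s ^+ (2 ^ k))%:C *: b k g) <= 1 / 16 * nrm g.
  have [k' ek] : exists k', k = k'.+2 by exists k.-2; case: (k) k0k => [|[]].
  have := Hk0 k'; rewrite ek !ltnS in k0k *; move=> /(_ k0k) h0.
  have s0 : 0 <= s by case/andP: sb.
  have h1 := square_le s0 (_ : 0 <= 1 / 2) h0.
  have h2 := square_le s0 (_ : 0 <= (1 / 2) ^+ 2) (h1 _).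
  move=> g; apply: le_trans (h2 _ _ g) _; rewrite ?sqr_ge0//.
  by rewrite ler_wpM2r ?nrm_ge0//; lra.
have h1 := inverse_small f (pow1 s sb) _ _ small.
have h2 := pow_res_lip L0 HL k f rb sb (@cabs1 R).
rewrite !mulr1 in h2.
have rs : `|r - s| = M%:R^-1.
  by rewrite /r /s -mulrBl -natrB// subSnn mul1r ger0_norm.
rewrite rs in h2.
rewrite -(subrKA (pow_res k ((s ^+ (2 ^ k))%:C) f)).
apply: (le_trans (nrmD _ _)).
have h3 : L * M%:R^-1 * nrm f <= 1 / 6 * nrm f by rewrite ler_wpM2r ?nrm_ge0.
have := h1 _ _; lra.
Qed.

End SpectralRadius.

(** * Adapted norms *)

Section Completeness.
Variables (R : realType) (B : completeNormedModType R[i]) (N : B -> R) (K : R).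
Hypothesis ND : forall f g, N (f + g) <= N f + N g.
Hypothesis N0 : N 0 = 0.
Hypothesis N_dist : forall f g, N (f - g) = N (g - f).
Hypothesis nrm_N : forall f, nrm f <= N f.
Hypothesis N_nrm : forall f, N f <= K * nrm f.

(** The limit is taken in the original norm, but the rate is telescoped in [N] itself, so no factor
    [K] enters it. *)
Lemma geometric_complete (u : nat -> B) (C th : R) : 0 <= th < 1 -> 0 <= C ->
  (forall n, N (u n.+1 - u n) <= C * th ^+ n) ->
  exists l, forall n, N (u n - l) <= C * th ^+ n / (1 - th).
Proof.
move=> th01 C0 uC; have tel := telescope_geometric N0 ND th01 C0 uC.
have real_eps (e : R[i]) : 0 < e -> exists2 e' : R, 0 < e' & e = e'%:C.
  by case: e => a b; rewrite ltcE/= => /andP[/eqP-> a0]; exists a.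
have : cvg (u @ \oo).
  apply/cauchy_cvgP/cauchy_exP => e /real_eps[e' e0 ->].
  have [n0 Hn0] := geometric_small (C / (1 - th)) th01 e0.
  exists (u n0); exists n0 => // n /= n0n; rewrite -ball_normE /ball_/=.
  rewrite -nrmE ltcR nrm_dist (le_lt_trans (nrm_N _))//.
  by rewrite -(subnKC n0n) (le_lt_trans (tel _ _))// mulrAC Hn0.
move=> /cvg_ex[l ul]; exists l => n; apply/ler_addgt0Pr => e e0.
have K1 : 0 < `|K| + 1 by rewrite ltr_wpDl.
have e1 : 0 < (e / (`|K| + 1))%:C by rewrite ltcR divr_gt0.
have /cvgrPdist_lt /(_ _ e1) [m _ Hm] := ul.
have := Hm (n + m)%N (leq_addl _ _); rewrite /= -nrmE ltcR nrm_dist => um.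
rewrite -(subrKA (u (n + m)%N)); apply: (le_trans (ND _ _)).
rewrite lerD ?(N_dist (u n))//.
apply: (le_trans (N_nrm _)).
apply: (@le_trans _ _ ((`|K| + 1) * nrm (u (n + m)%N - l))).
  by rewrite ler_wpM2r ?nrm_ge0// (le_trans (ler_norm _))// lerDl.
by rewrite mulrC -ler_pdivlMr// ltW.
Qed.

End Completeness.

Section AdaptedNorm.
Variables (R : realType) (B : completeNormedModType R[i]) (Q : {linear B -> B}).
Variables (q : R) (n : nat).
Hypothesis q_ge0 : 0 <= q.
Hypothesis Q_bounded : forall f, nrm (Q f) <= q * nrm f.
Hypothesis n_gt0 : (0 < n)%N.
Hypothesis Q_contract : forall f, nrm (iter n Q f) <= 1 / 2 * nrm f.

Let iterD k f g : iter k Q (f + g) = iter k Q f + iter k Q g.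
Proof. by elim: k => //= k ->; rewrite linearD. Qed.

Let iterZ k a f : iter k Q (a *: f) = a *: iter k Q f.
Proof. by elim: k => //= k ->; rewrite linearZ. Qed.

(** N f is the sum over k < n of th^-k |Q^k f|. Applying Q shifts the sum to th (N f - |f| + th^-n
    |Q^n f|), which is at most th N f as soon as th^n >= 1/2. *)
Lemma adapted_norm : exists (N : B -> R) (th K : R), 0 <= th < 1 /\ 0 <= K /\
  [/\ forall f g, N (f + g) <= N f + N g,
      forall a f, N (a *: f) = cabs a * N f,
      forall f, nrm f <= N f,
      forall f, N f <= K * nrm f &
      forall f, N (Q f) <= th * N f].
Proof.
(* By Bernoulli's inequality th^n >= 1 - n x = 1/2. *)
pose x : R := (2 * n%:R)^-1; pose th := 1 - x.
have n0 : 1 <= n%:R :> R by rewrite ler1n.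
have nx : n%:R * x = 1 / 2 by rewrite /x; field; lra.
have x0 : 0 < x by rewrite invr_gt0; lra.
have x1 : x <= 1 / 2 by rewrite -nx ler_peMl// ltW.
have th0 : 0 < th by rewrite /th; lra.
have th1 : th < 1 by rewrite /th; lra.
have bern k : 1 - k%:R * x <= th ^+ k.
  elim: k => [|k IH]; first by rewrite mul0r subr0 expr0.
  rewrite exprSr (le_trans _ (ler_wpM2r (ltW th0) IH))//.
  have : 0 <= k%:R * x * x.
    by apply: mulr_ge0; [apply: mulr_ge0 => //|]; exact: ltW.
  by rewrite /th -natr1; lra.
have thn : 1 / 2 <= th ^+ n by have := bern n; rewrite nx; lra.
pose a k f : R := th^-1 ^+ k * nrm (iter k Q f).
have thV : 0 <= th^-1 by rewrite invr_ge0 ltW.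
have a0 k f : 0 <= a k f by rewrite /a mulr_ge0 ?nrm_ge0// exprn_ge0.
exists (fun f => \sum_(k < n) a k f), th, (\sum_(k < n) th^-1 ^+ k * q ^+ k).
split; first by rewrite ltW.
split; first by apply: sumr_ge0 => k _; rewrite mulr_ge0 ?exprn_ge0.
split.
- move=> f g; rewrite -big_split/=; apply: ler_sum => k _.
  by rewrite /a -mulrDr ler_wpM2l ?exprn_ge0// iterD nrmD.
- move=> c f; rewrite mulr_sumr; apply: eq_bigr => k _.
  by rewrite /a iterZ nrmZ mulrCA.
- move=> f; rewrite -(prednK n_gt0) big_ord_recl {1}/a expr0 mul1r lerDl.
  by apply: sumr_ge0.
- move=> f; rewrite mulr_suml; apply: ler_sum => k _.
  rewrite /a -mulrA ler_wpM2l ?exprn_ge0//.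
  elim: (k : nat) => [|j IH]; first by rewrite mul1r.
  rewrite iterS exprS -mulrA (le_trans (Q_bounded _))// ler_wpM2l//.
move=> f; have aS k : a k (Q f) = th * a k.+1 f.
  by rewrite /a -iterSr exprS mulrA mulrA divff ?mul1r ?gt_eqF.
under eq_bigr do rewrite aS.
rewrite -mulr_sumr; apply: ler_wpM2l; first exact: ltW.
have -> : \sum_(k < n) a k.+1 f = \sum_(k < n.+1) a k f - a 0%N f.
  by rewrite big_ord_recl/= addrC addKr.
rewrite big_ord_recr/= -addrA gerDl subr_le0 {2}/a expr0 mul1r /a exprVn.
rewrite ler_pdivrMl ?exprn_gt0// (le_trans (Q_contract f))//.
by rewrite ler_wpM2r ?nrm_ge0.
Qed.

End AdaptedNorm.

(** * Exponential of a bounded operator *)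

Section RealExponential.
Variable R : realType.
Implicit Types x : R.

Lemma exp_partial_sum_le x n : 0 <= x -> \sum_(k < n) x ^+ k / k`!%:R <= expR x.
Proof.
move=> x0; rewrite /expR -(big_mkord xpredT (fun k => x ^+ k / k`!%:R)).
apply: (@nondecreasing_cvgn_le _ (series (exp_coeff x))); last exact: is_cvg_series_exp_coeff.
apply: nondecreasing_series => k _ _.
by rewrite /exp_coeff /= divr_ge0 ?exprn_ge0.
Qed.

Lemma exp_term_le x n : 0 <= x -> x ^+ n / n`!%:R <= expR x.
Proof.
move=> x0; apply: le_trans (exp_partial_sum_le n.+1 x0).
rewrite big_ord_recr/= lerDr; apply: sumr_ge0 => k _.
by rewrite divr_ge0 ?exprn_ge0.
Qed.

Lemma pow_lip (s t : R) k : `|s| <= 1 -> `|t| <= 1 ->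
  `|s ^+ k - t ^+ k| <= k%:R * `|s - t|.
Proof.
move=> s1 t1; elim: k => [|k IH]; first by rewrite subrr normr0 mul0r.
have -> : s ^+ k.+1 - t ^+ k.+1 = s * (s ^+ k - t ^+ k) + (s - t) * t ^+ k.
  by rewrite !exprS; ring.
apply: (le_trans (ler_normD _ _)); rewrite !normrM -natr1 mulrDl mul1r lerD//.
  by rewrite (le_trans _ IH)// ler_piMl.
by rewrite ler_piMr// normrX exprn_ile1.
Qed.

Lemma pow_taylor (s t : R) k : `|s| <= 1 -> `|t| <= 1 ->
  `|s ^+ k.+1 - t ^+ k.+1 - k.+1%:R * t ^+ k * (s - t)|
    <= (k.+1 ^ 2)%:R * `|s - t| ^+ 2.
Proof.
move=> s1 t1; elim: k => [|k IH].
  by rewrite !expr1 expr0 !mul1r subrr normr0 sqr_ge0.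
have -> : s ^+ k.+2 - t ^+ k.+2 - k.+2%:R * t ^+ k.+1 * (s - t)
   = s * (s ^+ k.+1 - t ^+ k.+1 - k.+1%:R * t ^+ k * (s - t))
     + k.+1%:R * t ^+ k * (s - t) ^+ 2.
  by rewrite !exprS -[k.+2%:R]natr1; ring.
apply: (le_trans (ler_normD _ _)); rewrite normrM.
have h1 : `|s| * `|s ^+ k.+1 - t ^+ k.+1 - k.+1%:R * t ^+ k * (s - t)|
     <= (k.+1 ^ 2)%:R * `|s - t| ^+ 2.
  by apply: (le_trans _ IH); rewrite ler_piMl.
have h2 : `|k.+1%:R * t ^+ k * (s - t) ^+ 2| <= k.+1%:R * `|s - t| ^+ 2.
  rewrite normrM (normrX 2) ler_wpM2r ?sqr_ge0// normrM normr_nat.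
  by rewrite ler_piMr// normrX exprn_ile1.
apply: (le_trans (lerD h1 h2)); rewrite -mulrDl ler_wpM2r ?sqr_ge0//.
by rewrite -natrD ler_nat -!mulnn -mulnSr leq_mul2r leqnSn orbT.
Qed.

End RealExponential.

Section OperatorExponential.
Variables (R : realType) (V : lmodType R[i]) (N : V -> R).
Hypothesis ND : forall f g, N (f + g) <= N f + N g.
Hypothesis NZ : forall a f, N (a *: f) = cabs a * N f.
Hypothesis N_eq0 : forall f, N f = 0 -> f = 0.
Hypothesis N_complete : forall (u : nat -> V) (C th : R),
  0 <= th < 1 -> 0 <= C -> (forall n, N (u n.+1 - u n) <= C * th ^+ n) ->
  exists l, forall n, N (u n - l) <= C * th ^+ n / (1 - th).

Variables (A : V -> V) (a : R).
Hypothesis A_linear : forall x f g, A (x *: f + g) = x *: A f + A g.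
Hypothesis a_ge0 : 0 <= a.
Hypothesis A_bounded : forall f, N (A f) <= a * N f.
Implicit Types (s t : R) (f g : V).

Let N0 : N 0 = 0. Proof. by rewrite -(scale0r 0) NZ cabs0 mul0r. Qed.
Let NN f : N (- f) = N f.
Proof. by rewrite -scaleN1r NZ cabsN cabs1 mul1r. Qed.
Let N_ge0 f : 0 <= N f.
Proof. have := ND f (- f); rewrite subrr N0 NN; lra. Qed.
Let NB f g : N (f - g) <= N f + N g.
Proof. by rewrite -[N g]NN ND. Qed.
Let N_dist f g : N (f - g) = N (g - f). Proof. by rewrite -NN opprB. Qed.

Let AD f g : A (f + g) = A f + A g.
Proof. by have := A_linear 1 f g; rewrite !scale1r. Qed.
Let A0 : A 0 = 0.
Proof. by have := AD 0 0; rewrite addr0 => /eqP; rewrite -subr_eq subrr eq_sym => /eqP. Qed.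
Let AZ x f : A (x *: f) = x *: A f.
Proof. by have := A_linear x f 0; rewrite !addr0 A0 addr0. Qed.
Let AB f g : A (f - g) = A f - A g.
Proof. by rewrite AD -scaleN1r AZ scaleN1r. Qed.

Definition exp_partial t f n :=
  \sum_(k < n) (t ^+ k / k`!%:R)%:C *: iter k A f.

Let U := exp_partial.

Let US t f n : U t f n.+1 = U t f n + (t ^+ n / n`!%:R)%:C *: iter n A f.
Proof. by rewrite /U /exp_partial big_ord_recr. Qed.

Let U0 t f : U t f 0 = 0. Proof. by rewrite /U /exp_partial big_ord0. Qed.

Let iter_bounded n f : N (iter n A f) <= a ^+ n * N f.
Proof.
elim: n => [|n IH]; first by rewrite mul1r.
by rewrite iterS exprS -mulrA (le_trans (A_bounded _))// ler_wpM2l.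
Qed.

Let U_linear t x f g n : U t (x *: f + g) n = x *: U t f n + U t g n.
Proof.
have iL k : iter k A (x *: f + g) = x *: iter k A f + iter k A g.
  by elim: k => //= k ->.
elim: n => [|n IH]; first by rewrite !U0 scaler0 addr0.
by rewrite !US IH iL !scalerDr addrACA !scalerA mulrC.
Qed.

(** The 4 buys a factor 4^k in the k-th term of the series: it pays for the geometric tail, and for
    the factors k and k^2 that come from comparing powers of s and t. *)
Let C0 := expR (4 * a).
Let C0_ge0 : 0 <= C0. Proof. exact: expR_ge0. Qed.
Let a4 : 0 <= 4 * a. Proof. by rewrite mulr_ge0. Qed.

Let coef_le n : a ^+ n / n`!%:R <= C0 * (1 / 2) ^+ n.
Proof.
have := exp_term_le n a4; rewrite -/C0 => h.
have -> : a ^+ n / n`!%:R = ((4 * a) ^+ n / n`!%:R) * (1 / 4) ^+ n.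
  by rewrite mulrAC -exprMn (_ : 4 * a * (1 / 4) = a)//; field.
apply: ler_pM => //; first by rewrite divr_ge0 ?exprn_ge0.
by rewrite lerXn2r ?nnegrE//; lra.
Qed.

Let U_step t f n : `|t| <= 1 -> N (U t f n.+1 - U t f n) <= C0 * N f * (1 / 2) ^+ n.
Proof.
move=> t1; rewrite US addrC addKr NZ cabsR mulrAC normrM normrX.
rewrite (ger0_norm (_ : 0 <= n`!%:R^-1)) ?invr_ge0//.
have t1n : `|t| ^+ n <= 1 by rewrite exprn_ile1.
apply: (@le_trans _ _ (1 / n`!%:R * (a ^+ n * N f))).
  apply: ler_pM; [|by []|by rewrite ler_wpM2r ?invr_ge0|exact: iter_bounded].
  by rewrite mulr_ge0 ?exprn_ge0 ?invr_ge0.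
rewrite mul1r mulrA ler_wpM2r// mulrC; exact: coef_le.
Qed.

Let half01 : 0 <= (1 / 2 : R) < 1. Proof. by apply/andP; split; lra. Qed.

Let U_limit t f : exists l, `|t| <= 1 ->
  forall n, N (U t f n - l) <= C0 * N f * (1 / 2) ^+ n / (1 - 1 / 2).
Proof.
have [t1|_] := boolP (`|t| <= 1); last by exists 0.
have [|l Hl] := N_complete half01 _ (fun n => U_step f n t1).
  by rewrite mulr_ge0.
by exists l.
Qed.

Let eq_limit (u : nat -> V) l l' C : (forall n, N (u n - l) <= C * (1 / 2) ^+ n) ->
  (forall n, N (u n - l') <= C * (1 / 2) ^+ n) -> l = l'.
Proof.
move=> ul ul'; apply/eqP; rewrite -subr_eq0; apply/eqP/N_eq0/eqP.
rewrite eq_le N_ge0 andbT; apply: (@geometric_le _ _ _ (2 * C) (1 / 2)) => // n.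
rewrite -(subrKA (u n)) (le_trans (ND _ _))// (N_dist l).
have := ul n; have := ul' n; lra.
Qed.

(** [M t] is exp (t A). The last two estimates are proved for partial sums, with constants
    controlled by the scalar series at 4 a, and survive the limit. *)
Lemma operator_exponential : exists (M : R -> V -> V) (K : R), 0 <= K /\
  [/\ forall t x f g, M t (x *: f + g) = x *: M t f + M t g,
      forall t f, `|t| <= 1 -> forall n,
        N (exp_partial t f n - M t f) <= K * N f * (1 / 2) ^+ n,
      forall f, M 0 f = f,
      forall s t f, `|s| <= 1 -> `|t| <= 1 ->
        N (M s f - M t f) <= K * `|s - t| * N f &
      forall s t f, `|s| <= 1 -> `|t| <= 1 ->
        N (M s f - M t f - (s - t)%:C *: A (M t f)) <= K * `|s - t| ^+ 2 * N f].
Proof.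
have limM t : exists Mt : V -> V, `|t| <= 1 -> forall f n,
    N (U t f n - Mt f) <= 2 * C0 * N f * (1 / 2) ^+ n.
  have /choice[Mt HM] := U_limit t; exists Mt => t1 f n.
  by apply: (le_trans (HM f t1 n)); rewrite le_eqVlt; apply/orP; left; apply/eqP; field.
have /choice[M' HM'] := limM.
(* Where no limit was constructed, the zero operator keeps linearity valid for all t. *)
pose M t f := if `|t| <= 1 then M' t f else 0.
have HM t f n : `|t| <= 1 -> N (U t f n - M t f) <= 2 * C0 * N f * (1 / 2) ^+ n.
  by move=> t1; rewrite /M t1; exact: HM'.
have HMd t f n : `|t| <= 1 -> N (M t f - U t f n) <= 2 * C0 * N f * (1 / 2) ^+ n.
  by move=> t1; rewrite N_dist; exact: HM.
exists M, (2 * C0); split; first by rewrite mulr_ge0.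
have pw n : 0 <= (1 / 2 : R) ^+ n by rewrite exprn_ge0.
split.
- move=> t x f g; have [t1|t1] := boolP (`|t| <= 1); last first.
    by rewrite /M (negbTE t1) scaler0 addr0.
  pose C := 2 * C0 * N (x *: f + g) + (cabs x * (2 * C0 * N f) + 2 * C0 * N g).
  apply: (@eq_limit (U t (x *: f + g)) _ _ C) => n.
    apply: (le_trans (HM _ _ _ t1)); rewrite ler_wpM2r// /C lerDl.
    by rewrite addr_ge0 ?mulr_ge0 ?cabs_ge0.
  rewrite U_linear opprD addrACA -scalerBr (le_trans (ND _ _))// NZ.
  have h1 := ler_wpM2l (cabs_ge0 x) (HM t f n t1); have h2 := HM t g n t1.
  apply: (le_trans (lerD h1 h2)); rewrite /C mulrA -mulrDl ler_wpM2r//.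
  by rewrite lerDr mulr_ge0// mulr_ge0.
- by move=> t f t1 n; exact: HM.
- move=> f; have t1 : `|0 : R| <= 1 by rewrite normr0.
  have U00 n : U 0 f n.+1 = f.
    elim: n => [|n IH]; first by rewrite US U0 add0r expr0 divr1 scale1r.
    by rewrite US IH expr0n mul0r scale0r addr0.
  apply/eqP; rewrite -subr_eq0; apply/eqP/N_eq0/eqP; rewrite eq_le N_ge0 andbT.
  apply: (@geometric_le _ _ _ (2 * C0 * N f) (1 / 2)) => // n.
  rewrite add0r N_dist -{1}(U00 n) (le_trans (HM 0 f n.+1 t1))//.
  rewrite ler_wpM2l ?mulr_ge0// exprS; have := pw n; lra.
- move=> s t f s1 t1.
  have UL n : N (U s f n - U t f n)
      <= `|s - t| * N f * \sum_(k < n) (4 * a) ^+ k / k`!%:R.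
    elim: n => [|n IH]; first by rewrite !U0 subrr N0 big_ord0 mulr0.
    rewrite !US big_ord_recr/= opprD addrACA mulrDr (le_trans (ND _ _))// lerD//.
    rewrite -scalerBl -rmorphB/= -mulrBl NZ cabsR normrM.
    rewrite (ger0_norm (_ : 0 <= n`!%:R^-1)) ?invr_ge0//.
    apply: (@le_trans _ _ (n%:R * `|s - t| / n`!%:R * (a ^+ n * N f))).
      by apply: ler_pM; rewrite ?mulr_ge0 ?invr_ge0// ler_wpM2r ?invr_ge0// pow_lip.
    rewrite exprMn.
    rewrite [leLHS](_ : _ = `|s - t| * N f * (a ^+ n / n`!%:R) * n%:R);
    last by ring.
    rewrite [leRHS](_ : _ = `|s - t| * N f * (a ^+ n / n`!%:R) * 4 ^+ n);
    last by ring.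
    rewrite ler_wpM2l//; first by rewrite !mulr_ge0 ?exprn_ge0 ?invr_ge0.
    by rewrite -natrX ler_nat ltnW// ltn_expl.
  apply: (@geometric_le _ _ _ (4 * C0 * N f) (1 / 2)) => // n.
  rewrite -(subrKA (U t f n)) -(subrKA (U s f n) (M s f)).
  have h : N (U s f n - U t f n) <= C0 * `|s - t| * N f.
    apply: (le_trans (UL n)); rewrite mulrC mulrA ler_wpM2r// ler_wpM2r//.
    exact: exp_partial_sum_le.
  apply: (le_trans (ND _ _)).
  apply: (le_trans (lerD (le_trans (ND _ _) (lerD (HMd s f n s1) h)) (HM t f n t1))).
  have : 0 <= C0 * `|s - t| * N f by rewrite mulr_ge0// mulr_ge0.
  lra.
move=> s t f s1 t1.
(* The index shift is that of differentiation: the derivative of the sum of n + 1 terms is A applied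
   to the sum of n terms. *)
pose W n := U s f n.+1 - U t f n.+1 - (s - t)%:C *: A (U t f n).
have WS n : W n.+1 = W n + ((s ^+ n.+1 - t ^+ n.+1 - n.+1%:R * t ^+ n * (s - t))
    / n.+1`!%:R)%:C *: iter n.+1 A f.
  have -> : ((s ^+ n.+1 - t ^+ n.+1 - n.+1%:R * t ^+ n * (s - t)) / n.+1`!%:R)
      = s ^+ n.+1 / n.+1`!%:R - t ^+ n.+1 / n.+1`!%:R - (s - t) * (t ^+ n / n`!%:R).
    rewrite factS natrM; field.
    by rewrite pnatr_eq0 -lt0n fact_gt0 addrC natr1 pnatr_eq0.
  have AU : A (U t f n.+1) = A (U t f n) + (t ^+ n / n`!%:R)%:C *: iter n.+1 A f.
    by rewrite US AD AZ.
  rewrite /W (US s f n.+1) (US t f n.+1) AU scalerDr !opprD.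
  have regroup (p1 p2 q1 q2 r1 r2 : V) :
      (p1 + p2) + (- q1 - q2) + (- r1 - r2) = (p1 - q1 - r1) + (p2 - q2 - r2).
    by rewrite (addrACA p1) (addrACA (p1 - q1)).
  rewrite regroup.
  have split3 (x y z : R) (v : V) :
      (x - y - z)%:C *: v = x%:C *: v - y%:C *: v - z%:C *: v.
    by rewrite !rmorphB/= !scalerBl.
  by congr (_ + _); rewrite split3 scalerA -rmorphM.
have WL n : N (W n) <= `|s - t| ^+ 2 * N f * \sum_(k < n.+1) (4 * a) ^+ k / k`!%:R.
  elim: n => [|n IH].
    rewrite /W !US !U0 A0 scaler0 !expr0 subrr sub0r oppr0 N0.
    by rewrite mulr_ge0 ?mulr_ge0 ?sqr_ge0// sumr_ge0// => k _; rewrite divr_ge0 ?exprn_ge0.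
  rewrite WS (le_trans (ND _ _))// big_ord_recr [leRHS]mulrDr; apply: lerD => //=.
  rewrite NZ cabsR normrM (ger0_norm (_ : 0 <= n.+1`!%:R^-1)) ?invr_ge0//.
  apply: (@le_trans _ _ ((n.+1 ^ 2)%:R * `|s - t| ^+ 2 / n.+1`!%:R * (a ^+ n.+1 * N f))).
    apply: ler_pM; [by rewrite mulr_ge0 ?invr_ge0|by []| |exact: (iter_bounded n.+1)].
    by rewrite ler_wpM2r ?invr_ge0// pow_taylor.
  rewrite exprMn.
  rewrite [leLHS](_ : _ = `|s - t| ^+ 2 * N f * (a ^+ n.+1 / n.+1`!%:R) * (n.+1 ^ 2)%:R);
    last by ring.
  rewrite [leRHS](_ : _ = `|s - t| ^+ 2 * N f * (a ^+ n.+1 / n.+1`!%:R) * 4 ^+ n.+1);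
    last by ring.
  rewrite ler_wpM2l//; first by rewrite !mulr_ge0 ?exprn_ge0 ?invr_ge0 ?sqr_ge0.
  rewrite -natrX ler_nat (_ : 4 = 2 ^ 2)%N// -expnM mulnC expnM leq_exp2r//.
  by rewrite ltnW// ltn_expl.
pose c4 := 4 * C0 * N f + 2 * (a * (2 * C0 * N f)).
apply: (@geometric_le _ _ _ c4 (1 / 2)) => // n.
have -> : M s f - M t f - (s - t)%:C *: A (M t f)
  = (M s f - U s f n.+1) - (M t f - U t f n.+1)
    + (W n - (s - t)%:C *: A (M t f - U t f n)).
  rewrite AB scalerBr /W !opprB subrKA [RHS]addrA; congr (_ - _).
  by rewrite addrAC subrKA subrKA.
have st2 : `|s - t| <= 2 by rewrite (le_trans (ler_normB _ _))//; lra.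
have h1 : N (M s f - U s f n.+1) <= 2 * C0 * N f * (1 / 2) ^+ n.
  apply: (le_trans (HMd _ _ _ s1)); rewrite ler_wpM2l ?mulr_ge0// exprS.
  by have := pw n; lra.
have h2 : N (M t f - U t f n.+1) <= 2 * C0 * N f * (1 / 2) ^+ n.
  apply: (le_trans (HMd _ _ _ t1)); rewrite ler_wpM2l ?mulr_ge0// exprS.
  by have := pw n; lra.
have h3 : N ((s - t)%:C *: A (M t f - U t f n))
    <= 2 * (a * (2 * C0 * N f * (1 / 2) ^+ n)).
  rewrite NZ cabsR; apply: ler_pM => //; apply: (le_trans (A_bounded _)).
  by rewrite ler_wpM2l// HMd.
have h4 : N (W n) <= C0 * `|s - t| ^+ 2 * N f.
  apply: (le_trans (WL n)); rewrite mulrC mulrA ler_wpM2r// ler_wpM2r ?sqr_ge0//.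
  exact: exp_partial_sum_le.
have h5 : 0 <= C0 * `|s - t| ^+ 2 * N f by rewrite mulr_ge0// mulr_ge0 ?sqr_ge0.
apply: (le_trans (ND _ _)); apply: (le_trans (lerD (NB _ _) (NB _ _))).
have := lerD (lerD h1 h2) (lerD h4 h3); rewrite /c4; lra.
Qed.
End OperatorExponential.

(** * Bounded measurable functions *)

Section BoundedMeasurable.
Context {d : measure_display} {X : measurableType d} {R : realType}.
Implicit Types (G H : X -> R) (m : {measure set X -> \bar R}).

Definition bounded_measurable G :=
  measurable_fun setT G /\ exists M, forall x, `|G x| <= M.

Lemma bm_cst (a : R) : bounded_measurable (cst a).
Proof. by split; [exact: measurable_cst | exists `|a|]. Qed.

Lemma bmD G H : bounded_measurable G -> bounded_measurable H ->
  bounded_measurable (fun x => G x + H x).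
Proof.
move=> [mG [M GM]] [mH [M' HM']]; split; first exact: measurable_funD.
by exists (M + M') => x; rewrite (le_trans (ler_normD _ _))// lerD.
Qed.

Lemma bmM G H : bounded_measurable G -> bounded_measurable H ->
  bounded_measurable (fun x => G x * H x).
Proof.
move=> [mG [M GM]] [mH [M' HM']]; split; first exact: measurable_funM.
by exists (M * M') => x; rewrite normrM ler_pM.
Qed.

Lemma bmZ (a : R) G : bounded_measurable G ->
  bounded_measurable (fun x => a * G x).
Proof. by move=> bG; apply: (bmM (bm_cst a)). Qed.

Lemma bm_indic (A : set X) : measurable A -> bounded_measurable (\1_A : X -> R).
Proof.
move=> mA; split; first exact: measurable_indic.
by exists 1 => x; rewrite indicE normr_nat; case: (_ \in _).
Qed.

Lemma bm_comp (T : X -> X) G : measurable_fun setT T -> bounded_measurable G ->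
  bounded_measurable (G \o T).
Proof.
by move=> mT [mG [M GM]]; split; [exact: measurableT_comp | exists M => x; exact: GM].
Qed.

Lemma bm_expR G : bounded_measurable G -> bounded_measurable (expR \o G).
Proof.
move=> [mG [M GM]]; split; first exact: measurableT_comp.
exists (expR M) => x /=; rewrite ger0_norm ?expR_ge0// ler_expR.
exact: le_trans (ler_norm _) (GM x).
Qed.

Lemma bm_bounded G : bounded_measurable G -> [bounded G x | x in setT].
Proof.
move=> [_ [M GM]]; exists M; split; first exact: num_real.
by move=> M' MM' x _; exact: le_trans (GM x) (ltW MM').
Qed.

Lemma bm_integrable m G w : bounded_measurable G ->
  m.-integrable setT (EFin \o w) ->
  m.-integrable setT (EFin \o (fun x => G x * w x)).
Proof.
move=> bG iw; have := integrableMr measurableT (proj1 bG) (bm_bounded bG) iw.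
by apply: eq_integrable.
Qed.

(* Subtracting [(M/2) 1_(G >= M/2)] from a function with values in [0, M]
   leaves one with values in [0, M/2] and does not change [Delta]. *)
Lemma bounded_measurable_ind (Delta : (X -> R) -> R) (C : R) :
  (forall G H, bounded_measurable G -> bounded_measurable H ->
     Delta (fun x => G x + H x) = Delta G + Delta H) ->
  (forall a G, bounded_measurable G -> Delta (fun x => a * G x) = a * Delta G) ->
  (forall G M, bounded_measurable G -> (forall x, `|G x| <= M) ->
     `|Delta G| <= C * M) ->
  (forall A, measurable A -> Delta \1_A = 0) ->
  forall G, bounded_measurable G -> Delta G = 0.
Proof.
move=> DD DZ DC D1.
have step k : forall M G, bounded_measurable G -> (forall x, 0 <= G x <= M) ->
    `|Delta G| <= C * M * (1 / 2) ^+ k.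
  elim: k => [|k IH] M G bG GM.
    rewrite mulr1; apply: DC => // x; have /andP[h1 h2] := GM x.
    by rewrite ger0_norm.
  pose A := [set x | M / 2 <= G x].
  have mA : measurable A.
    rewrite -[A]setTI; apply: measurable_fun_le => //; exact: (proj1 bG).
  pose H x := G x + (- (M / 2)) * (\1_A x : R).
  have bA := bmZ (- (M / 2)) (bm_indic mA).
  have bH : bounded_measurable H by apply: bmD.
  have -> : Delta G = Delta H.
    by rewrite /H DD// DZ ?D1 ?mulr0 ?addr0//; exact: bm_indic.
  rewrite exprS (_ : C * M * _ = C * (M / 2) * (1 / 2) ^+ k); last by field.
  apply: IH => // x; have /andP[h1 h2] := GM x; rewrite /H indicE.
  have [xA|xA] := boolP (x \in A); rewrite ?mulr1 ?mulr0 ?addr0.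
    by move: xA; rewrite inE /A/= => xA; apply/andP; split; lra.
  by move: xA; rewrite notin_setE /A/= => /negP; rewrite -ltNge => /ltW ->; rewrite h1.
have pos M G : bounded_measurable G -> (forall x, 0 <= G x <= M) -> Delta G = 0.
  move=> bG GM; apply/eqP; rewrite -normr_le0.
  have e0 (e : R) : 0 < e -> `|Delta G| <= 0 + e.
    move=> e0; have : (fun k => C * M * (1 / 2 : R) ^+ k) @ \oo --> C * M * 0.
      by apply: cvgM; [exact: cvg_cst | apply: cvg_expr; rewrite ger0_norm; lra].
    rewrite mulr0 => /cvgrPdist_lt /(_ e e0) [n0 _ Hn0].
    have := Hn0 n0 (leqnn _); rewrite /= sub0r normrN => h.
    rewrite add0r (le_trans (step n0 M G bG GM))// ltW//.
    exact: le_lt_trans (ler_norm _) h.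
  by apply/ler_addgt0Pr.
move=> G bG; have [_ [M GM]] := bG.
(* Adding the constant M makes the function nonnegative and costs nothing, since [Delta] vanishes on
   the indicator of the whole space. *)
have shift : Delta (fun x => G x + M * (\1_[set: X] x : R)) = 0.
  apply: (pos (M + M)).
    by apply: bmD => //; apply: bmZ; exact: bm_indic.
  move=> x; rewrite indicE in_setT mulr1; have := GM x; rewrite ler_norml.
  by move=> /andP[? ?]; apply/andP; split; lra.
have bT : bounded_measurable (\1_[set: X] : X -> R) by exact: bm_indic.
by move: shift; rewrite DD//; [rewrite DZ// D1// mulr0 addr0|exact: bmZ].
Qed.

End BoundedMeasurable.

(** * Integration of bounded functions against densities *)

Section Pairing.
Context {d : measure_display} {X : measurableType d} {R : realType}.
Variable m : {measure set X -> \bar R}.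
Implicit Types (G H w : X -> R).

Definition pairing G w : R := Rintegral m setT (fun x => G x * w x).

Let integ w := m.-integrable setT (EFin \o w).

Lemma pairingDl G H w : bounded_measurable G -> bounded_measurable H ->
  integ w -> pairing (fun x => G x + H x) w = pairing G w + pairing H w.
Proof.
move=> bG bH iw; rewrite /pairing -RintegralD//; [|exact: bm_integrable..].
by apply: eq_Rintegral => x _; rewrite mulrDl.
Qed.

Lemma pairingZl a G w : bounded_measurable G -> integ w ->
  pairing (fun x => a * G x) w = a * pairing G w.
Proof.
move=> bG iw; rewrite /pairing -RintegralZl//; last exact: bm_integrable.
by apply: eq_Rintegral => x _; rewrite mulrA.
Qed.

Lemma pairingDr G w w' : bounded_measurable G -> integ w -> integ w' ->
  pairing G (fun x => w x + w' x) = pairing G w + pairing G w'.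
Proof.
move=> bG iw iw'; rewrite /pairing -RintegralD//; [|exact: bm_integrable..].
by apply: eq_Rintegral => x _; rewrite mulrDr.
Qed.

Lemma pairingZr a G w : bounded_measurable G -> integ w ->
  pairing G (fun x => a * w x) = a * pairing G w.
Proof.
move=> bG iw; rewrite /pairing -RintegralZl//; last exact: bm_integrable.
by apply: eq_Rintegral => x _; rewrite mulrCA.
Qed.

Lemma pairing_le G w M : bounded_measurable G -> (forall x, `|G x| <= M) ->
  integ w -> `|pairing G w| <= M * Rintegral m setT (fun x => `|w x|).
Proof.
move=> bG GM iw; have iGw := bm_integrable bG iw.
apply: (le_trans (le_normr_Rintegral measurableT iGw)).
have iaw : integ (fun x => `|w x|).
  by have := integrable_abse iw; apply: eq_integrable.
rewrite -RintegralZl//; apply: le_Rintegral => //.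
- by have := integrable_abse iGw; apply: eq_integrable.
- have bM : bounded_measurable (cst M : X -> R) by exact: bm_cst.
  exact: (bm_integrable bM iaw).
- by move=> x _; rewrite normrM ler_wpM2r.
Qed.

Lemma pairing_indic A w : measurable A -> pairing \1_A w = Rintegral m A w.
Proof.
move=> mA; rewrite Rintegral_mkcond /pairing; apply: eq_Rintegral => x _.
by rewrite patch_indic mulrC.
Qed.

Lemma pairing_ae G w w' : bounded_measurable G -> integ w -> integ w' ->
  ae_eq m setT w w' -> pairing G w = pairing G w'.
Proof.
move=> bG iw iw' ww'; rewrite /pairing /Rintegral; congr fine.
apply: ae_eq_integral => //.
- by have /integrableP[] := bm_integrable bG iw.
- by have /integrableP[] := bm_integrable bG iw'.
- by apply: filterS ww' => x /= + _ => -> //.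
Qed.

End Pairing.

Section Densities.
Context {d : measure_display} {X : measurableType d} {R : realType}.
Variable m : probability X R.
Implicit Types (G w : X -> R) (nu : probability X R).

Lemma bm_integrable_prob nu G : bounded_measurable G ->
  nu.-integrable setT (EFin \o G).
Proof.
move=> bG; apply: measurable_bounded_integrable => //.
- exact: fin_num_fun_lty.
- exact: (proj1 bG).
- exact: bm_bounded.
Qed.

Lemma Rintegral_indic nu A : measurable A ->
  Rintegral nu setT (\1_A : X -> R) = fine (nu A).
Proof. by move=> mA; rewrite /Rintegral integral_indic// setIT. Qed.

Lemma Rintegral_prob_le nu G M : bounded_measurable G ->
  (forall x, `|G x| <= M) -> `|Rintegral nu setT G| <= M.
Proof.
move=> bG GM; have i1 := bm_integrable_prob nu (bm_cst (1 : R)).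
have := pairing_le bG GM i1.
have -> : pairing nu G (cst 1) = Rintegral nu setT G.
  by apply: eq_Rintegral => x _; rewrite mulr1.
have -> : Rintegral nu setT (fun x => `|cst 1 x : R|)
    = Rintegral nu setT (\1_setT : X -> R).
  by apply: eq_Rintegral => x _; rewrite normr1 in_setT.
move=> /le_trans; apply.
by rewrite Rintegral_indic// probability_setT mulr1.
Qed.

(** Both sides are linear in G and bounded by a multiple of sup |G|, so [bounded_measurable_ind]
    reduces the claim to indicators, where it is the Radon-Nikodym theorem. *)
Lemma pairing_density nu w : nu `<< m -> m.-integrable setT (EFin \o w) ->
  ae_eq m setT w
    (fun x => fine (Radon_Nikodym (charge_of_finite_measure nu) m x)) ->
  forall G, bounded_measurable G -> pairing m G w = Rintegral nu setT G.
Proof.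
move=> num iw wE.
pose Delta G := pairing m G w - Rintegral nu setT G.
suff D0 G : bounded_measurable G -> Delta G = 0.
  by move=> G bG; apply/eqP; rewrite -subr_eq0; apply/eqP/D0.
move: G; apply: (@bounded_measurable_ind _ _ _ Delta
    (Rintegral m setT (fun x => `|w x|) + 1)).
- move=> G H bG bH; rewrite /Delta pairingDl// RintegralD//; first by ring.
  + exact: bm_integrable_prob.
  + exact: bm_integrable_prob.
- move=> a G bG; rewrite /Delta pairingZl// RintegralZl//; first by ring.
  exact: bm_integrable_prob.
- move=> G M bG GM; rewrite /Delta (le_trans (ler_normB _ _))// mulrDl mul1r.
  apply: lerD; last exact: Rintegral_prob_le.
  by rewrite mulrC; exact: pairing_le.
- move=> A mA; rewrite /Delta Rintegral_indic// pairing_indic//.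
  have iRN := Radon_Nikodym_integrable (nu := charge_of_finite_measure nu) num.
  have -> : nu A = (\int[m]_(x in A) Radon_Nikodym (charge_of_finite_measure nu) m x)%E.
    by rewrite -Radon_Nikodym_integral.
  apply/eqP; rewrite subr_eq0; apply/eqP; rewrite /Rintegral; congr fine.
  apply: ae_eq_integral => //.
  + have /integrableP[mw _] := iw; exact: measurable_funS mw.
  + have /integrableP[mw _] := iRN; exact: measurable_funS mw.
  + apply: filterS wE => x /= wx _; rewrite wx// fineK//.
    exact: Radon_Nikodym_fin_num.
Qed.

End Densities.

(** * Legendre transform *)

Lemma lipschitz_continuous (R : realType) (f : R -> R) (K : R) :
  (forall x y, `|f x - f y| <= K * `|x - y|) -> continuous f.
Proof.
move=> fK x; apply/cvgrPdist_lt => e e0.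
have K1 : 0 < `|K| + 1 by rewrite ltr_wpDl.
apply/nbhs_ballP; exists (e / (`|K| + 1)); first by rewrite /= divr_gt0.
move=> y; rewrite /ball/= ltr_pdivlMr// mulrC; apply: le_lt_trans.
apply: (le_trans (fK x y)); rewrite ler_wpM2r//.
by rewrite (le_trans (ler_norm _))// lerDl.
Qed.

Section Legendre.
Variables (R : realType) (L G : R -> R) (C t1 tau : R).
Hypothesis tau01 : 0 < tau < t1.
Hypothesis C_ge0 : 0 <= C.
Hypothesis G_bounded : forall t, `|t| < t1 -> `|G t| <= C.
Hypothesis L_semiconcave : forall s t, `|s| < t1 -> `|t| < t1 ->
  L s <= L t + (s - t) * G t + C * (s - t) ^+ 2.
Hypothesis L0 : L 0 = 0.
Hypothesis L_ge0 : forall t, `|t| < t1 -> 0 <= L t.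
Hypothesis L_tau : 0 < L tau.
Hypothesis L_Ntau : 0 < L (- tau).

Implicit Types s t x y : R.

Let tau_gt0 : 0 < tau. Proof. by case/andP: tau01. Qed.

Let small t : `|t| <= tau -> `|t| < t1.
Proof. by move=> /le_lt_trans; apply; case/andP: tau01. Qed.

Let L_lip s t : `|s| <= tau -> `|t| <= tau ->
  L s - L t <= (C + 2 * C * tau) * `|s - t|.
Proof.
move=> s1 t1'; have := L_semiconcave (small s1) (small t1').
have h1 : (s - t) * G t <= C * `|s - t|.
  rewrite (le_trans (ler_norm _))// normrM mulrC ler_wpM2r//.
  exact: G_bounded (small t1').
have h2 : C * (s - t) ^+ 2 <= 2 * C * tau * `|s - t|.
  rewrite -[X in C * X]real_normK ?num_real// expr2.
  rewrite [leRHS](_ : _ = C * ((2 * tau) * `|s - t|)); last by ring.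
  rewrite ler_wpM2l// ler_wpM2r// (le_trans (ler_normB _ _))//; lra.
lra.
Qed.

(** L is controlled only near 0; composing with this 1-Lipschitz retraction yields a function
    continuous on the whole line, ready for the extreme value theorem. *)
Let clamp t := Num.max (- tau) (Num.min t tau).

Let clamp_le t : `|clamp t| <= tau.
Proof.
rewrite ler_norml /clamp le_max lexx/= ge_max ge_min lexx orbT andbT.
have := tau_gt0; lra.
Qed.

Let clamp_id t : `|t| <= tau -> clamp t = t.
Proof.
rewrite ler_norml => /andP[h1 h2]; rewrite /clamp min_l// max_r//.
Qed.

Let clamp_lip s t : `|clamp s - clamp t| <= `|s - t|.
Proof.
have := tau_gt0; rewrite /clamp /Num.max /Num.min => h.
rewrite ler_norml; case: (ltP s tau) => s1; case: (ltP t tau) => t2;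
  do 2 case: ltP => ?; have := ler_norm (s - t); have := ler_norm (t - s);
  rewrite (distrC t s) => ? ?; apply/andP; split; lra.
Qed.

Let maximizer x : exists t, `|t| <= tau /\
  forall s, `|s| <= tau -> s * x - L s <= t * x - L t.
Proof.
have ab : - tau <= tau by have := tau_gt0; lra.
have cont : continuous (fun t => clamp t * x - L (clamp t)).
  apply: (@lipschitz_continuous _ _ (`|x| + (C + 2 * C * tau))) => s t.
  have h1 := L_lip (clamp_le s) (clamp_le t).
  have h2 := L_lip (clamp_le t) (clamp_le s).
  rewrite (distrC (clamp t)) in h2.
  have h3 : 0 <= C + 2 * C * tau by apply: addr_ge0 => //; apply: mulr_ge0;
    [apply: mulr_ge0|exact: ltW].
  have h4 := ler_wpM2l h3 (clamp_lip s t).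
  have -> : clamp s * x - L (clamp s) - (clamp t * x - L (clamp t))
      = (clamp s - clamp t) * x - (L (clamp s) - L (clamp t)) by ring.
  apply: (le_trans (ler_normB _ _)); rewrite [leRHS]mulrDl lerD//.
    by rewrite normrM mulrC ler_wpM2l// clamp_lip.
  by rewrite ler_norml; apply/andP; split; lra.
have [t] := EVT_max ab (continuous_subspaceT cont).
rewrite in_itv/= -ler_norml => tt Ht; exists t; split=> // s ss.
have := Ht s; rewrite in_itv/= -ler_norml => /(_ ss).
by rewrite !clamp_id.
Qed.

Let tmax x := projT1 (cid (maximizer x)).
Let tmaxP x : `|tmax x| <= tau /\
  forall s, `|s| <= tau -> s * x - L s <= tmax x * x - L (tmax x).
Proof. by rewrite /tmax; case: cid. Qed.

Let c x := tmax x * x - L (tmax x).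
(** Exactly what makes t x - L t negative at t = tau and t = - tau for |x| < eps0. *)
Let eps0 := Num.min (L tau) (L (- tau)) / tau.

Let c_ge0 x : 0 <= c x.
Proof.
have [_ /(_ 0)] := tmaxP x; rewrite normr0 mul0r L0 subr0; apply.
exact: ltW.
Qed.

(* A maximizer on the boundary would give a negative value, below the value
   0 taken at the origin. *)
Let max_interior x t : `|x| < eps0 -> `|t| <= tau -> t * x - L t = c x ->
  `|t| < tau.
Proof.
move=> xe tt tc; rewrite lt_neqAle tt andbT; apply/eqP => teq.
have : 0 <= t * x - L t by rewrite tc c_ge0.
have : tau * `|x| < Num.min (L tau) (L (- tau)) by rewrite mulrC -ltr_pdivlMr.
rewrite lt_min => /andP[h1 h2].
have h3 : t * x <= tau * `|x| by rewrite (le_trans (ler_norm _))// normrM teq.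
have [t0|t0] := leP 0 t; rewrite ?(ger0_norm t0) ?(ltr0_norm t0) in teq.
  by rewrite teq in h3 *; lra.
have te : t = - tau by rewrite -teq opprK.
by rewrite te in h3 *; lra.
Qed.

(** Maximality bounds L from below by a line of slope x, semiconcavity from above by a parabola of
    slope [G t]; touching at the interior point t, the two have equal slopes. *)
Let max_slope x t : `|t| < tau ->
  (forall s, `|s| <= tau -> s * x - L s <= t * x - L t) -> G t = x.
Proof.
move=> tt tm; have tl := ltW tt.
have key s : `|s| <= tau -> (s - t) * (x - G t) <= C * (s - t) ^+ 2.
  move=> ss; have := tm s ss; have := L_semiconcave (small ss) (small tl); lra.
set y := x - G t.
suff : y = 0 by rewrite /y => /eqP; rewrite subr_eq0 => /eqP.
(* Small enough that t + u and t - u remain in [-tau, tau], and that the inequality u |y| <= C u^2,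
   found by moving in the direction of the sign of y, is impossible. *)
pose u := Num.min (tau - `|t|) (`|y| / (C + 1)) / 2.
apply/eqP/negPn/negP => y0.
have C1 : 0 < C + 1 by rewrite ltr_wpDl.
have u0 : 0 < u by rewrite /u divr_gt0// lt_min subr_gt0 tt/= divr_gt0// normr_gt0.
have u1 : u <= tau - `|t|.
  have : 2 * u <= tau - `|t| by rewrite /u mulrC divfK// ge_min lexx.
  by lra.
have u2 : 2 * u * (C + 1) <= `|y|.
  by rewrite -ler_pdivlMr// /u mulrC divfK// ge_min lexx orbT.
have uy : u * `|y| <= C * u ^+ 2.
  have [y1|y1] := leP 0 y.
    have := key (t + u); rewrite [t + u - t]addrAC subrr add0r -/y (ger0_norm y1); apply.
    by rewrite (le_trans (ler_normD _ _))// (ger0_norm (ltW u0)); lra.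
  have := key (t - u); rewrite [t - u - t]addrAC subrr add0r -/y sqrrN (ltr0_norm y1).
  rewrite mulrN -mulNr; apply.
  by rewrite (le_trans (ler_normB _ _))// (ger0_norm (ltW u0)); lra.
have : u * (2 * u * (C + 1)) <= C * u ^+ 2 by rewrite (le_trans _ uy)// ler_wpM2l// ltW.
have : 0 <= C * u ^+ 2 by rewrite mulr_ge0 ?sqr_ge0.
have : 0 < u ^+ 2 by rewrite exprn_gt0.
lra.
Qed.

(** [c] is a maximum of affine functions with slopes in [-tau, tau], hence convex and tau-Lipschitz.
    Equality in convexity would make one t optimal for both x and y, so x = G t = y. If c x = 0 then
    t = 0 is optimal and x = G 0; as c 0 = 0, also 0 = G 0. *)
Lemma legendre_rate : exists (e0 : R) (c : R -> R),
  [/\ 0 < e0, continuous c, strictly_convex_on `]- e0, e0[ c,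
      forall x, - e0 < x < e0 -> (c x = 0 <-> x = 0) &
      (forall x y, `|c x - c y| <= tau * `|x - y|) /\
      forall x, 0 < x < e0 -> exists t, [/\ 0 <= t < tau, c x = t * x - L t &
        forall s, `|s| < t1 -> L s <= L t + (s - t) * x + C * (s - t) ^+ 2]].
Proof.
have c_lip x y : c x - c y <= tau * `|x - y|.
  have [tx _] := tmaxP x; have [_ /(_ _ tx)] := tmaxP y; rewrite -/(c y) => h.
  have : tmax x * (x - y) <= tau * `|x - y|.
    by rewrite (le_trans (ler_norm _))// normrM ler_wpM2r.
  rewrite {1}/c; lra.
have c_lip2 x y : `|c x - c y| <= tau * `|x - y|.
  rewrite ler_norml; have := c_lip x y; have := c_lip y x.
  by rewrite (distrC y) => ? ?; apply/andP; split; lra.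
have itvE x : (- eps0 < x < eps0) = (`|x| < eps0) by rewrite ltr_norml.
have tint x : `|x| < eps0 -> `|tmax x| < tau.
  by move=> xe; apply: (max_interior xe); [case: (tmaxP x)|].
exists eps0, c; split.
- by rewrite /eps0 divr_gt0// lt_min L_tau.
- exact: lipschitz_continuous c_lip2.
- move=> x y u; rewrite /= !in_itv/= !itvE => xe ye xy u0 u1.
  set z := u * x + (1 - u) * y.
  have [tz tzm] := tmaxP z.
  have hx : tmax z * x - L (tmax z) <= c x by have [_] := tmaxP x; apply.
  have hy : tmax z * y - L (tmax z) <= c y by have [_] := tmaxP y; apply.
  have cz : c z = u * (tmax z * x - L (tmax z)) + (1 - u) * (tmax z * y - L (tmax z)).
    by rewrite /c /z; ring.
  have u1' : 0 < 1 - u by lra.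
  have hx' := ler_wpM2l (ltW u0) hx; have hy' := ler_wpM2l (ltW u1') hy.
  rewrite lt_neqAle cz lerD// andbT; apply/eqP => e.
  have ex : tmax z * x - L (tmax z) = c x.
    by apply: (@mulfI _ u); [rewrite gt_eqF|lra].
  have ey : tmax z * y - L (tmax z) = c y.
    by apply: (@mulfI _ (1 - u)); [rewrite gt_eqF|lra].
  have tt := max_interior xe tz ex.
  have Gx : G (tmax z) = x.
    by apply: max_slope => // s ss; rewrite ex; have [_] := tmaxP x; apply.
  have Gy : G (tmax z) = y.
    by apply: max_slope => // s ss; rewrite ey; have [_] := tmaxP y; apply.
  by move: xy; rewrite -Gx Gy eqxx.
- have zero_max x : c x = 0 -> G 0 = x.
    move=> cx; apply: max_slope; first by rewrite normr0.
    move=> s ss; rewrite mul0r L0 subr0 -cx.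
    by have [_] := tmaxP x; apply.
  have c0 : c 0 = 0.
    apply/eqP; rewrite eq_le c_ge0 andbT /c mulr0 sub0r oppr_le0.
    by apply/L_ge0/small; case: (tmaxP 0).
  move=> x _; split=> [cx|->//].
  by rewrite -(zero_max x cx) (zero_max 0 c0).
split=> // x /andP[x0 xe].
have xe' : `|x| < eps0 by rewrite gtr0_norm.
have [tx txm] := tmaxP x; have tt := tint x xe'.
exists (tmax x); split=> //.
  (* A negative maximizer would give c x <= t x < 0, because L >= 0. *)
  have [//|t0] := leP 0 (tmax x); first by rewrite (le_lt_trans (ler_norm _)).
  have := c_ge0 x; rewrite /c; have := L_ge0 (small tx).
  have : tmax x * x < 0 by rewrite nmulr_rlt0.
  lra.
by move=> s ss; have := L_semiconcave ss (small tx); rewrite (max_slope tt txm).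
Qed.

End Legendre.

(** * Local large deviations *)

Section LargeDeviations.
Context {d : measure_display} {X : measurableType d} {R : realType}.
Variables (nu : probability X R) (S : nat -> X -> R).
Hypothesis S_bm : forall n, bounded_measurable (S n).
Variables (L c : R -> R) (C t1 tau e0 : R).
Hypothesis tau01 : 0 < tau < t1.
Hypothesis C_ge0 : 0 <= C.
Hypothesis c_lip : forall x y, `|c x - c y| <= tau * `|x - y|.
Hypothesis c_max : forall x, 0 < x < e0 -> exists t,
  [/\ 0 <= t < tau, c x = t * x - L t &
    forall s, `|s| < t1 -> L s <= L t + (s - t) * x + C * (s - t) ^+ 2].

Let Z n t := Rintegral nu setT (fun x => expR (t * S n x)).

Hypothesis Z_growth : forall t, `|t| < t1 -> exists k1 k2 n0, 0 < k1 /\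
  forall n, (n0 <= n)%N ->
    k1 * expR (n%:R * L t) <= Z n t <= k2 * expR (n%:R * L t).

Implicit Types (s t u e delta : R) (n : nat).

Let bm_exp n t : bounded_measurable (fun x => expR (t * S n x)).
Proof. by apply: (bm_expR (bmZ t (S_bm n))). Qed.

Let tail n a := [set x | a < S n x].

Let tail_measurable n a : measurable (tail n a).
Proof.
rewrite -[tail n a]setCK; apply: measurableC.
rewrite (_ : ~` _ = setT `&` [set x | S n x <= a]); last first.
  by rewrite setTI; apply/seteqP; split=> x /=; rewrite ?leNgt => /negP.
by apply: measurable_fun_le => //; exact: (proj1 (S_bm n)).
Qed.

Let p n a := fine (nu (tail n a)).

Let integral_le (f g : X -> R) : bounded_measurable f -> bounded_measurable g ->
  (forall x, f x <= g x) -> Rintegral nu setT f <= Rintegral nu setT g.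
Proof.
by move=> bf bg fg; apply: le_Rintegral => //; exact: bm_integrable_prob.
Qed.

Let integralZ (f : X -> R) k : bounded_measurable f ->
  Rintegral nu setT (fun x => k * f x) = k * Rintegral nu setT f.
Proof. by move=> bf; rewrite RintegralZl//; exact: bm_integrable_prob. Qed.

Let integralB (f g : X -> R) : bounded_measurable f -> bounded_measurable g ->
  Rintegral nu setT (fun x => f x - g x) = Rintegral nu setT f - Rintegral nu setT g.
Proof. by move=> bf bg; rewrite RintegralB//; exact: bm_integrable_prob. Qed.

Let chernoff n t a : 0 <= t -> expR (t * a) * p n a <= Z n t.
Proof.
move=> t0; have bA := bm_indic (R := R) (tail_measurable n a).
rewrite /p -Rintegral_indic// -(integralZ _ bA).
apply: integral_le => //; first by apply: bmZ; exact: bm_indic.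
move=> x; rewrite indicE; have [xA|xA] := boolP (x \in _); last first.
  by rewrite mulr0 expR_ge0.
rewrite mulr1 ler_expR ler_wpM2l//; move: xA; rewrite inE => /ltW; exact.
Qed.

Let bmB (f g : X -> R) : bounded_measurable f -> bounded_measurable g ->
  bounded_measurable (fun x => f x - g x).
Proof.
move=> bf bg; have := bmD bf (bmZ (-1) bg); congr bounded_measurable.
by apply/funext => x; rewrite mulN1r.
Qed.

(* Under the density proportional to [exp (t S)], the two exponential tails
   control the mass outside [a < S < b]. *)
Let tilted_lower n t u a b : 0 <= t -> 0 <= u ->
  Z n t - expR (- (u * b)) * Z n (t + u) - expR (u * a) * Z n (t - u)
    <= expR (t * b) * p n a.
Proof.
move=> t0 u0; have bA := bm_indic (R := R) (tail_measurable n a).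
rewrite /p -Rintegral_indic// -(integralZ _ bA).
have b1 := bm_exp n t; have b2 := bmZ (expR (- (u * b))) (bm_exp n (t + u)).
have b3 := bmZ (expR (u * a)) (bm_exp n (t - u)).
rewrite /Z -(integralZ _ (bm_exp n (t + u))) -(integralZ _ (bm_exp n (t - u))).
rewrite -(integralB b1 b2) -(integralB (bmB b1 b2) b3).
apply: integral_le.
- by apply: bmB; [apply: bmB => //; exact: bmZ|exact: bmZ].
- by apply: bmZ; exact: bm_indic.
move=> x; set y := S n x.
have -> : expR (- (u * b)) * expR ((t + u) * y) = expR (t * y) * expR (u * (y - b)).
  by rewrite -!expRD; congr expR; ring.
have -> : expR (u * a) * expR ((t - u) * y) = expR (t * y) * expR (u * (a - y)).
  by rewrite -!expRD; congr expR; ring.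
have e0' := expR_ge0 (t * y).
have e1 := expR_ge0 (u * (y - b)); have e2 := expR_ge0 (u * (a - y)).
have m1 := mulr_ge0 e0' e1; have m2 := mulr_ge0 e0' e2.
(* For a < y <= b the main exponential is at most e^(t b); for y > b or y <= a one of the subtracted
   exponentials already dominates e^(t y). *)
rewrite indicE; have [xA|xA] := boolP (x \in _).
  move: xA; rewrite inE /tail/= -/y => ay; rewrite mulr1.
  have [yb|yb] := leP y b.
    have : expR (t * y) <= expR (t * b) by rewrite ler_expR ler_wpM2l.
    lra.
  have : 1 <= expR (u * (y - b)).
    by rewrite -expR0 ler_expR mulr_ge0// subr_ge0 ltW.
  move=> /(ler_wpM2l e0'); have := expR_ge0 (t * b); lra.
move: xA; rewrite notin_setE /tail/= -/y => /negP; rewrite -leNgt => ya.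
have : 1 <= expR (u * (a - y)) by rewrite -expR0 ler_expR mulr_ge0// subr_ge0.
move=> /(ler_wpM2l e0'); rewrite mulr0; lra.
Qed.

Let small_tau t : 0 <= t < tau -> `|t| < t1.
Proof.
by move/andP => [t0 tt]; rewrite ger0_norm// (lt_trans tt)//; case/andP: tau01.
Qed.

Let archi (a e : R) : 0 < e -> exists n0, forall n, (n0 <= n)%N -> a <= n%:R * e.
Proof.
move=> e0'; exists (Num.truncn (`|a| / e)).+1 => n n0n.
have h : `|a| / e < n%:R.
  by rewrite (lt_le_trans (truncnS_gt _))// ler_nat.
by rewrite (le_trans (ler_norm a))// -ler_pdivrMr// ltW.
Qed.

Let tail_upper e delta : 0 < e < e0 -> 0 < delta -> exists n0, forall n, (n0 <= n)%N ->
  p n (n%:R * e) <= expR (n%:R * (- c e + delta)).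
Proof.
move=> ee d0; have [t [/andP[t0 tt] ce _]] := c_max ee.
have [k1 [k2 [n0 [k10 Hn0]]]] := Z_growth (small_tau (introT andP (conj t0 tt))).
have [n1 Hn1] := archi (ln (`|k2| + 1)) d0.
exists (maxn n0 n1) => n; rewrite geq_max => /andP[n0n n1n].
have /andP[_ Zle] := Hn0 n n0n; have ch := chernoff n (n%:R * e) t0.
have k2p : 0 < `|k2| + 1 by rewrite ltr_wpDl.
rewrite -(@ler_pM2l _ (expR (t * (n%:R * e)))) ?expR_gt0//.
apply: (le_trans ch); apply: (le_trans Zle).
rewrite -expRD (_ : _ + _ = n%:R * L t + n%:R * delta); last by rewrite ce; ring.
rewrite expRD mulrC ler_wpM2l ?expR_ge0//.
apply: (@le_trans _ _ (`|k2| + 1)); first by rewrite (le_trans (ler_norm _))// lerDl.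
by rewrite -{1}(lnK (_ : `|k2| + 1 \is Num.pos))// ler_expR; exact: Hn1.
Qed.

(** The tilt is the maximizer t for e + r, and the window from n e to n (e + 2 r) is centred at n (e
    + r). Shifting t by u in either direction changes L by u (e + r) up to C u^2, while the window
    edge contributes u (e + 2 r) or u e; both tails thus lose u r - C u^2 per unit of time. *)
Let tail_lower e delta : 0 < e < e0 -> 0 < delta -> exists n0, forall n, (n0 <= n)%N ->
  expR (n%:R * (- c e - delta)) <= p n (n%:R * e).
Proof.
move=> /andP[e_gt0 ee] d0.
have tau0 : 0 < tau by case/andP: tau01.
(* The first bound keeps e + r below e0; the second makes t r and c (e + r) - c e at most delta/4
   each, leaving room for the constant [k1]. *)
pose r := Num.min ((e0 - e) / 2) (delta / (4 * tau)).
have r0 : 0 < r.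
  by rewrite lt_min divr_gt0 ?subr_gt0//= divr_gt0// mulr_gt0.
have r1 : r <= (e0 - e) / 2 by rewrite ge_min lexx.
have r2 : r * (4 * tau) <= delta.
  by rewrite -ler_pdivlMr ?mulr_gt0// ge_min lexx orbT.
have er : 0 < e + r < e0 by apply/andP; split; lra.
have [t [t0tt ce sc]] := c_max er; have /andP[t0 tt] := t0tt.
(* This gives C u^2 <= u r / 2, so that both tails are smaller than the main term by exp (- n u r /
   2), and keeps t + u and t - u inside the interval where growth is known. *)
pose u := Num.min (r / (2 * (C + 1))) (t1 - tau) / 2.
have C1 : 0 < C + 1 by rewrite ltr_wpDl.
have u0 : 0 < u.
  rewrite /u divr_gt0// lt_min divr_gt0 ?mulr_gt0//= subr_gt0.
  by case/andP: tau01.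
have u1 : 2 * u <= t1 - tau by rewrite /u mulrC divfK// ge_min lexx orbT.
have u2 : 2 * u * (2 * (C + 1)) <= r.
  by rewrite -ler_pdivlMr ?mulr_gt0// /u mulrC divfK// ge_min lexx.
have Cu : C * u ^+ 2 <= u * r / 2.
  have : u * (2 * u * (2 * (C + 1))) <= u * r by rewrite ler_wpM2l// ltW.
  by have := sqr_ge0 u; have := mulr_ge0 C_ge0 (sqr_ge0 u); lra.
have tp : `|t + u| < t1.
  by rewrite (le_lt_trans (ler_normD _ _))// !ger0_norm ?(ltW u0)//; lra.
have tm : `|t - u| < t1.
  by rewrite (le_lt_trans (ler_normB _ _))// !ger0_norm ?(ltW u0)//; lra.
have [k1 [k1' [n1 [k10 H1]]]] := Z_growth (small_tau t0tt).
have [k2' [k2 [n2 [_ H2]]]] := Z_growth tp.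
have [k3' [k3 [n3 [_ H3]]]] := Z_growth tm.
have scp := sc _ tp; have scm := sc _ tm.
rewrite (_ : t + u - t = u) in scp; last by ring.
rewrite (_ : t - u - t = - u) in scm; last by ring.
rewrite sqrrN in scm.
pose k := `|k2| + `|k3| + 1.
have kp : 0 < k by rewrite /k ltr_wpDl.
have ur0 : 0 < u * r / 2 by rewrite divr_gt0// mulr_gt0.
have [n4 H4] := archi (ln (2 * k / k1)) ur0.
have d4 : 0 < delta / 4 by rewrite divr_gt0.
have [n5 H5] := archi (ln (2 / k1)) d4.
exists (maxn (maxn n1 n2) (maxn n3 (maxn n4 n5))) => n.
rewrite !geq_max => /andP[/andP[n1n n2n] /andP[n3n /andP[n4n n5n]]].
have /andP[Z1 _] := H1 n n1n; have /andP[_ Z2] := H2 n n2n; have /andP[_ Z3] := H3 n n3n.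
set a := n%:R * e; pose b := n%:R * (e + 2 * r).
have low := tilted_lower n a b t0 (ltW u0).
set W := expR (n%:R * L t) in Z1.
set q := expR (- (n%:R * (u * r / 2))).
have W0 : 0 <= W by exact: expR_ge0.
have q0 : 0 <= q by exact: expR_ge0.
have bound2 : expR (- (u * b)) * Z n (t + u) <= `|k2| * (W * q).
  apply: (@le_trans _ _ (expR (- (u * b)) * (`|k2| * expR (n%:R * L (t + u))))).
    rewrite ler_wpM2l ?expR_ge0// (le_trans Z2)// ler_wpM2r ?expR_ge0//.
    exact: ler_norm.
  rewrite mulrCA ler_wpM2l// -!expRD ler_expR /b.
  rewrite [leLHS](_ : _ = n%:R * (L (t + u) - u * (e + 2 * r))); last by ring.
  by rewrite -mulrBr ler_wpM2l//;
    clear low Z1 Z2 Z3 W0 q0 d4 ur0 kp scm tp tm u1 u2 r1 r2; lra.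
have bound3 : expR (u * a) * Z n (t - u) <= `|k3| * (W * q).
  apply: (@le_trans _ _ (expR (u * a) * (`|k3| * expR (n%:R * L (t - u))))).
    rewrite ler_wpM2l ?expR_ge0// (le_trans Z3)// ler_wpM2r ?expR_ge0//.
    exact: ler_norm.
  rewrite mulrCA ler_wpM2l// -!expRD ler_expR /a.
  rewrite [leLHS](_ : _ = n%:R * (L (t - u) + u * e)); last by ring.
  by rewrite -mulrBr ler_wpM2l//;
    clear low Z1 Z2 Z3 W0 q0 d4 ur0 kp scp tp tm u1 u2 r1 r2 bound2; lra.
have kq : k * q <= k1 / 2.
  have : 2 * k / k1 <= expR (n%:R * (u * r / 2)).
    rewrite -[leLHS]lnK ?posrE; last by rewrite divr_gt0// mulr_gt0.
    by rewrite ler_expR; exact: H4.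
  rewrite ler_pdivrMr// /q expRN => h.
  by rewrite ler_pdivrMr ?expR_gt0//;
    clear low Z1 Z2 Z3 W0 q0 d4 ur0 kp scp scm tp tm u1 u2 r1 r2 bound2 bound3 Cu; lra.
have main : k1 / 2 * W <= expR (t * b) * p n a.
  have k23 : `|k2| * (W * q) + `|k3| * (W * q) <= W * (k1 / 2).
    rewrite -mulrDl mulrCA ler_wpM2l// (le_trans _ kq)// ler_wpM2r//.
    by rewrite /k lerDl.
  by clear Z2 Z3 W0 q0 d4 ur0 kp scp scm tp tm u1 u2 r1 r2 kq Cu; lra.
rewrite -(@ler_pM2l _ (expR (t * b))) ?expR_gt0//.
apply: (le_trans _ main).
have k1p : 2 / k1 <= expR (n%:R * (delta / 4)).
  rewrite -[leLHS]lnK ?posrE; last by rewrite divr_gt0.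
  by rewrite ler_expR; exact: H5.
have cer : c (e + r) - c e <= tau * r.
  rewrite (le_trans (ler_norm _))// (le_trans (c_lip _ _))//.
  by rewrite addrAC subrr add0r gtr0_norm.
have tr : t * r <= tau * r by rewrite ler_wpM2r// ltW.
rewrite -expRD.
apply: (@le_trans _ _ (expR (n%:R * L t - n%:R * (delta / 4)))).
  rewrite ler_expR /b.
  rewrite [leLHS](_ : _ = n%:R * (t * (e + 2 * r) - c e - delta)); last by ring.
  by rewrite -mulrBr ler_wpM2l//;
    clear low Z1 Z2 Z3 W0 q0 d4 ur0 kp scp scm tp tm u1 u2 kq Cu main bound2 bound3; lra.
rewrite expRD expRN mulrC ler_wpM2r//.
rewrite -[k1 / 2]invrK lef_pV2 ?posrE ?invr_gt0 ?divr_gt0 ?expR_gt0//.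
by rewrite invf_div.
Qed.

Lemma large_deviation_limit e : 0 < e < e0 ->
  ((n%:R^-1)%:E * lne (nu [set x | (n%:R * e < S n x)%R]))%E
    @[n --> \oo] --> (- c e)%:E.
Proof.
move=> ee.
have finp n : nu (tail n (n%:R * e)) = (p n (n%:R * e))%:E.
  by rewrite /p fineK// fin_num_measure//; exact: tail_measurable.
apply/fine_cvgP; split.
  (* Any exponential lower bound shows that the tail has positive measure for large n, so that [lne]
     is finite. *)
  have [n0 Hn0] := tail_lower ee ltr01.
  exists n0 => // n n0n /=; rewrite -/(tail n _) finp.
  have p0 : 0 < p n (n%:R * e) by rewrite (lt_le_trans _ (Hn0 n n0n))// expR_gt0.
  by rewrite lne_EFin// -EFinM.
apply/cvgrPdist_le => delta d0.
have [n1 H1] := tail_lower ee d0; have [n2 H2] := tail_upper ee d0.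
exists (maxn 1 (maxn n1 n2)) => // n /=; rewrite !geq_max => /andP[n0 /andP[n1n n2n]].
have l1 := H1 n n1n; have l2 := H2 n n2n; rewrite -/(tail n _) finp.
have p0 : 0 < p n (n%:R * e) by rewrite (lt_le_trans _ l1)// expR_gt0.
have nR : 0 < n%:R :> R by rewrite ltr0n.
rewrite lne_EFin// -EFinM/=.
rewrite -ler_ln ?posrE ?expR_gt0// expRK in l1.
rewrite -ler_ln ?posrE ?expR_gt0// expRK in l2.
set y := n%:R^-1 * _.
have yE : ln (p n (n%:R * e)) = n%:R * y by rewrite /y mulrA divff ?mul1r ?gt_eqF.
rewrite yE ler_pM2l// in l1; rewrite yE ler_pM2l// in l2.
by rewrite ler_norml; apply/andP; split; lra.
Qed.

End LargeDeviations.

(** * Pairing of the function space with bounded functions *)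

Section FunctionSpacePairing.
Context {d : measure_display} {X : measurableType d} {R : realType}.
Variables (m : probability X R) (B : completeNormedModType R[i]).
Variable iota : B -> X -> R[i].
Hypothesis B_L1 : L1_subspace m iota.
Implicit Types (f g : B) (G : X -> R).

Let re f := fun x => complex.Re (iota f x).
Let im f := fun x => complex.Im (iota f x).

Let re_int f : m.-integrable setT (EFin \o re f).
Proof. by case: B_L1 => /(_ f)[]. Qed.
Let im_int f : m.-integrable setT (EFin \o im f).
Proof. by case: B_L1 => /(_ f)[]. Qed.

Lemma iota_linear (a : R[i]) f g :
  ae_eq m setT (iota (a *: f + g)) (fun x => a * iota f x + iota g x).
Proof. by case: B_L1. Qed.

Lemma iota0 : ae_eq m setT (iota 0) (cst 0).
Proof.
apply: filterS (iota_linear 1 0 0) => x /= /(_ I).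
rewrite scaler0 addr0 mul1r => /eqP.
by rewrite -subr_eq subrr eq_sym => /eqP.
Qed.

Lemma iota_inj f g : ae_eq m setT (iota f) (iota g) -> f = g.
Proof.
case: B_L1 => _ _ inj fg; apply/eqP; rewrite -subr_eq0; apply/eqP/inj.
have lin := iota_linear (-1) g f; rewrite scaleN1r addrC in lin.
apply: filterS2 fg lin => x /= /(_ I) fg /(_ I) -> _.
by rewrite fg mulN1r addNr.
Qed.

(** Unlike [iota], this pairing is exactly linear in [f], and it determines [f] ([cpair_separates]),
    so it replaces pointwise computation in the space. *)
Definition cpair G f : R[i] := pairing m G (re f) +i* pairing m G (im f).

Lemma cpair_linear G a f g : bounded_measurable G ->
  cpair G (a *: f + g) = a * cpair G f + cpair G g.
Proof.
move=> bG; have lin := iota_linear a f g; case: a lin => a1 a2 lin.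
have iZ (r : R) w : m.-integrable setT (EFin \o w) ->
    m.-integrable setT (EFin \o (fun x => r * w x)).
  exact: bm_integrable (bm_cst r).
have iD w w' : m.-integrable setT (EFin \o w) -> m.-integrable setT (EFin \o w') ->
    m.-integrable setT (EFin \o (fun x => w x + w' x)).
  by move=> iw iw'; have := integrableD measurableT iw iw'; apply: eq_integrable.
have rr := iZ a1 _ (re_int f); have ir := iZ a2 _ (im_int f).
have ii := iZ a1 _ (im_int f); have ri := iZ a2 _ (re_int f).
have nir := iZ (- a2) _ (im_int f).
rewrite /cpair.
have -> : pairing m G (re ((a1 +i* a2) *: f + g))
    = a1 * pairing m G (re f) - a2 * pairing m G (im f) + pairing m G (re g).
  rewrite -mulNr -!pairingZr// -!pairingDr//; last exact: iD.
  apply: pairing_ae => //; first by do 2 apply: (iD) => //.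
  apply: filterS lin => x /= /(_ I); rewrite /re /im => -> _.
  by case: (iota f x) (iota g x) => [u v] [u' v'] /=; rewrite mulNr.
have -> : pairing m G (im ((a1 +i* a2) *: f + g))
    = a1 * pairing m G (im f) + a2 * pairing m G (re f) + pairing m G (im g).
  rewrite -!pairingZr// -!pairingDr//; last exact: iD.
  apply: pairing_ae => //; first by do 2 apply: (iD) => //.
  apply: filterS lin => x /= /(_ I); rewrite /re /im => -> _.
  by case: (iota f x) (iota g x) => [u v] [u' v'] /=.
by [].
Qed.

Lemma cpairDl G H f : bounded_measurable G -> bounded_measurable H ->
  cpair (fun x => G x + H x) f = cpair G f + cpair H f.
Proof. by move=> bG bH; rewrite /cpair !pairingDl. Qed.

Lemma cpairZl (a : R) G f : bounded_measurable G ->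
  cpair (fun x => a * G x) f = a%:C * cpair G f.
Proof.
move=> bG; rewrite /cpair !pairingZl//.
by apply/eqP; rewrite eq_complex/= !mul0r subr0 addr0 !eqxx.
Qed.

Lemma cpair0 G : bounded_measurable G -> cpair G 0 = 0.
Proof.
move=> bG; have := cpair_linear 1 0 0 bG.
by rewrite scaler0 addr0 mul1r => /eqP; rewrite -subr_eq subrr eq_sym => /eqP.
Qed.

Lemma cpairZ G a f : bounded_measurable G -> cpair G (a *: f) = a * cpair G f.
Proof. by move=> bG; have := cpair_linear a f 0 bG; rewrite !addr0 cpair0// addr0. Qed.

Lemma cpairB G f g : bounded_measurable G -> cpair G (f - g) = cpair G f - cpair G g.
Proof.
move=> bG; have := cpair_linear (-1) g f bG.
by rewrite scaleN1r addrC => ->; rewrite mulN1r addrC.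
Qed.

Hypothesis B_incl : continuous_inclusion m iota.

Let cabs_measurable (w : X -> R[i]) :
  measurable_fun setT (fun x => complex.Re (w x)) ->
  measurable_fun setT (fun x => complex.Im (w x)) ->
  measurable_fun setT (fun x => cabs (w x)).
Proof.
move=> mr mi.
have -> : (fun x => cabs (w x))
    = (fun y => Num.sqrt y) \o (fun x => complex.Re (w x) ^+ 2 + complex.Im (w x) ^+ 2).
  by apply/funext => x /=; case: (w x).
apply: measurableT_comp; first exact: continuous_measurable_fun (@sqrt_continuous R).
by apply: measurable_funD; exact: measurable_funX.
Qed.

Let small_L1 : exists e : R, 0 < e /\ forall f, nrm f < e ->
  Rintegral m setT (fun x => `|re f x|) <= 1 /\
  Rintegral m setT (fun x => `|im f x|) <= 1.
Proof.
have /fine_cvgP[fin /cvgrPdist_lt /(_ _ ltr01) lt1] := B_incl 0.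
have [[e1 e2] /=] := (nbhs_ballP _ _).1 (filterI fin lt1).
rewrite ltcE/= => /andP[/eqP -> e10] Hb; exists e1; split=> // f fe.
have {Hb}[] := Hb f.
  by rewrite -ball_normE /ball_/= sub0r normrN -nrmE ltcR.
rewrite /= sub0r normrN => fN lt.
have key (w : X -> R) : m.-integrable setT (EFin \o w) ->
    (\forall x \ae m, `|w x| <= cabs (iota f x - iota 0 x)) ->
    Rintegral m setT (fun x => `|w x|) <= 1.
  move=> iw wle; apply: le_trans (ltW (le_lt_trans (ler_norm _) lt)).
  have le : (\int[m]_x (`|w x|%R)%:E <= L1normC m (fun x => (iota f x - iota 0 x)%R))%E.
    apply: ae_ge0_le_integral => //.
    - by have /integrableP[mw _] := integrable_abse iw; exact: mw.
    - by move=> x _; rewrite lee_fin; exact: cabs_ge0.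
    - apply/measurable_EFinP; apply: cabs_measurable.
      + have -> : (fun x => complex.Re (iota f x - iota 0 x)) = (fun x => re f x - re 0 x).
          by apply/funext => x; rewrite ReB.
        by apply: measurable_funB; apply/measurable_EFinP;
          [have /integrableP[] := re_int f|have /integrableP[] := re_int 0].
      + have -> : (fun x => complex.Im (iota f x - iota 0 x)) = (fun x => im f x - im 0 x).
          by apply/funext => x; rewrite /im; case: (iota f x) (iota 0 x) => [? ?] [? ?].
        by apply: measurable_funB; apply/measurable_EFinP;
          [have /integrableP[] := im_int f|have /integrableP[] := im_int 0].
    - by apply: filterS wle => x /= h _; rewrite lee_fin.
  rewrite /Rintegral fine_le//.
  by rewrite ge0_fin_numE ?integral_ge0// (le_lt_trans le)// ltey_eq fN.
split; apply: key => //.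
- apply: filterS iota0 => x /= /(_ I) ->; rewrite subr0; exact: Re_le_cabs.
- apply: filterS iota0 => x /= /(_ I) ->; rewrite subr0; exact: Im_le_cabs.
Qed.

Lemma cpair_bounded : exists c, 0 <= c /\ forall G M f, bounded_measurable G ->
  (forall x, `|G x| <= M) -> cabs (cpair G f) <= c * M * nrm f.
Proof.
have [e [e0 He]] := small_L1.
exists (4 / e); split; first by rewrite divr_ge0// ltW.
move=> G M f bG GM.
have [f0|f0] := eqVneq (nrm f) 0.
  by rewrite (nrm0_eq0 f0) cpair0// cabs0 nrm0 mulr0.
have fp : 0 < nrm f by rewrite lt_def f0 nrm_ge0.
(* Rescales [f] to norm e/2; real and imaginary parts then contribute M each, and scaling back
   produces 4/e. *)
pose r := e / (2 * nrm f).
have r0 : 0 < r by rewrite divr_gt0// mulr_gt0.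
pose g := r%:C *: f.
have ge : nrm g < e.
  rewrite /g nrmZ cabsR gtr0_norm// /r invfM -mulrA divfK//.
  by rewrite gtr_pMr// invf_lt1// ltr1n.
have [hr hi] := He g ge.
have M0 : 0 <= M by apply: le_trans (GM point).
have small : cabs (cpair G g) <= M + M.
  apply: (le_trans (cabs_le_ReIm _)); apply: lerD.
    apply: (le_trans (pairing_le bG GM (re_int g))); exact: ler_piMr.
  apply: (le_trans (pairing_le bG GM (im_int g))); exact: ler_piMr.
have e1 : cabs (cpair G g) = r * cabs (cpair G f).
  by rewrite /g cpairZ// cabsM cabsR gtr0_norm.
rewrite e1 in small; move: (cabs (cpair G f)) small => y small.
have : y <= r^-1 * (M + M) by rewrite ler_pdivlMl.
move=> /le_trans; apply; rewrite /r invf_div -mulr2n -[M *+ 2]mulr_natl.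
rewrite [leLHS](_ : _ = 4 / e * M * nrm f)//.
by ring.
Qed.

Lemma cpair_separates f : (forall A, measurable A -> cpair \1_A f = 0) -> f = 0.
Proof.
move=> H; have key w : m.-integrable setT (EFin \o w) ->
    (forall A, measurable A -> pairing m \1_A w = 0) -> ae_eq m setT w (cst 0).
  move=> iw Hw.
  have : ae_eq m setT (EFin \o w) (EFin \o cst 0).
    have m0 : measurable_fun setT (EFin \o cst 0 : X -> \bar R).
      by apply/measurable_EFinP; exact: measurable_cst.
    apply: (integral_ae_eq measurableT iw m0) => A _ mA.
    have := Hw A mA; rewrite pairing_indic// /Rintegral => e.
    rewrite -[LHS]fineK.
      by rewrite e integral0.
    apply: integrable_fin_num => //; exact: integrableS iw.
  by apply: filterS => x /= h _; have [->] := h I.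
have hr : ae_eq m setT (re f) (cst 0).
  by apply: key => // A mA; have := H A mA; rewrite /cpair => -[].
have hi : ae_eq m setT (im f) (cst 0).
  by apply: key => // A mA; have := H A mA; rewrite /cpair => -[].
apply: iota_inj; apply: filterS3 hr hi iota0 => x /= /(_ I) h1 /(_ I) h2 /(_ I) h3 _.
rewrite h3; apply/eqP; rewrite eq_complex; apply/andP; split; apply/eqP.
  exact: h1.
exact: h2.
Qed.

(** * Duality between P and composition with T *)

Section Transfer.
Variables (T : X -> X) (P : (X -> R[i]) -> X -> R[i]) (PB : B -> B).
Hypothesis T_meas : measurable_fun setT T.
Hypothesis P_PF : perron_frobenius m T P.
Hypothesis PB_restr : restriction_of m iota P PB.

(** [perron_frobenius] speaks of sets only; [bounded_measurable_ind] extends the duality to bounded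
    functions. *)
Let pairing_transfer (w w' : X -> R) : m.-integrable setT (EFin \o w) ->
  m.-integrable setT (EFin \o w') ->
  (forall A, measurable A -> Rintegral m A w' = Rintegral m (T @^-1` A) w) ->
  forall G, bounded_measurable G -> pairing m G w' = pairing m (G \o T) w.
Proof.
move=> iw iw' Hw.
pose Delta G := pairing m G w' - pairing m (G \o T) w.
suff D0 G : bounded_measurable G -> Delta G = 0.
  by move=> G bG; apply/eqP; rewrite -subr_eq0; apply/eqP/D0.
move: G; have bT G : bounded_measurable G -> bounded_measurable (G \o T) by exact: bm_comp.
apply: (@bounded_measurable_ind _ _ _ Delta
    (Rintegral m setT (fun x => `|w' x|) + Rintegral m setT (fun x => `|w x|))).
- move=> G H bG bH; rewrite /Delta pairingDl//.
  by rewrite (pairingDl (bT G bG) (bT H bH) iw); ring.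
- move=> a G bG; rewrite /Delta pairingZl// (pairingZl a (bT G bG) iw); ring.
- move=> G M bG GM; rewrite /Delta (le_trans (ler_normB _ _))// mulrDl.
  by apply: lerD; rewrite mulrC; apply: pairing_le => //; [exact: bT|move=> x; exact: GM].
- move=> A mA; rewrite /Delta pairing_indic// Hw//.
  have mTA : measurable (T @^-1` A).
    by rewrite -[X in measurable X]setTI; exact: T_meas.
  have -> : (\1_A : X -> R) \o T = \1_(T @^-1` A) by [].
  by rewrite -(pairing_indic m w mTA) subrr.
Qed.

Lemma cpair_transfer G f : bounded_measurable G ->
  cpair G (PB f) = cpair (G \o T) f.
Proof.
move=> bG; have [[Pr Pi] PA] := P_PF (conj (re_int f) (im_int f)).
have ae_r : ae_eq m setT (re (PB f)) (fun x => complex.Re (P (iota f) x)).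
  by apply: filterS (PB_restr f) => x /= h _; rewrite /re h.
have ae_i : ae_eq m setT (im (PB f)) (fun x => complex.Im (P (iota f) x)).
  by apply: filterS (PB_restr f) => x /= h _; rewrite /im h.
rewrite /cpair; congr (_ +i* _).
  apply: pairing_transfer => // A mA.
  rewrite -[LHS]pairing_indic// (pairing_ae (bm_indic mA) (re_int _) Pr ae_r).
  by rewrite pairing_indic//; have [] := PA A mA.
apply: pairing_transfer => // A mA.
rewrite -[LHS]pairing_indic// (pairing_ae (bm_indic mA) (im_int _) Pi ae_i).
by rewrite pairing_indic//; have [] := PA A mA.
Qed.

End Transfer.

Section Multiplication.
Variable phi : X -> R.
Hypothesis phi_bm : bounded_measurable phi.
Hypothesis B_alg : banach_algebra m iota.
Hypothesis phi_B : mem_space m iota (fun x => (phi x)%:C).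

(** [banach_algebra] asserts only that some product exists for each f; the choice of one is linear
    because [iota] is injective. *)
Lemma multiplication_operator : exists (A : B -> B) (a : R), 0 <= a /\
  [/\ forall x f g, A (x *: f + g) = x *: A f + A g,
      forall f, nrm (A f) <= a * nrm f &
      forall G f, bounded_measurable G ->
        cpair G (A f) = cpair (fun x => G x * phi x) f].
Proof.
have [p pE] := phi_B; have [C [C0 HC]] := B_alg.
have /choice[A HA] : forall f, exists g : B,
    ae_eq m setT (iota g) (fun x => (phi x)%:C * iota f x) /\
    nrm g <= C * nrm p * nrm f.
  move=> f; have [g [gE gle]] := HC p f; exists g; split.
    by apply: filterS2 pE gE => x /= /(_ I) h1 /(_ I) h2 _; rewrite h2 h1.
  by rewrite -lecR !rmorphM/= !nrmE.
exists A, (C * nrm p); split; first by rewrite mulr_ge0 ?nrm_ge0// ltW.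
split.
- move=> x f g; apply: iota_inj.
  have [h1 _] := HA (x *: f + g); have [h2 _] := HA f; have [h3 _] := HA g.
  have h4 := iota_linear x f g; have h5 := iota_linear x (A f) (A g).
  apply: filterS3 h1 h2 (filterI h3 (filterI h4 h5)).
  move=> y /= /(_ I) -> /(_ I) e2 [/(_ I) e3 [/(_ I) e4 /(_ I) e5]] _.
  by rewrite e5 e4 e2 e3; ring.
- by move=> f; have [] := HA f.
move=> G f bG; have [h _] := HA f.
have mul_int w : m.-integrable setT (EFin \o w) ->
    m.-integrable setT (EFin \o (fun x => phi x * w x)).
  exact: bm_integrable.
rewrite /cpair; congr (_ +i* _).
  rewrite (@pairing_ae _ _ _ _ G _ (fun x => phi x * re f x))//; last first.
  - apply: filterS h => x /= /(_ I) h _; rewrite /re h; exact: ReM_real.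
  - exact: mul_int.
  by apply: eq_Rintegral => x _; rewrite mulrA.
rewrite (@pairing_ae _ _ _ _ G _ (fun x => phi x * im f x))//; last first.
- apply: filterS h => x /= /(_ I) h _; rewrite /im h.
  by case: (iota f x) => u v /=; rewrite mul0r addr0.
- exact: mul_int.
by apply: eq_Rintegral => x _; rewrite mulrA.
Qed.

End Multiplication.

Lemma cpair_density (nu : probability X R) : density_in_space m iota nu ->
  exists g, forall G, bounded_measurable G -> cpair G g = (Rintegral nu setT G)%:C.
Proof.
move=> [num [g gE]]; exists g => G bG.
have hr : ae_eq m setT (re g)
    (fun x => fine (Radon_Nikodym (charge_of_finite_measure nu) m x)).
  by apply: filterS gE => x /= h _; rewrite /re h.
have hi : ae_eq m setT (im g) (fun x => 0 * re g x).
  by apply: filterS gE => x /= h _; rewrite /im h// mul0r.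
have i0 : m.-integrable setT (EFin \o (fun x => 0 * re g x)).
  exact: bm_integrable (bm_cst (0 : R)) (re_int g).
rewrite /cpair (pairing_density num (re_int g) hr)// (pairing_ae bG (im_int g) i0 hi).
by rewrite pairingZr// mul0r.
Qed.

End FunctionSpacePairing.

(** A nonzero vector in the range of [Pi i] is an eigenvector for [lam i], which has modulus 1 and
    so equals 1; by simplicity the vector is a multiple of h0. Hence the peripheral part of P has
    values in the line of h0. *)
Lemma peripheral_decomposition (R : realType) (B : normedModType R[i])
    (P : {linear B -> B}) :
  quasi_compact_diagonal P -> simple_eigenvalue P 1 ->
  (forall l, eigenvalue_of P l -> `|l| = 1 -> l = 1) ->
  exists (Q : {linear B -> B}) (h0 : B), continuous Q /\
    [/\ (spectral_radius Q < 1)%E,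
        forall f, exists a, P f = a *: h0 + Q f,
        forall f, P (Q f) = Q (Q f) &
        forall f, P f = f -> exists a, f = a *: h0].
Proof.
move=> [s [lam [Pi [Q [PE lam1 [Pi1 Pij] [Qc Qr] QPi]]]]] [h0 [h00 Ph0 simple]] only1.
have fixed f : P f = f -> exists a, f = a *: h0.
  by move=> Pf; apply: (simple 1%N); rewrite /= Pf scale1r subrr.
have PPi i f : P (Pi i f) = lam i *: Pi i f.
  rewrite PE (QPi i f).1 addr0 (bigD1 i)//= big1 ?addr0.
    by have [_ _ ->] := Pi1 i.
  by move=> j ji; rewrite Pij// scaler0.
have lamPi i f : lam i *: Pi i f = Pi i f.
  have [->|Pif0] := eqVneq (Pi i f) 0; first by rewrite scaler0.
  rewrite (_ : lam i = 1) ?scale1r//; apply: only1; last exact: lam1.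
  by exists (Pi i f).
exists Q, h0; split=> //; split=> // f.
  have /choice[a Ha] : forall i, exists a, Pi i f = a *: h0.
    by move=> i; apply: fixed; rewrite PPi lamPi.
  exists (\sum_i a i); rewrite PE scaler_suml; congr (_ + _).
  by apply: eq_bigr => i _; rewrite lamPi Ha.
rewrite PE big1 ?add0r// => i _.
by rewrite (QPi i f).2 scaler0.
Qed.

Section MeanZeroContraction.
Variables (R : realType) (B : completeNormedModType R[i]) (P Q : {linear B -> B}).
Variables (h0 h : B) (l : B -> R[i]) (c : R).
Hypothesis l_linear : forall a f g, l (a *: f + g) = a * l f + l g.
Hypothesis l_bounded : forall f, cabs (l f) <= c * nrm f.
Hypothesis l_P : forall f, l (P f) = l f.
Hypothesis l_h : l h = 1.
Hypothesis P_h : P h = h.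
Hypothesis P_dec : forall f, exists a, P f = a *: h0 + Q f.
Hypothesis PQ : forall f, P (Q f) = Q (Q f).
Hypothesis P_fixed : forall f, P f = f -> exists a, f = a *: h0.
Variable n : nat.
Hypothesis Q_contract : forall f, nrm (iter n Q f) <= 1 / 2 * nrm f.

(** As [l] is P-invariant and P Q = Q^2, l (Q f) equals l (Q^(k n) (Q f)) for every k, and the
    latter tends to 0. *)
Lemma decaying_part_mean0 f : l (Q f) = 0.
Proof.
have lQ k g : l (iter k Q (Q g)) = l (Q g).
  by elim: k g => //= k IH g; rewrite -iterS iterSr IH -PQ l_P.
have decay k g : nrm (iter (k * n) Q g) <= (1 / 2) ^+ k * nrm g.
  elim: k => [|k IH]; first by rewrite mul0n expr0 mul1r.
  rewrite mulSn iterD (le_trans (Q_contract _))// exprS -[leRHS]mulrA.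
  exact: ler_wpM2l.
have c0 : 0 <= `|c| by [].
apply/eqP; rewrite -cabs_eq0 eq_le cabs_ge0 andbT.
apply: (@geometric_le _ _ _ (`|c| * nrm (Q f)) (1 / 2)) => [|k].
  by apply/andP; split; lra.
rewrite add0r -(lQ (k * n)%N) (le_trans (l_bounded _))//.
apply: (@le_trans _ _ (`|c| * nrm (iter (k * n) Q (Q f)))).
  by rewrite ler_wpM2r ?nrm_ge0// ler_norm.
by rewrite -mulrA ler_wpM2l// mulrC decay.
Qed.

(** Applying [l] to P f = a h0 + Q f gives a l(h0) = 0, and l(h0) is nonzero because h, with l h =
    1, is a multiple of h0. *)
Lemma mean0_transfer f : l f = 0 -> P f = Q f.
Proof.
move=> lf; have [b hb] := P_fixed P_h.
have lZ a g : l (a *: g) = a * l g.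
  have l0 : l 0 = 0.
    have := l_linear 1 0 0; rewrite scaler0 addr0 mul1r => /eqP.
    by rewrite -subr_eq subrr eq_sym => /eqP.
  by have := l_linear a g 0; rewrite !addr0 l0 addr0.
have lh0 : l h0 != 0.
  by apply/eqP => lh0; move: l_h; rewrite hb lZ lh0 mulr0 => /eqP; rewrite eq_sym oner_eq0.
have [a Pf] := P_dec f; have := l_P f.
rewrite Pf l_linear decaying_part_mean0 addr0 lf => /eqP.
by rewrite mulf_eq0 (negbTE lh0) orbF => /eqP ->; rewrite scale0r add0r.
Qed.

End MeanZeroContraction.

Lemma exp_partial_error (R : realType) (x b : R) n : `|x| <= b ->
  `|expR x - \sum_(k < n) x ^+ k / k`!%:R| <= 2 * expR (2 * b) * (1 / 2) ^+ n.
Proof.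
move=> xb; have b0 : 0 <= b by apply: le_trans xb.
pose v n := \sum_(k < n) x ^+ k / k`!%:R.
have vS k : `|v k.+1 - v k| <= expR (2 * b) * (1 / 2) ^+ k.
  rewrite /v big_ord_recr/= addrAC subrr add0r normrM normrX.
  rewrite (ger0_norm (_ : 0 <= k`!%:R^-1)) ?invr_ge0//.
  have h := exp_term_le k (_ : 0 <= 2 * b).
  apply: (@le_trans _ _ (b ^+ k / k`!%:R)).
    by rewrite ler_wpM2r ?invr_ge0// lerXn2r ?nnegrE.
  have -> : b ^+ k / k`!%:R = ((2 * b) ^+ k / k`!%:R) * (1 / 2) ^+ k.
    by rewrite mulrAC -exprMn (_ : 2 * b * (1 / 2) = b)//; field.
  by rewrite ler_wpM2r ?exprn_ge0// h// mulr_ge0.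
have half01 : 0 <= (1 / 2 : R) < 1 by apply/andP; split; lra.
have tel := telescope_geometric (normr0 _) (@ler_normD _ _) half01 (expR_ge0 _) vS.
have vlim : v @ \oo --> expR x.
  have -> : v = series (exp_coeff x).
    by apply/funext => k; rewrite /v /series/= big_mkord.
  exact: is_cvg_series_exp_coeff.
apply/ler_addgt0Pr => e e0.
have /cvgrPdist_lt /(_ e e0) [k0 _ Hk0] := vlim.
have := Hk0 (n + k0)%N (leq_addl _ _) => /= h1.
rewrite -/(v n) -(subrKA (v (n + k0)%N)) addrC.
rewrite (le_trans (ler_normD _ _))// lerD ?(ltW h1)//.
by rewrite (le_trans (tel n k0))// le_eqVlt; apply/orP; left; apply/eqP; field.
Qed.

(** * The transfer operator *)

Section BirkhoffSums.
Context {d : measure_display} {X : measurableType d} {R : realType}.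
Variables (T : X -> X) (phi : X -> R).
Hypothesis T_meas : measurable_fun setT T.
Hypothesis phi_bm : bounded_measurable phi.

Let S := birkhoff_sum T phi.

Lemma birkhoff0 x : S 0 x = 0.
Proof. by rewrite /S /birkhoff_sum big_geq. Qed.

Lemma birkhoffS n x : S n.+1 x = phi x + S n (T x).
Proof.
rewrite /S /birkhoff_sum big_nat_recl//=; congr (_ + _).
by apply: eq_bigr => k _; rewrite -iterSr.
Qed.

Lemma birkhoffD k n x : S (k + n) x = S k x + S n (iter k T x).
Proof.
elim: k x => [|k IH] x; first by rewrite birkhoff0 add0r.
by rewrite addSn !birkhoffS IH addrA iterSr.
Qed.

Lemma iter_measurable k : measurable_fun setT (iter k T).
Proof.
elim: k => [|k IH]; first exact: measurable_id.
rewrite (_ : iter k.+1 T = T \o iter k T)//; exact: measurableT_comp.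
Qed.

Lemma birkhoff_bm n : bounded_measurable (S n).
Proof.
elim: n => [|n IH].
  have -> : S 0 = cst 0 by apply/funext => x; rewrite birkhoff0.
  exact: bm_cst.
have -> : S n.+1 = (fun x => phi x + (S n \o T) x).
  by apply/funext => x; rewrite birkhoffS.
by apply: bmD => //; exact: bm_comp.
Qed.

Lemma birkhoff_le M n x : (forall y, `|phi y| <= M) -> `|S n x| <= n%:R * M.
Proof.
move=> phiM; elim: n x => [|n IH] x; first by rewrite birkhoff0 normr0 mul0r.
rewrite birkhoffS (le_trans (ler_normD _ _))// -natr1 mulrDl mul1r addrC lerD//.
Qed.

End BirkhoffSums.

Section TransferOperator.
Context {d : measure_display} {X : measurableType d} {R : realType}.
Variables (m : probability X R) (T : X -> X).
Hypothesis T_meas : measurable_fun setT T.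
Variable P : (X -> R[i]) -> X -> R[i].
Hypothesis P_PF : perron_frobenius m T P.
Variables (B : completeNormedModType R[i]) (iota : B -> X -> R[i]).
Hypothesis B_L1 : L1_subspace m iota.
Hypothesis B_incl : continuous_inclusion m iota.
Hypothesis B_alg : banach_algebra m iota.
Variable PB : {linear B -> B}.
Hypothesis PB_restr : restriction_of m iota P PB.
Hypothesis PB_bounded : continuous PB.
Hypothesis PB_qc : quasi_compact_diagonal PB.
Hypothesis one_simple : simple_eigenvalue PB 1.
Hypothesis one_only : forall l : R[i], eigenvalue_of PB l -> `|l| = 1 -> l = 1.
Variable mu : probability X R.
Hypothesis mu_inv : invariant_measure mu T.
Hypothesis mu_dens : density_in_space m iota mu.
Variable phi : X -> R.
Hypothesis phi_bm : bounded_measurable phi.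
Hypothesis phi_B : mem_space m iota (fun x => (phi x)%:C).

Let E (nu : probability X R) (G : X -> R) := Rintegral nu setT G.
Let pair := cpair m iota.
Let l := pair (cst 1).
Let bm1 : bounded_measurable (cst (1 : R) : X -> R). Proof. exact: bm_cst. Qed.

Let pair_PB G f : bounded_measurable G -> pair G (PB f) = pair (G \o T) f.
Proof. exact: (cpair_transfer B_L1 T_meas P_PF PB_restr). Qed.

Let l_PB f : l (PB f) = l f.
Proof. by rewrite /l pair_PB. Qed.

(** Fixedness is tested on indicators, where duality turns it into mu (T^-1 A) = mu A. *)
Lemma invariant_density : exists h, PB h = h /\
  forall G, bounded_measurable G -> pair G h = (E mu G)%:C.
Proof.
have [h hE] := cpair_density B_L1 mu_dens; exists h; split=> //.
apply/eqP; rewrite -subr_eq0; apply/eqP.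
apply: (cpair_separates B_L1) => A mA; have bA := bm_indic (R := R) mA.
rewrite cpairB// -/pair pair_PB// /pair !hE//; last exact: bm_comp.
have mTA : measurable (T @^-1` A).
  by rewrite -[X in measurable X]setTI; exact: T_meas.
rewrite (Rintegral_indic _ mA).
rewrite (_ : (\1_A : X -> R) \o T = \1_(T @^-1` A))//.
by rewrite (Rintegral_indic _ mTA) mu_inv// subrr.
Qed.

Lemma invariant_expectation G : bounded_measurable G -> E mu (G \o T) = E mu G.
Proof.
move=> bG; have [h [PBh hE]] := invariant_density.
have := pair_PB h bG; rewrite PBh !hE//; last exact: bm_comp.
by move=> /complexI.
Qed.

(** On mean-zero elements PB coincides with the decaying part, and the adapted norm turns
    contraction of an iterate into contraction in one step, as the perturbation argument
    requires. *)
Lemma spectral_gap : exists (N : B -> R) (th K : R) (h : B),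
  0 <= th < 1 /\ 0 <= K /\
  [/\ [/\ forall f g, N (f + g) <= N f + N g,
         forall a f, N (a *: f) = cabs a * N f,
         forall f, nrm f <= N f &
         forall f, N f <= K * nrm f],
      forall (u : nat -> B) (C r : R), 0 <= r < 1 -> 0 <= C ->
        (forall n, N (u n.+1 - u n) <= C * r ^+ n) ->
        exists v, forall n, N (u n - v) <= C * r ^+ n / (1 - r),
      PB h = h,
      forall G, bounded_measurable G -> pair G h = (E mu G)%:C &
      forall f, l f = 0 -> N (PB f) <= th * N f].
Proof.
have [Q [h0 [Qc [Qr PBdec PQ PBfix]]]] := peripheral_decomposition PB_qc one_simple one_only.
have [n [n0 Qn]] := spectral_radius_lt1_contract Qc Qr.
have [q [q0 Qq]] := continuous_nrm_bounded Qc.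
have [N [th [K [th01 [K0 [ND NZ nN Nn NQ]]]]]] := adapted_norm q0 Qq n0 Qn.
have [h [PBh hE]] := invariant_density.
exists N, th, K, h; split=> //; split=> //; split=> //.
- have N0 : N 0 = 0 by rewrite -(scale0r 0) NZ cabs0 mul0r.
  have Nd f g : N (f - g) = N (g - f).
    by rewrite -opprB -scaleN1r NZ cabsN cabs1 mul1r.
  by move=> u C r; exact: (geometric_complete ND N0 Nd nN Nn).
have [c [c0 cb]] := cpair_bounded B_L1 B_incl.
move=> f lf; rewrite (@mean0_transfer R B PB Q h0 h l (c * 1) _ _ _ _ _ _ _ _ n)//.
- by move=> a u v; exact: cpair_linear.
- move=> u; apply: cb => // x; by rewrite normr1.
- rewrite /l hE// /E (_ : cst 1 = \1_setT) ?Rintegral_indic//.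
    by rewrite probability_setT.
  by apply/funext => x; rewrite indicE in_setT.
Qed.

(** By duality the correlation is the pairing of phi with P^k (phi h), and phi h is in the kernel of
    [l] because phi has mean 0 under mu. *)
Lemma correlation_decay : E mu phi = 0 -> exists C th, 0 <= C /\ 0 <= th < 1 /\
  forall k, `|E mu (fun x => phi x * phi (iter k T x))| <= C * th ^+ k.
Proof.
move=> phi0.
have [N [th [K [h [th01 [K0 [[ND NZ nN Nn] _ PBh hE gap]]]]]]] := spectral_gap.
have [A [a [a0 [AL Aa pairA]]]] := multiplication_operator B_L1 phi_bm B_alg phi_B.
have [c [c0 cb]] := cpair_bounded B_L1 B_incl.
have [_ [M phiM]] := phi_bm.
have M0 : 0 <= M by apply: le_trans (phiM point).
have lA : l (A h) = 0.
  rewrite /l /pair pairA// -/pair hE; last exact: (bmM bm1 phi_bm).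
  rewrite (_ : (fun x => cst 1 x * phi x) = phi) ?phi0//.
  by apply/funext => x; rewrite mul1r.
have decay k : l (iter k PB (A h)) = 0 /\ N (iter k PB (A h)) <= th ^+ k * N (A h).
  elim: k => [|k [IH1 IH2]]; first by rewrite mul1r.
  rewrite iterS l_PB; split=> //; rewrite (le_trans (gap _ IH1))// exprS -mulrA.
  by rewrite ler_wpM2l//; case/andP: th01.
have pair_iter k G f : bounded_measurable G ->
    pair G (iter k PB f) = pair (G \o iter k T) f.
  elim: k G => [//|k IH] G bG; rewrite iterS pair_PB// IH//.
  exact: bm_comp.
exists (c * M * N (A h)), th; split.
  by rewrite mulr_ge0 ?mulr_ge0// (le_trans (nrm_ge0 (A h))).
split=> // k.
have bk : bounded_measurable (phi \o iter k T).
  by apply: bm_comp => //; exact: iter_measurable.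
have := cb phi M (iter k PB (A h)) phi_bm phiM.
rewrite -/(pair phi _) pair_iter// /pair pairA// -/pair hE; last exact: bmM.
rewrite cabsR (_ : E mu _ = E mu (fun x => phi x * phi (iter k T x))); last first.
  by apply: eq_Rintegral => x _; rewrite mulrC.
move=> /le_trans; apply; rewrite -[leRHS]mulrA ler_wpM2l ?mulr_ge0//.
by rewrite (le_trans (nN _))// mulrC; have [] := decay k.
Qed.

Let S := birkhoff_sum T phi.

Let exp_bm t n : bounded_measurable (fun x => expR (t * S n x)).
Proof. exact: (bm_expR (bmZ t (birkhoff_bm T_meas phi_bm n))). Qed.

(** Identifies the abstract exponential with multiplication by e^(t phi): both are compared with
    their n-th partial sums, whose errors are O(2^-n). *)
Let pair_exp (N : B -> R) (A : B -> B) (M : R -> B -> B) K t :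
  (forall f, nrm f <= N f) ->
  (forall x f g, A (x *: f + g) = x *: A f + A g) ->
  (forall G f, bounded_measurable G ->
     pair G (A f) = pair (fun x => G x * phi x) f) ->
  (forall f n, N (exp_partial A t f n - M t f) <= K * N f * (1 / 2) ^+ n) ->
  forall G f, bounded_measurable G ->
    pair G (M t f) = pair (fun x => G x * expR (t * phi x)) f.
Proof.
move=> nN AL pairA HM G f bG.
have [c [c0 cb]] := cpair_bounded B_L1 B_incl.
have [_ [b phib]] := phi_bm; have [_ [M0 GM0]] := bG.
have b0 : 0 <= b by apply: le_trans (phib point).
have M00 : 0 <= M0 by apply: le_trans (GM0 point).
have pair_iterA k H : bounded_measurable H ->
    pair H (iter k A f) = pair (fun x => H x * phi x ^+ k) f /\
    bounded_measurable (fun x => H x * phi x ^+ k).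
  elim: k H => [|k IH] H bH.
    have -> : (fun x => H x * phi x ^+ 0) = H.
      by apply/funext => x; rewrite expr0 mulr1.
    by [].
  rewrite iterS pairA//; have [-> bk] := IH _ (bmM bH phi_bm).
  have -> : (fun x => H x * phi x * phi x ^+ k) = (fun x => H x * phi x ^+ k.+1).
    by apply/funext => x; rewrite exprS mulrA.
  split=> //.
  suff -> : (fun x => H x * phi x ^+ k.+1) = (fun x => H x * phi x * phi x ^+ k) by [].
  by apply/funext => x; rewrite exprS mulrA.
pose Ex n x := \sum_(k < n) (t * phi x) ^+ k / k`!%:R.
have ExS n : (fun x => G x * Ex n.+1 x)
    = (fun x => G x * Ex n x + (t ^+ n / n`!%:R) * (G x * phi x ^+ n)).
  by apply/funext => x; rewrite /Ex big_ord_recr/= mulrDr exprMn; congr (_ + _); ring.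
have pairE n : pair G (exp_partial A t f n) = pair (fun x => G x * Ex n x) f /\
    bounded_measurable (fun x => G x * Ex n x).
  elim: n => [|n [IH bn]].
    have -> : (fun x => G x * Ex 0 x) = (fun x => 0 * cst 1 x).
      by apply/funext => x; rewrite /Ex big_ord0 mulr0 mul0r.
    have b0' := bmZ 0 bm1.
    rewrite /exp_partial big_ord0 /pair cpair0// cpairZl// rmorph0 mul0r.
    by split.
  have [e1 b1] := pair_iterA n G bG.
  rewrite ExS; split; last by apply: bmD => //; exact: bmZ.
  rewrite /exp_partial big_ord_recr/= addrC /pair cpair_linear// -/pair e1.
  rewrite /pair cpairDl//; last exact: bmZ.
  by rewrite cpairZl// addrC -/pair -IH.
have bexp : bounded_measurable (fun x => G x * expR (t * phi x)).
  by apply: bmM => //; exact: (bm_expR (bmZ t phi_bm)).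
apply/eqP; rewrite -subr_eq0 -cabs_eq0 eq_le cabs_ge0 andbT.
pose C1 := c * M0 * (K * N f).
pose C2 := c * (M0 * (2 * expR (2 * (`|t| * b)))) * nrm f.
apply: (@geometric_le _ _ _ (C1 + C2) (1 / 2)) => [|n].
  by apply/andP; split; lra.
rewrite add0r -(subrKA (pair G (exp_partial A t f n))) (le_trans (cabsD _ _))//.
rewrite mulrDl; apply: lerD.
  rewrite cabs_distC /pair -cpairB// (le_trans (cb _ _ _ bG GM0))//.
  by rewrite /C1 -[leRHS]mulrA ler_wpM2l ?mulr_ge0// (le_trans (nN _)).
have [-> bn] := pairE n.
have bdiff := bmD bn (bmZ (-1) bexp).
have -> : pair (fun x => G x * Ex n x) f - pair (fun x => G x * expR (t * phi x)) f
    = pair (fun x => G x * Ex n x + (-1) * (G x * expR (t * phi x))) f.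
  rewrite /pair cpairDl//; last exact: bmZ.
  by rewrite cpairZl// rmorphN rmorph1 mulN1r.
have bound x : `|G x * Ex n x + (-1) * (G x * expR (t * phi x))|
    <= M0 * (2 * expR (2 * (`|t| * b))) * (1 / 2) ^+ n.
  rewrite mulN1r -mulrBr normrM -[leRHS]mulrA; apply: ler_pM => //.
  by rewrite distrC exp_partial_error// normrM ler_wpM2l.
apply: (le_trans (cb _ _ f bdiff bound)).
by rewrite /C2 le_eqVlt; apply/orP; left; apply/eqP; ring.
Qed.

Lemma exponential_moment_growth : exists (t1 C : R) (L G : R -> R),
  0 < t1 /\ 0 <= C /\
  [/\ forall t, `|t| < t1 -> `|G t| <= C,
      forall s t, `|s| < t1 -> `|t| < t1 ->
        L s <= L t + (s - t) * G t + C * (s - t) ^+ 2,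
      forall t n, `|t| < t1 ->
        E mu (fun x => expR (t * S n x)) <= expR (n%:R * L t) * (1 + C * t ^+ 2),
      forall t, `|t| < t1 -> forall n,
        expR (n%:R * L t) / 2 <= E mu (fun x => expR (t * S n x)) &
      forall nu, density_in_space m iota nu -> forall t, `|t| < t1 ->
        exists k1 k2 n0, 0 < k1 /\ forall n, (n0 <= n)%N ->
          k1 * expR (n%:R * L t) <= E nu (fun x => expR (t * S n x))
            <= k2 * expR (n%:R * L t)].
Proof.
have [N [th [K [h [th01 [K0 [[ND NZ nN Nn] Nc PBh hE gap]]]]]]] := spectral_gap.
have [A [a [a0 [AL Aa pairA]]]] := multiplication_operator B_L1 phi_bm B_alg phi_B.
have [c [c0 cb]] := cpair_bounded B_L1 B_incl.
have [p [p0 PBp]] := continuous_nrm_bounded PB_bounded.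
have N_eq0 f : N f = 0 -> f = 0.
  move=> f0; apply: nrm0_eq0; apply/eqP; rewrite eq_le nrm_ge0 andbT.
  by rewrite -f0.
have N_ge0 f : 0 <= N f by apply: le_trans (nrm_ge0 f) (nN f).
have NA f : N (A f) <= (K * a) * N f.
  rewrite (le_trans (Nn _))// -mulrA ler_wpM2l// (le_trans (Aa f))//.
  by rewrite ler_wpM2l.
have NPB f : N (PB f) <= (K * p) * N f.
  rewrite (le_trans (Nn _))// -mulrA ler_wpM2l// (le_trans (PBp f))//.
  by rewrite ler_wpM2l.
have Ka0 : 0 <= K * a by rewrite mulr_ge0.
have Kp0 : 0 <= K * p by rewrite mulr_ge0.
have [M [KM [KM0 [ML Mlim M0 Mlip Mdiff]]]] :=
  operator_exponential ND NZ N_eq0 Nc AL Ka0 NA.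
pose Pt t f := PB (M t f); pose Dt t f := PB (A (M t f)).
have AB f g : A (f - g) = A f - A g.
  by rewrite addrC -scaleN1r AL scaleN1r addrC.
have NM t f : `|t| <= 1 -> N (M t f) <= (KM + 1) * N f.
  move=> t1; rewrite -(subrK f (M t f)) (le_trans (ND _ _))// mulrDl mul1r lerD2r.
  rewrite -{2}(M0 f) (le_trans (Mlip _ _ _ t1 _)) ?normr0// subr0.
  by rewrite ler_wpM2r// ler_piMr.
pose KK := K * p * KM + K * p * (K * a * (KM + 1)).
have KK0 : 0 <= KK.
  by rewrite addr_ge0// mulr_ge0// mulr_ge0// addr_ge0.
have KKl : K * p * KM <= KK by rewrite lerDl mulr_ge0// mulr_ge0// addr_ge0.
have l_linear x f g : l (x *: f + g) = x * l f + l g by exact: cpair_linear.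
have l_bounded f : cabs (l f) <= c * N f.
  have := cb (cst 1) 1 f bm1; rewrite mulr1 => /(_ _)/le_trans; apply.
    by move=> x; rewrite normr1.
  by rewrite ler_wpM2l.
have lh : l h = 1.
  rewrite /l hE// /E (_ : cst 1 = \1_setT) ?Rintegral_indic//.
    by rewrite probability_setT.
  by apply/funext => x; rewrite indicE in_setT.
have Pt_linear t x f g : Pt t (x *: f + g) = x *: Pt t f + Pt t g.
  by rewrite /Pt ML linearP.
have Dt_linear t x f g : Dt t (x *: f + g) = x *: Dt t f + Dt t g.
  by rewrite /Dt ML AL linearP.
have Pt_lip s t f : `|s| <= 1 -> `|t| <= 1 ->
    N (Pt s f - Pt t f) <= KK * `|s - t| * N f.
  move=> s1 t1; rewrite /Pt -linearB (le_trans (NPB _))//.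
  rewrite (le_trans (ler_wpM2l Kp0 (Mlip s t f s1 t1)))// !mulrA.
  by rewrite ler_wpM2r// ler_wpM2r.
have Pt_diff s t f : `|s| <= 1 -> `|t| <= 1 ->
    N (Pt s f - Pt t f - (s - t)%:C *: Dt t f) <= KK * `|s - t| ^+ 2 * N f.
  move=> s1 t1; rewrite /Pt /Dt -linearZ -!linearB (le_trans (NPB _))//.
  rewrite (le_trans (ler_wpM2l Kp0 (Mdiff s t f s1 t1)))//.
  rewrite [leLHS](_ : _ = K * p * KM * `|s - t| ^+ 2 * N f); last by ring.
  by rewrite ler_wpM2r// ler_wpM2r ?exprn_ge0.
have Dt_bounded t f : `|t| <= 1 -> N (Dt t f) <= KK * N f.
  move=> t1; rewrite /Dt (le_trans (NPB _))//.
  rewrite (le_trans (ler_wpM2l Kp0 (NA _)))//.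
  rewrite (le_trans (ler_wpM2l Kp0 (ler_wpM2l Ka0 (NM t f t1))))// !mulrA.
  by rewrite ler_wpM2r// /KK !mulrA lerDr !mulr_ge0.
have P0h : Pt 0 h = h by rewrite /Pt M0.
have lP0 f : l (Pt 0 f) = l f by rewrite /Pt M0 l_PB.
have P0c f : l f = 0 -> N (Pt 0 f) <= th * N f by rewrite /Pt M0; exact: gap.
have [t2 [C [L [G [t20 [C0 [GC Lsc Lup Lb Llow]]]]]]] :=
  perturbed_growth ND NZ N_eq0 Nc l_linear l_bounded c0 Pt_linear Dt_linear KK0
    Pt_lip Pt_diff Dt_bounded th01 lh P0h lP0 P0c.
(* Each application of P_t composes with T and multiplies by e^(t phi), matching S_(n+1) = phi + S_n
   o T. *)
have lPt t n f : `|t| <= 1 -> l (iter n (Pt t) f) = pair (fun x => expR (t * S n x)) f.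
  move=> t1; have pM := pair_exp nN AL pairA (Mlim t ^~ t1).
  elim: n f => [|n IH] f.
    rewrite /= /l; congr (pair _ f); apply/funext => x.
    by rewrite /S birkhoff0 mulr0 expR0.
  rewrite iterSr IH /Pt pair_PB// pM; last exact: bm_comp.
  congr (pair _ f); apply/funext => x /=.
  by rewrite -expRD /S birkhoffS; congr expR; ring.
pose t1 := Num.min t2 1.
have t1P t : `|t| < t1 -> `|t| < t2 /\ `|t| <= 1.
  by rewrite lt_min => /andP[? /ltW].
have E_ge0 nu t n : 0 <= E nu (fun x => expR (t * S n x)).
  by apply: Rintegral_ge0 => x _; exact: expR_ge0.
have cE nu g t n : `|t| <= 1 ->
    (forall H, bounded_measurable H -> pair H g = (E nu H)%:C) ->
    E nu (fun x => expR (t * S n x)) = cabs (l (iter n (Pt t) g)).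
  by move=> tt gE; rewrite lPt// gE// cabsR ger0_norm.
exists t1, C, L, G; split; first by rewrite lt_min t20/=.
split=> //; split.
- by move=> t /t1P[t2t _]; exact: GC.
- by move=> s t /t1P[s2 _] /t1P[t2t _]; exact: Lsc.
- by move=> t n /t1P[t2t tt]; rewrite (cE mu h t n tt hE); exact: Lup.
- move=> t /t1P[t2t tt] n; rewrite (cE mu h t n tt hE); apply: Llow => //.
  by rewrite subrr -(scale0r 0) NZ cabs0 mul0r.
move=> nu nud t /t1P[t2t tt].
have [g gE] := cpair_density B_L1 nud; rewrite -/pair in gE.
have lg : l g = 1.
  rewrite /l gE// /E (_ : cst 1 = \1_setT) ?Rintegral_indic//.
    by rewrite probability_setT.
  by apply/funext => x; rewrite indicE in_setT.
have lk k : l (iter k PB g) = 1.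
  by elim: k => // k IH; rewrite iterS l_PB.
have Ng k : N (iter k PB g - h) <= th ^+ k * N (g - h).
  elim: k => [|k IH]; first by rewrite mul1r.
  rewrite iterS -{1}PBh -linearB (le_trans (gap _ _))//.
    by rewrite /l /pair cpairB// -/pair -/l lk lh subrr.
  by rewrite exprS -mulrA ler_wpM2l//; case/andP: th01.
(* The density g may be far from h, but some P^k g lies in the unit ball where [Llow] applies. This
   k depends on g and not on t, so the interval of t serves all nu. *)
have [k Hk] : exists k, N (iter k PB g - h) <= 1.
  have [k Hk] := geometric_small (N (g - h)) th01 ltr01.
  by exists k; rewrite (le_trans (Ng k))// mulrC ltW// Hk.
have [_ [b phib]] := phi_bm.
exists (expR (- (`|t| * (k%:R * b))) * (expR (- (k%:R * L t)) / 2)), (C * N g), k.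
split; first by rewrite mulr_gt0 ?expR_gt0// divr_gt0 ?expR_gt0.
move=> n kn; apply/andP; split; last first.
  by rewrite (cE nu g t n tt gE) mulrC; exact: Lb.
have pair_iter j H f : bounded_measurable H ->
    pair H (iter j PB f) = pair (H \o iter j T) f.
  elim: j H => [//|j IH] H bH; rewrite iterS pair_PB// IH//.
  exact: bm_comp.
have bSk : bounded_measurable ((fun x => expR (t * S (n - k) x)) \o iter k T).
  by apply: bm_comp => //; exact: iter_measurable.
have low := Llow t (n - k)%N _ t2t (lk k) Hk.
rewrite lPt// pair_iter// gE// cabsR ger0_norm in low; last first.
  by apply: Rintegral_ge0 => x _; exact: expR_ge0.
(* Discarding the first k terms of S_n, at most k b in absolute value, costs e^(-|t| k b). What is
   left is S_(n-k) o T^k, whose moment against g is that of S_(n-k) against P^k g. *)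
have Sle : expR (- (`|t| * (k%:R * b))) * E nu ((fun x => expR (t * S (n - k) x)) \o iter k T)
    <= E nu (fun x => expR (t * S n x)).
  rewrite /E -RintegralZl//; last exact: bm_integrable_prob.
  apply: le_Rintegral => //; [apply: bm_integrable_prob; exact: bmZ|exact: bm_integrable_prob|].
  move=> x _ /=; rewrite -expRD ler_expR -{2}(subnKC kn) /S birkhoffD mulrDr lerD2r.
  rewrite lerNl (le_trans (ler_norm _))// normrN normrM ler_wpM2l//.
  exact: birkhoff_le.
apply: le_trans Sle; rewrite -mulrA ler_wpM2l ?expR_ge0//; apply: le_trans low.
rewrite mulrAC ler_wpM2r// -expRD ler_expR natrB// le_eqVlt.
by apply/orP; left; apply/eqP; ring.
Qed.

End TransferOperator.

(** * Variance *)

(** The square of 1 + x/2 <= e^(x/2), whose left side is nonnegative for x >= -2. *)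
Lemma expR_ge_quadratic (R : realType) (x : R) : -2 <= x ->
  1 + x + x ^+ 2 / 4 <= expR x.
Proof.
move=> x2; have -> : expR x = expR (x / 2) ^+ 2.
  by rewrite -expRM_natl; congr expR; field.
have -> : 1 + x + x ^+ 2 / 4 = (1 + x / 2) ^+ 2 by field.
by rewrite lerXn2r ?nnegrE ?expR_ge0 ?expR_ge1Dx//; lra.
Qed.

Section Variance.
Context {d : measure_display} {X : measurableType d} {R : realType}.
Variables (mu : probability X R) (T : X -> X) (phi : X -> R).
Hypothesis T_meas : measurable_fun setT T.
Hypothesis phi_bm : bounded_measurable phi.

Let E (G : X -> R) := Rintegral mu setT G.
Let S := birkhoff_sum T phi.

Hypothesis inv : forall G, bounded_measurable G -> E (G \o T) = E G.
Hypothesis phi0 : E phi = 0.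

Let ED (f g : X -> R) : bounded_measurable f -> bounded_measurable g ->
  E (fun x => f x + g x) = E f + E g.
Proof. by move=> bf bg; rewrite /E RintegralD//; exact: bm_integrable_prob. Qed.

Let EZ k (f : X -> R) : bounded_measurable f -> E (fun x => k * f x) = k * E f.
Proof. by move=> bf; rewrite /E RintegralZl//; exact: bm_integrable_prob. Qed.

Let S_bm n : bounded_measurable (S n).
Proof. exact: birkhoff_bm. Qed.

Let ST_bm n : bounded_measurable (S n \o T).
Proof. exact: bm_comp. Qed.

Let sq_bm (f : X -> R) : bounded_measurable f ->
  bounded_measurable (fun x => f x ^+ 2).
Proof.
move=> bf; rewrite (_ : (fun x => _) = (fun x => f x * f x)); first exact: bmM.
by apply/funext => x; rewrite expr2.
Qed.

Lemma birkhoff_mean0 n : E (S n) = 0.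
Proof.
elim: n => [|n IH].
  have -> : S 0 = (fun x => 0 * phi x).
    by apply/funext => x; rewrite /S birkhoff0 mul0r.
  by rewrite EZ// mul0r.
have -> : S n.+1 = (fun x => phi x + (S n \o T) x).
  by apply/funext => x; rewrite /S birkhoffS.
by rewrite ED// inv// phi0 IH addr0.
Qed.

Let gam k := E (fun x => phi x * phi (iter k T x)).

Let phik_bm k : bounded_measurable (fun x => phi x * phi (iter k T x)).
Proof.
apply: bmM => //; have -> : (fun x => phi (iter k T x)) = phi \o iter k T by [].
by apply: bm_comp => //; exact: iter_measurable.
Qed.

Let cross n : E (fun x => phi x * S n (T x)) = \sum_(k < n) gam k.+1.
Proof.
elim: n => [|n IH].
  rewrite big_ord0 (_ : (fun x => _) = (fun x => 0 * phi x)) ?EZ ?mul0r//.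
  by apply/funext => x; rewrite /S birkhoff0 mulr0 mul0r.
have -> : (fun x => phi x * S n.+1 (T x))
    = (fun x => phi x * S n (T x) + phi x * phi (iter n.+1 T x)).
  apply/funext => x; rewrite -mulrDr /S -addn1 birkhoffD birkhoffS birkhoff0 addr0.
  by rewrite -iterSr addn1.
by rewrite ED ?IH ?big_ord_recr//; apply: bmM => //; exact: ST_bm.
Qed.

Let var n := E (fun x => S n x ^+ 2).

Let varS n : var n.+1 = var n + (gam 0 + 2 * \sum_(k < n) gam k.+1).
Proof.
rewrite /var.
have -> : (fun x => S n.+1 x ^+ 2) = (fun x => (phi x * phi (iter 0 T x)
     + 2 * (phi x * S n (T x))) + ((fun y => S n y ^+ 2) \o T) x).
  by apply/funext => x; rewrite /S birkhoffS /=; ring.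
have b1 : bounded_measurable (fun x => phi x * S n (T x)).
  by apply: bmM => //; exact: ST_bm.
have b2 := bmZ 2 b1; have b3 := sq_bm (S_bm n).
rewrite ED//; [|by apply: bmD => //; exact: (phik_bm 0)|exact: bm_comp].
by rewrite ED// ?EZ// ?inv// ?cross 1?addrC//; exact: (phik_bm 0).
Qed.

(** The increments of [var] are the partial sums of the Green-Kubo series gam 0 + 2 (gam 1 + gam 2 +
    ...), which converge geometrically to s2; their errors are summable. *)
Lemma variance_linear C th : 0 <= C -> 0 <= th < 1 ->
  (forall k, `|gam k| <= C * th ^+ k) ->
  exists s2 D, forall n, `|var n - n%:R * s2| <= D.
Proof.
move=> C0 th01 gamC; have /andP[th0 th1] := th01.
pose w n := gam 0 + 2 * \sum_(k < n) gam k.+1.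
have wS n : `|w n.+1 - w n| <= (2 * C) * th ^+ n.
  rewrite /w big_ord_recr/= [X in `|X|](_ : _ = 2 * gam n.+1); last by ring.
  rewrite normrM.
  rewrite ger0_norm// -mulrA ler_wpM2l// (le_trans (gamC _))// ler_wpM2l//.
  by rewrite exprS ler_piMl ?exprn_ge0// ltW.
have C20 : 0 <= 2 * C by rewrite mulr_ge0.
have [s2 Hs2] := geometric_cvg th01 C20 wS.
pose D := 2 * C / (1 - th) / (1 - th).
have th1' : 0 < 1 - th by rewrite subr_gt0.
have D0 : 0 <= D by rewrite /D divr_ge0 ?divr_ge0// ltW.
exists s2, D => n.
suff : `|var n - n%:R * s2| <= D * (1 - th ^+ n).
  by move=> /le_trans; apply; rewrite ler_piMr// gerBl exprn_ge0.
elim: n => [|n IH].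
  rewrite expr0 subrr mulr0 mul0r subr0 /var.
  rewrite (_ : (fun x => _) = (fun x => 0 * phi x)) ?EZ ?mul0r ?normr0//.
  by apply/funext => x; rewrite /S birkhoff0 expr0n mul0r.
rewrite varS -/(w n) -natr1 mulrDl mul1r opprD addrACA.
rewrite (le_trans (ler_normD _ _))// (le_trans (lerD IH (Hs2 n)))//.
rewrite exprS /D le_eqVlt; apply/orP; left; apply/eqP.
by field; rewrite gt_eqF.
Qed.

(** The linear term integrates to 0, and the condition on t keeps t S_n above -2, where the
    quadratic bound holds. *)
Lemma exponential_moment_ge n t M : (forall x, `|phi x| <= M) ->
  `|t| * (n%:R * M) <= 2 -> 1 + t ^+ 2 * var n / 4 <= E (fun x => expR (t * S n x)).
Proof.
move=> phiM tM.
have b1 := bm_cst (1 : R) : bounded_measurable (cst 1 : X -> R).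
have b2 := bmZ t (S_bm n); have b3 := bmZ (t ^+ 2 / 4) (sq_bm (S_bm n)).
have E1 : E (cst 1) = 1.
  rewrite /E (_ : cst 1 = \1_setT) ?Rintegral_indic// ?probability_setT//.
  by apply/funext => x; rewrite indicE in_setT.
have -> : 1 + t ^+ 2 * var n / 4
    = E (fun x => (cst 1 x + t * S n x) + t ^+ 2 / 4 * S n x ^+ 2).
  rewrite ED//; last exact: bmD.
  rewrite ED// E1 EZ// birkhoff_mean0 mulr0 addr0 EZ; last exact: sq_bm.
  by rewrite /var; ring.
apply: le_Rintegral => //; [apply: bm_integrable_prob|apply: bm_integrable_prob|].
- by apply: bmD => //; exact: bmD.
- exact: (bm_expR b2).
move=> x _; have : - 2 <= t * S n x.
  rewrite lerNl (le_trans (ler_norm _))// normrN normrM (le_trans _ tM)//.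
  by rewrite ler_wpM2l//; exact: birkhoff_le.
move=> /expR_ge_quadratic; rewrite exprMn /=.
by rewrite (_ : t ^+ 2 * S n x ^+ 2 / 4 = t ^+ 2 / 4 * S n x ^+ 2)//; ring.
Qed.

Lemma exponential_moment_ge1 n t : 1 <= E (fun x => expR (t * S n x)).
Proof.
have b1 := bm_cst (1 : R) : bounded_measurable (cst 1 : X -> R).
have b2 := bmZ t (S_bm n).
have E1 : E (cst 1) = 1.
  rewrite /E (_ : cst 1 = \1_setT) ?Rintegral_indic// ?probability_setT//.
  by apply/funext => x; rewrite indicE in_setT.
have <- : E (fun x => cst 1 x + t * S n x) = 1.
  by rewrite ED// E1 EZ// birkhoff_mean0 mulr0 addr0.
apply: le_Rintegral => //; [apply: bm_integrable_prob|apply: bm_integrable_prob|].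
- exact: bmD.
- exact: (bm_expR b2).
by move=> x _; exact: expR_ge1Dx.
Qed.

End Variance.

Theorem theorem1 (R : realType) (d : measure_display) (X : measurableType d)
  (m : probability X R) (T : X -> X)
  (T_meas : measurable_fun setT T) (T_nonsing : nonsingular m T)
  (P : (X -> R[i]) -> X -> R[i]) (P_PF : perron_frobenius m T P)
  (B : completeNormedModType R[i]) (iota : B -> X -> R[i])
  (B_L1 : L1_subspace m iota)
  (B_incl : continuous_inclusion m iota)
  (B_const : contains_constants m iota)
  (B_alg : banach_algebra m iota)
  (B_lat : complex_banach_lattice m iota)
  (PB : {linear B -> B}) (PB_restr : restriction_of m iota P PB)
  (PB_bounded : continuous PB) (PB_radius : spectral_radius PB = 1%E)
  (PB_qc : quasi_compact_diagonal PB)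
  (one_simple : simple_eigenvalue PB 1)
  (one_only : forall l : R[i], eigenvalue_of PB l -> `|l| = 1 -> l = 1)
  (mu : probability X R)
  (mu_inv : invariant_measure mu T) (mu_dens : density_in_space m iota mu)
  (phi : X -> R) (phi_meas : measurable_fun setT phi)
  (phi_bounded : exists M : R, forall x, `|phi x| <= M)
  (phi_B : mem_space m iota (fun x => (phi x)%:C))
  (phi_mean : (\int[mu]_x (phi x)%:E = 0)%E) :
  exists sigma2 : R,
    ((\int[mu]_x ((birkhoff_sum T phi n x / Num.sqrt n%:R) ^+ 2)%:E)%E
       @[n --> \oo] --> sigma2%:E) /\
    (0 < sigma2 ->
     exists (eps0 : R) (c : R -> R),
       [/\ 0 < eps0,
           {within `]- eps0, eps0[, continuous c},
           strictly_convex_on `]- eps0, eps0[ c,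
           forall x : R, - eps0 < x < eps0 -> (c x = 0 <-> x = 0) &
           forall (eps : R) (nu : probability X R),
             0 < eps < eps0 -> density_in_space m iota nu ->
             ((n%:R^-1)%:E *
              lne (nu [set x | (n%:R * eps < birkhoff_sum T phi n x)%R]))%E
               @[n --> \oo] --> (- c eps)%:E]).
Proof.
have phi_bm : bounded_measurable phi by [].
have phi0 : Rintegral mu setT phi = 0 by rewrite /Rintegral phi_mean.
clear phi_mean PB_radius.
have inv := invariant_expectation T_meas P_PF B_L1 PB_restr mu_inv mu_dens.
have [C0 [th [C00 [th01 decay]]]] := correlation_decay T_meas P_PF B_L1 B_incl
  B_alg PB_restr PB_qc one_simple one_only mu_inv mu_dens phi_bm phi_B phi0.
have [s2 [D HD]] := variance_linear T_meas phi_bm inv C00 th01 decay.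
have S_bm n := birkhoff_bm T_meas phi_bm n.
set S := birkhoff_sum T phi in HD S_bm *.
exists s2; split.
  have sq n : (0 < n)%N -> (\int[mu]_x ((S n x / Num.sqrt n%:R) ^+ 2)%:E)%E
      = ((Rintegral mu setT (fun x => S n x ^+ 2)) / n%:R)%:E.
    move=> n0.
    have b2 : bounded_measurable (fun x => n%:R^-1 * (S n x * S n x)).
      by apply: bmZ; exact: bmM.
    have -> : (fun x => ((S n x / Num.sqrt n%:R) ^+ 2)%:E)
        = EFin \o (fun x => n%:R^-1 * (S n x * S n x)).
      apply/funext => x /=; rewrite exprMn exprVn sqr_sqrtr//.
      by rewrite mulrC expr2.
    rewrite -[LHS]fineK; last exact: integrable_fin_num (bm_integrable_prob mu b2).
    congr (_%:E); rewrite -[LHS]/(Rintegral mu setT _) RintegralZl//.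
      by rewrite mulrC.
    by apply: bm_integrable_prob; exact: bmM.
  apply/fine_cvgP; split; first by exists 1%N => // n n0 /=; rewrite sq.
  apply/cvgrPdist_le => e e0.
  exists (Num.truncn (D / e)).+1 => // n /= nD.
  have n0 : (0 < n)%N by apply: leq_trans nD.
  have nR : 0 < n%:R :> R by rewrite ltr0n.
  rewrite sq//= -(ler_pM2l nR) -{1}(ger0_norm (ltW nR)) -normrM.
  rewrite mulrBr mulrCA divff ?gt_eqF// mulr1 distrC (le_trans (HD n))//.
  rewrite -ler_pdivrMr// ltW// (lt_le_trans (truncnS_gt _))//.
  by rewrite ler_nat.
move=> s20.
have [t1 [C [L [G [t10 [C_ge0 [GC Lsc Lup Llow Lnu]]]]]]] :=
  exponential_moment_growth T_meas P_PF B_L1 B_incl B_alg PB_restr PB_bounded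
    PB_qc one_simple one_only mu_inv mu_dens phi_bm phi_B.
have Ege1 n t := exponential_moment_ge1 T_meas phi_bm inv phi0 n t.
rewrite -/S in Ege1.
have expX n x : expR (n%:R * x) = expR x ^+ n by rewrite expRM_natl.
(* If L t < 0, the upper growth bound would send the moments to 0, yet they are at least 1. *)
have L_ge0 t : `|t| < t1 -> 0 <= L t.
  move=> tt; rewrite leNgt; apply/negP => Lt0.
  have th' : 0 <= expR (L t) < 1 by rewrite expR_ge0 -expR0 ltr_expR.
  have : 1 <= (0 : R).
    apply: (@geometric_le _ _ _ (1 + C * t ^+ 2) (expR (L t))) => // n.
    by rewrite add0r -expX mulrC (le_trans (Ege1 n t))// Lup.
  by rewrite ler10.
(* At t = 0 every moment equals 1, which the lower growth bound forbids if L 0 > 0. *)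
have L0 : L 0 = 0.
  have tt : `|0 : R| < t1 by rewrite normr0.
  apply/eqP; rewrite eq_le L_ge0// andbT leNgt; apply/negP => Lt0.
  have th' : 0 <= expR (- L 0) < 1.
    by rewrite expR_ge0 -expR0 ltr_expR oppr_lt0.
  have : 1 <= (0 : R).
    apply: (@geometric_le _ _ _ 2 (expR (- L 0))) => // n.
    have := Lup 0 n tt; have := Llow 0 tt n.
    have -> : Rintegral mu setT (fun x => expR (0 * S n x)) = 1.
      rewrite (_ : (fun x => _) = \1_setT) ?Rintegral_indic ?probability_setT//.
      by apply/funext => x; rewrite mul0r expR0 indicE in_setT.
    rewrite -expX mulrN expRN add0r => h _.
    by rewrite ler_pdivlMr ?expR_gt0//; lra.
  by rewrite ler10.
have [M phiM] := phi_bounded.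
have M0 : 0 <= M by apply: le_trans (phiM point).
(* C does not depend on n while the variance grows like n s2. This n stays fixed from here on and
   determines [tau]. *)
have [n Hn] : exists n, 4 * C < Rintegral mu setT (fun x => S n x ^+ 2).
  exists (Num.truncn ((4 * C + D) / s2)).+1.
  have := HD (Num.truncn ((4 * C + D) / s2)).+1.
  have := truncnS_gt ((4 * C + D) / s2).
  set k := _.+1; rewrite ltr_pdivrMr// ler_norml => h /andP[h1 _]; lra.
(* The second bound gives |t| n M <= 2 at |t| = tau, as [exponential_moment_ge] requires. *)
pose tau := Num.min (t1 / 2) (2 / (n%:R * M + 1)).
have nM : 0 <= n%:R * M by rewrite mulr_ge0.
have nM1 : 0 < n%:R * M + 1 by lra.
have tau0 : 0 < tau by rewrite lt_min !divr_gt0.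
have tau1 : tau <= t1 / 2 by rewrite ge_min lexx.
have tau2 : tau * (n%:R * M + 1) <= 2.
  by rewrite -ler_pdivlMr// ge_min lexx orbT.
have tau01 : 0 < tau < t1 by apply/andP; split; lra.
(* Were L t <= 0, the two moment bounds would give 1 + t^2 var_n / 4 <= 1 + C t^2, against the
   choice of n. *)
have L_pos t : `|t| = tau -> 0 < L t.
  move=> tt; have tlt : `|t| < t1 by rewrite tt; case/andP: tau01.
  have t2 : 0 < t ^+ 2 by rewrite exprn_even_gt0//= -normr_gt0 tt.
  have tM : `|t| * (n%:R * M) <= 2.
    by rewrite tt (le_trans _ tau2)// ler_wpM2l ?ltW//; lra.
  have low := exponential_moment_ge T_meas phi_bm inv phi0 phiM tM.
  have up := Lup t n tlt; rewrite -/S in low; rewrite -/S in up.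
  rewrite ltNge; apply/negP => Lt0.
  have e1 : expR (n%:R * L t) <= 1.
    by rewrite -expR0 ler_expR mulr_ge0_le0.
  have h1 : expR (n%:R * L t) * (1 + C * t ^+ 2) <= 1 + C * t ^+ 2.
    by rewrite ler_piMl// addr_ge0// mulr_ge0 ?sqr_ge0.
  have := ltr_pM2l t2 (4 * C) (Rintegral mu setT (fun x => S n x ^+ 2)).
  by rewrite Hn => h2; lra.
have [e0 [c [e00 c_cont c_conv c_zero [c_lip c_max]]]] :=
  legendre_rate tau01 C_ge0 GC Lsc L0 L_ge0 (L_pos tau (gtr0_norm tau0))
    (L_pos (- tau) (etrans (normrN _) (gtr0_norm tau0))).
exists e0, c; split=> //; first exact: continuous_subspaceT.
move=> eps nu epse nud.
exact: (large_deviation_limit S_bm tau01 C_ge0 c_lip c_max (Lnu nu nud) epse).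
Qed.
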